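(* Let $X$ be a compact Hausdorff space. Then $HX$ is an absolute retract if and only if $X$ is an openly generated compactum of weight $\le\omega_1$.
   Context: For a compact Hausdorff space $X$, let $HM(X)$ be the set of all maps $\alpha:[0,1)\to X$ for which there exist $0=t_0<t_1<\dots<t_n=1$ such that $\alpha$ is constant on each $[t_i,t_{i+1})$. Let $C(X)$ be the set of continuous real-valued functions on $X$. For $\varphi\in C(X)$ and $0\le a<b\le 1$ define $\varphi_{(a,b)}:HM(X)\to\mathbb{R}$ by $\varphi_{(a,b)}(\alpha)=\frac{1}{b-a}\int_a^b\varphi(\alpha(t))\,dt$, and let $S_{HM}(X)$ be the set of all such functions. The map $\alpha\mapsto(\varphi_{(a,b)}(\alpha))_{\varphi_{(a,b)}\in S_{HM}(X)}$ embeds $HM(X)$ into the product $\prod_{\varphi_{(a,b)}\in S_{HM}(X)}[\min\varphi,\max\varphi]$ (product topology); $HX$ is the closure of the image of $HM(X)$ in this product. A partially ordered set is $\omega$-complete if every countable subset has a least upper bound. An $\omega$-system is a continuous inverse system of compacta of weight $\le\omega$ (i.e. metrizable) with surjective bonding maps, indexed by an $\omega$-complete directed set. A compactum $X$ is openly generated if $X$ is the limit of an $\omega$-system whose bonding maps are open. *)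

(* Defs.v *)
From HB Require Import structures.
From mathcomp Require Import all_boot all_order all_algebra.
From mathcomp Require Import all_classical all_reals all_analysis.
Set Implicit Arguments. Unset Strict Implicit. Unset Printing Implicit Defensive.
Import Order.TTheory GRing.Theory Num.Theory.
Import numFieldNormedType.Exports.
Local Open Scope classical_set_scope.
Local Open Scope ring_scope.

(* alpha : R -> X is in HM(X): only its values on [0,1) matter; it is
   constant on each [t_i, t_{i+1}) for some partition 0 = t_0 < ... < t_n = 1. *)
Definition is_HM (R : realType) (X : Type) (alpha : R -> X) : Prop :=
  exists (n : nat) (t : nat -> R),
    t 0%N = 0 /\ t n = 1 /\ (forall i, (i < n)%N -> t i < t i.+1) /\
    (forall i, (i < n)%N -> forall s, t i <= s -> s < t i.+1 -> alpha s = alpha (t i)).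

Definition HM (R : realType) (X : Type) := {alpha : R -> X | is_HM alpha}.

Definition SHM_index (R : realType) (X : topologicalType) :=
  {p : (X -> R) * R * R | continuous p.1.1 /\ 0 <= p.1.2 /\ p.1.2 < p.2 /\ p.2 <= 1}.

Definition phi_ab (R : realType) (X : topologicalType) (s : SHM_index R X)
  (alpha : R -> X) : R :=
  let: (phi, a, b) := sval s in
  (b - a)^-1 * (\int[@lebesgue_measure R]_(t in `[a, b]) phi (alpha t)).

Definition HXspace (R : realType) (X : topologicalType) : topologicalType :=
  {ptws SHM_index R X -> R^o}.

Definition HM_embed (R : realType) (X : topologicalType) (alpha : HM R X)
  : HXspace R X := fun s => phi_ab s (sval alpha).

(* HX: the closure of the image of HM(X).  Since the image lies in the closed
   subspace prod [min phi, max phi] of R^S, its closure there coincides with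
   its closure in R^S. *)
Definition HX (R : realType) (X : topologicalType) : set (HXspace R X) :=
  closure (range (@HM_embed R X)).

Definition absolute_retract (T : topologicalType) (K : set T) : Prop :=
  forall (Y : topologicalType), compact [set: Y] -> hausdorff_space Y ->
  forall e : T -> Y, {within K, continuous e} -> {in K &, injective e} ->
  exists r : Y -> T, continuous r /\ (forall y, K (r y)) /\
                     (forall x, K x -> r (e x) = x).

Definition is_base (T : topologicalType) (B : set (set T)) : Prop :=
  (forall U, B U -> open U) /\
  (forall U x, open U -> U x -> exists V, B V /\ V x /\ V `<=` U).

Definition weight_le_omega (T : topologicalType) : Prop :=
  exists B : set (set T), is_base B /\ countable B.

(* |B| <= aleph_1: B carries a well-order all of whose proper initial segments
   are countable (i.e. B order-embeds as an initial segment of omega_1). *)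
Definition card_le_aleph1 (U : Type) (B : set U) : Prop :=
  exists r : U -> U -> Prop,
    (forall x, B x -> ~ r x x) /\
    (forall x y z, B x -> B y -> B z -> r x y -> r y z -> r x z) /\
    (forall x y, B x -> B y -> x = y \/ r x y \/ r y x) /\
    (forall C, C `<=` B -> C !=set0 ->
        exists m, C m /\ forall y, C y -> ~ r y m) /\
    (forall x, B x -> countable [set y | B y /\ r y x]).

Definition weight_le_omega1 (T : topologicalType) : Prop :=
  exists B : set (set T), is_base B /\ card_le_aleph1 B.

Definition is_lub (A : Type) (le : A -> A -> Prop) (C : set A) (s : A) : Prop :=
  (forall c, C c -> le c s) /\ (forall u, (forall c, C c -> le c u) -> le s u).

Definition omega_system (A : Type) (le : A -> A -> Prop)
  (Xs : A -> topologicalType) (p : forall a b : A, Xs b -> Xs a) : Prop :=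
  (forall a, le a a) /\
  (forall a b c, le a b -> le b c -> le a c) /\
  (forall a b, le a b -> le b a -> a = b) /\
  (exists a : A, True) /\
  (forall a b, exists c, le a c /\ le b c) /\
  (forall C : set A, C !=set0 -> countable C -> exists s, is_lub le C s) /\
  (forall a, compact [set: Xs a] /\ hausdorff_space (Xs a) /\ weight_le_omega (Xs a)) /\
  (forall a b, le a b -> continuous (p a b) /\ (forall y : Xs a, exists x : Xs b, p a b x = y)) /\
  (forall a (x : Xs a), p a a x = x) /\
  (forall a b c, le a b -> le b c -> forall x : Xs c, p a b (p b c x) = p a c x) /\
  (* continuity of the system: for every directed B with supremum beta,
     X_beta is (naturally) the limit of the subsystem indexed by B *)
  (forall (B : set A) (beta : A), B !=set0 ->
     (forall a b, B a -> B b -> exists c, B c /\ le a c /\ le b c) ->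
     is_lub le B beta ->
     forall x : forall a, Xs a,
       (forall a b, B a -> B b -> le a b -> p a b (x b) = x a) ->
       exists y : Xs beta, (forall a, B a -> p a beta y = x a) /\
         (forall y' : Xs beta, (forall a, B a -> p a beta y' = x a) -> y' = y)).

Definition system_limit (A : Type) (le : A -> A -> Prop)
  (Xs : A -> topologicalType) (p : forall a b : A, Xs b -> Xs a)
  : set (prod_topology Xs) :=
  [set x | forall a b, le a b -> p a b (x b) = x a].

Definition homeomorphic_to_subspace (T T' : topologicalType) (L : set T') : Prop :=
  exists (f : T -> T') (g : T' -> T),
    continuous f /\ (forall x, L (f x)) /\ (forall x, g (f x) = x) /\
    (forall y, L y -> f (g y) = y) /\ {within L, continuous g}.

Definition openly_generated (X : topologicalType) : Prop :=
  exists (A : Type) (le : A -> A -> Prop) (Xs : A -> topologicalType)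
         (p : forall a b : A, Xs b -> Xs a),
    @omega_system A le Xs p /\
    (forall a b, le a b -> forall U : set (Xs b), open U -> open (p a b @` U)) /\
    homeomorphic_to_subspace X (@system_limit A le Xs p).

(* Main.v *)
Require Import Defs.
From HB Require Import structures.
From mathcomp Require Import all_boot all_order all_algebra.
From mathcomp Require Import generic_quotient.
From mathcomp Require wochoice.
From mathcomp Require Import all_classical all_reals all_analysis.
From mathcomp Require Import ring lra.
Set Implicit Arguments. Unset Strict Implicit. Unset Printing Implicit Defensive.
Import Order.TTheory GRing.Theory Num.Theory.
Import numFieldNormedType.Exports.
Local Open Scope classical_set_scope.
Local Open Scope ring_scope.

(** A point of [HX] amounts to a measure on [[0,1] x X] with Lebesgue marginal.

    Sufficiency.  Write [X] as the limit of an increasing well-ordered chain of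
    open metrizable quotients all of whose initial segments are countable.  Given
    an embedding of [HX] in [Y], extend the coordinates to [Y] by Tietze and, along
    the chain, successively project onto the fibres of the restriction maps by
    minimising a weighted sum of squares of countably many coordinates.  The graph
    of the resulting map is closed: the first-order optimality condition bounds a
    linear functional from below on a fibre, and over an open quotient the fibrewise
    minimum of such a functional is again given by continuous coordinates.

    Necessity.  Embed [HX] in a Tychonoff cube.  The coordinates of a retraction [r]
    of the cube onto [HX] depend on countably many coordinates, so there are many
    families [Phi] of functions on [X] such that the [Phi]-coordinates of [r] depend
    on [Phi]-coordinates only.  Perturbing a point on the [Phi]-coordinates and
    applying [r] shows that the quotient of [X] by such a family is open; the
    countable ones yield an omega-system.  Prescribing a rapidly oscillating step
    function on [A] and a constant mixture on [B] shows that points not separated by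
    [A `&` B] are not separated by [A] or not separated by [B].  Together with a
    closing-off argument along a chain of length omega_1 of countable families this
    bounds the weight. *)

(** * Topological preliminaries *)

(** Why squares: a minimiser of a convex quadratic over a fibre is characterised by [good], an
    inequality linear in the competitor, and over an open quotient the fibrewise minimum of a linear
    functional varies continuously ([fibre_min]). All stages together form one closed relation
    between [HX] and [Y] with exactly one solution over each point of [Y], so the retraction is
    continuous by [closed_graph_continuous] and no continuity is carried along the chain. Countable
    initial segments let each stage be controlled by a single index of the omega-system: this is how
    weight at most omega_1 enters. For the converse, coordinates outside a closed family can be
    prescribed at will in the cube without changing the coordinates of [r] in the family. The weight
    bound is by contradiction: if the chain left two points unseparated, every point of some open
    set would be [full] at a countable stage, and a stage of countable cofinality would make that
    whole set full, although later stages must still split some class meeting it. *)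

Section Topology.

(** The form in which compactness is used throughout: if a property failed at every index, the
    failing sets would be closed and directed, and a common point would refute the limiting
    statement. *)
Lemma compact_directed_inter (T : topologicalType) (K : set T) (I : Type)
    (F : I -> set T) (i0 : I) :
  compact K -> (forall i, closed (F i)) ->
  (forall i j, exists k, F k `<=` F i `&` F j) ->
  (forall i, K `&` F i !=set0) -> exists x, K x /\ forall i, F i x.
Proof.
move=> cK clF dF neF.
pose G := filter_from [set: I] (fun i => K `&` F i).
have PG : ProperFilter G.
  apply: filter_from_proper => [|i _]; last exact: neF.
  apply: filter_from_filter; first by exists i0.
  move=> i j _ _; have [k Fk] := dF i j; exists k => // x [Kx /Fk[? ?]].
  by split.
have GK : G K by exists i0 => // x [].
have [x [Kx xG]] := cK G PG GK; exists x; split=> // i.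
apply: (clF i) => B Bx.
have [|y [[_ Fy] By]] := xG (K `&` F i) B _ Bx; first by exists i.
by exists y.
Qed.

(** A tube argument: over [y] the graph meets the compact [K] only in [f y], so over nearby points
    it stays inside any given neighbourhood of [f y]. *)
Lemma closed_graph_continuous (Y T : topologicalType) (K : set T)
    (G : set (T * Y)) (f : Y -> T) :
  compact K -> closed G -> (forall y, K (f y)) -> (forall y, G (f y, y)) ->
  (forall y z, K z -> G (z, y) -> z = f y) -> continuous f.
Proof.
move=> /compact_near_coveringP cK clG Kf Gf uf y U Uy.
have : \forall y' \near y, K `<=` (fun z => ~ G (z, y') \/ U z).
  apply: cK => z Kz.
  have [zE|zNE] := pselect (z = f y).
    exists (U, setT); first by split; [rewrite zE|exact: filterT].
    by move=> [z' y'] /= [Uz' _]; right.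
  have nG : nbhs (z, y) (~` G).
    by apply: open_nbhs_nbhs; split; [exact: closed_openC|move=> /(uf _ _ Kz)].
  case: nG => -[A B] /= [Az By] ABG; exists (A, B) => //= -[z' y'] /= ABzy.
  by left; exact: (ABG (z', y')).
by apply: filterS => y' /(_ _ (Kf y'))[/(_ (Gf y'))|].
Qed.

Lemma compact_bound (R : realType) (X : topologicalType) (phi : X -> R) :
  compact [set: X] -> continuous phi -> exists M, 0 < M /\ forall x, `|phi x| <= M.
Proof.
move=> cX cphi.
have [X0|X0] := pselect ([set: X] !=set0); last first.
  by exists 1; split=> // x; case: X0; exists x.
have [c _ cmax] := @compact_EVT_max X R (fun x => `|phi x|) setT X0 cX
  (continuous_subspaceT (fun x => continuous_comp (cphi x) (@norm_continuous _ R _))).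
exists (`|phi c| + 1); split=> [|x]; first by rewrite ltr_wpDl.
by rewrite ler_wpDr// cmax// inE.
Qed.

Lemma compact_min (R : realType) (T : topologicalType) (f : T -> R) (K : set T) :
  K !=set0 -> compact K -> continuous f -> exists c, K c /\ forall x, K x -> f c <= f x.
Proof.
move=> K0 cK cf.
have [c cK' cmin] := compact_EVT_min K0 cK (continuous_subspaceT cf).
by exists c; split=> [|x Kx]; [rewrite inE in cK'|apply: cmin; rewrite inE].
Qed.

Lemma ptws_proj_continuous (I : Type) (K : I -> topologicalType) (i : I) :
  continuous (fun f : prod_topology K => f i).
Proof. by move=> f; apply: (@proj_continuous {classic I} K i). Qed.

Lemma ptws_cvg_continuous (T : topologicalType) (I : Type)
    (K : I -> topologicalType) (f : T -> prod_topology K) :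
  (forall i, continuous (fun x => f x i)) -> continuous f.
Proof.
move=> cf x; apply/cvg_sup => i.
move=> U [_ [[V oV <-] /= Vfx]] VU.
have nV : nbhs x (fun y => V (f y i)).
  exact: (cf i x V (open_nbhs_nbhs (conj oV Vfx))).
exact: (@filterS _ (nbhs x) _ _ _ (fun y (Vy : V (f y i)) => VU (f y) Vy) nV).
Qed.

Lemma cst_cont (R : realType) (T : topologicalType) (k : R) :
  continuous (fun _ : T => k).
Proof. by move=> x; exact: cvg_cst. Qed.

Lemma comp_cont (T U V : topologicalType) (f : T -> U) (g : U -> V) :
  continuous f -> continuous g -> continuous (fun x => g (f x)).
Proof. by move=> cf cg x; apply: continuous_comp; [exact: cf|exact: cg]. Qed.

Lemma add_cont (R : realType) (T : topologicalType) (f g : T -> R) :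
  continuous f -> continuous g -> continuous (fun x => f x + g x).
Proof. by move=> cf cg x; apply: (@continuousD R R^o); [exact: cf|exact: cg]. Qed.

Lemma sub_cont (R : realType) (T : topologicalType) (f g : T -> R) :
  continuous f -> continuous g -> continuous (fun x => f x - g x).
Proof. by move=> cf cg x; apply: (@continuousB R R^o); [exact: cf|exact: cg]. Qed.

Lemma mul_cont (R : realType) (T : topologicalType) (f g : T -> R) :
  continuous f -> continuous g -> continuous (fun x => f x * g x).
Proof. by move=> cf cg x; apply: (@continuousM _ T); [exact: cf|exact: cg]. Qed.

Lemma scale_cont (R : realType) (T : topologicalType) (k : R) (f : T -> R) :
  continuous f -> continuous (fun x => k * f x).
Proof. by move=> cf; apply: mul_cont => //; exact: cst_cont. Qed.

Lemma max_cont (R : realType) (T : topologicalType) (f g : T -> R) :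
  continuous f -> continuous g -> continuous (fun x => Num.max (f x) (g x)).
Proof. by move=> cf cg x; apply: continuous_max; [exact: cf|exact: cg]. Qed.

Lemma sum_cont (R : realType) (T : topologicalType) (I : Type) (r : seq I)
    (P : pred I) (f : I -> T -> R) :
  (forall i, P i -> continuous (f i)) ->
  continuous (fun x => \sum_(i <- r | P i) f i x).
Proof.
move=> cf; elim: r => [|i r IH].
  by under eq_fun do rewrite big_nil; exact: cst_cont.
under eq_fun do rewrite big_cons.
by case: (boolP (P i)) => // Pi; apply: add_cont => //; exact: cf.
Qed.

Lemma closed_eq_real (R : realType) (T : topologicalType) (f g : T -> R) :
  continuous f -> continuous g -> closed [set x | f x = g x].
Proof.
move=> cf cg.
rewrite (_ : [set x | f x = g x] = (fun x => f x - g x) @^-1` [set 0]).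
  have /continuous_closedP : continuous (fun x => f x - g x); last apply.
    exact: sub_cont.
  exact: closed_eq.
by apply/seteqP; split=> x /= => [->|/subr0_eq//]; rewrite subrr.
Qed.

Lemma closed_le_real (R : realType) (T : topologicalType) (f g : T -> R) :
  continuous f -> continuous g -> closed [set x | f x <= g x].
Proof.
move=> cf cg.
rewrite (_ : [set x | f x <= g x] = (fun x => g x - f x) @^-1` [set y | 0 <= y]).
  have /continuous_closedP : continuous (fun x => g x - f x); last apply.
    exact: sub_cont.
  exact: closed_ge.
by apply/seteqP; split=> x /=; rewrite subr_ge0.
Qed.

Lemma open_lt_real (R : realType) (T : topologicalType) (f g : T -> R) :
  continuous f -> continuous g -> open [set x | f x < g x].
Proof.
move=> cf cg; rewrite -[X in open X]setCK openC.
rewrite (_ : ~` _ = [set x | g x <= f x]); first exact: closed_le_real.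
by apply/seteqP; split=> x /=; rewrite leNgt => /negP.
Qed.

Lemma urysohn_fun (R : realType) (X : topologicalType) (A B : set X) :
  compact [set: X] -> hausdorff_space X -> closed A -> closed B ->
  A `&` B = set0 ->
  exists f : X -> R, [/\ continuous f, forall x, 0 <= f x <= 1,
    forall x, A x -> f x = 0 & forall x, B x -> f x = 1].
Proof.
move=> cX hX cA cB AB.
have [f [cf f0 f1 f01]] := @urysohn_ext_itv X R (compact_normal hX cX) A B 0 1 cA cB AB ltr01.
exists f; split=> // x.
- by have := f01 (f x); rewrite /= in_itv /=; apply; exists x.
- by move=> Ax; apply: f0; exists x.
- by move=> Bx; apply: f1; exists x.
Qed.

Lemma continuous_separates (R : realType) (X : topologicalType) (x y : X) :
  compact [set: X] -> hausdorff_space X -> x <> y ->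
  exists phi : X -> R, continuous phi /\ phi x <> phi y.
Proof.
move=> cX hX xy.
have cl (z : X) : closed [set z].
  exact: accessible_closed_set1 (hausdorff_accessible hX) z.
have [|phi [cphi _ phix phiy]] := @urysohn_fun R X [set x] [set y] cX hX (cl x) (cl y).
  by apply/seteqP; split=> // z [/= ->] /xy.
exists phi; split=> //; rewrite phix// phiy// => /eqP.
by rewrite eq_sym oner_eq0.
Qed.

End Topology.

(** * Coordinates of points of HX *)

Section StepFunctions.
Variables (R : realType).

Lemma is_HM_comp (X Y : Type) (f : X -> Y) (alpha : R -> X) :
  is_HM alpha -> is_HM (f \o alpha).
Proof.
move=> [n [t [t0 [t1 [tlt tc]]]]]; exists n, t; split=> //; split=> //; split=> //.
by move=> i ilt s s1 s2; rewrite /= (tc i).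
Qed.

Lemma is_HM_cst (X : Type) (x : X) : is_HM (fun _ : R => x).
Proof.
exists 1%N, (fun i => i%:R); split=> //; split=> //; split=> //.
by move=> i _; rewrite ltr_nat.
Qed.

Lemma is_HM_measurable (f : R -> R) : is_HM f -> measurable_fun (`[0, 1] : set R) f.
Proof.
move=> [n [t [t0 [t1 [tlt tc]]]]].
have t_ge0 i : (i <= n)%N -> 0 <= t i.
  elim: i => [|i IH] ilt; first by rewrite t0.
  by rewrite (le_trans (IH (ltnW ilt)))// ltW// tlt.
have mf i : (i <= n)%N -> measurable_fun (`[0, t i[ : set R) f.
  elim: i => [|i IH] ilt.
    by rewrite t0 set_itvco0; exact: measurable_fun_set0.
  have -> : `[0, t i.+1[%classic = `[0, t i[ `|` `[t i, t i.+1[.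
    apply/seteqP; split=> x /=; rewrite !in_itv /=.
      by move=> /andP[-> ->]; case: (ltP x (t i)) => _; [left|right].
    move=> [/andP[-> xlt]|/andP[xge ->]] /=; first exact: (lt_trans xlt (tlt _ ilt)).
    by rewrite (le_trans (t_ge0 i (ltnW ilt)) xge).
  apply/measurable_funU => //; split; first exact: IH (ltnW ilt).
  apply: (eq_measurable_fun (fun=> f (t i))) => [x|]; last exact: measurable_cst.
  by rewrite inE /= in_itv /= => /andP[x1 x2]; rewrite (tc i).
have -> : `[0, 1]%classic = `[0, (1:R)[ `|` [set 1].
  apply/seteqP; split=> x /=; rewrite !in_itv /=.
    by rewrite [x <= 1]le_eqVlt => /andP[-> /orP[/eqP ->|->]]; [right|left].
  by move=> [/andP[-> /ltW]|->] //; rewrite ler01 lexx.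
apply/measurable_funU => //; split; last exact: measurable_fun_set1.
by rewrite -t1; exact: mf.
Qed.

Variable X : topologicalType.
Hypothesis cX : compact [set: X].

Lemma HM_integrable (phi : X -> R) (alpha : R -> X) :
  continuous phi -> is_HM alpha ->
  (@lebesgue_measure R).-integrable (`[0, 1] : set R) (EFin \o (phi \o alpha)).
Proof.
move=> cphi ha; apply: measurable_bounded_integrable => //.
- have := @lebesgue_measure_itv R (`[0, 1]).
  by rewrite /= lte_fin ltr01 -EFinB subr0 => ->; exact: ltry.
- by apply: is_HM_measurable; apply: is_HM_comp.
have [M [_ bM]] := compact_bound cX cphi.
exists M; split; first exact: num_real.
by move=> N MN y _ /=; apply: (le_trans (bM _)); exact: ltW.
Qed.

Lemma HM_integrable_sub (phi : X -> R) (alpha : R -> X) a b u v :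
  continuous phi -> is_HM alpha -> 0 <= a -> b <= 1 ->
  (@lebesgue_measure R).-integrable [set` Interval (BSide u a) (BSide v b)]
     (EFin \o (phi \o alpha)).
Proof.
move=> cphi ha a0 b1; apply: (integrableS _ _ _ (HM_integrable cphi ha)) => //.
move=> x; rewrite /= !in_itv /= => /andP[ax xb]; apply/andP; split.
  by apply: (le_trans a0); move: ax; case: u => // /ltW.
by apply: le_trans b1; move: xb; case: v => // /ltW.
Qed.

End StepFunctions.

(** * Coordinates as integrals over time intervals *)

Section Young.
Variables (R : realType) (X : topologicalType).
Local Notation H := (HXspace R X).
Local Notation Z := (@HX R X).

(* Unnormalised coordinates [(b - a) * z(phi, a, b)], made total: they are [0]
   when [(phi, a, b)] is not an index, in particular when [a = b]. *)
Definition young (z : H) (phi : X -> R) (a b : R) : R :=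
  match pselect (continuous phi /\ 0 <= a /\ a < b /\ b <= 1) with
  | left h => (b - a) * z (exist _ (phi, a, b) h)
  | right _ => 0
  end.

Lemma young_coord (z : H) (s : SHM_index R X) :
  z s = ((sval s).2 - (sval s).1.2)^-1 *
        young z (sval s).1.1 (sval s).1.2 (sval s).2.
Proof.
case: s => -[[phi a] b] /= h; rewrite /young; case: pselect => // h'.
have ab : b - a != 0 by rewrite subr_eq0 gt_eqF//; case: h => _ [_ []].
by rewrite mulKf// (Prop_irrelevance h h').
Qed.

Lemma young_inj (z z' : H) :
  (forall phi a b, continuous phi -> 0 <= a -> a <= b -> b <= 1 ->
     young z phi a b = young z' phi a b) -> z = z'.
Proof.
move=> zz'; apply: funext => s; rewrite [LHS]young_coord [RHS]young_coord.
by case: s => -[[phi a] b] /= [c [a0 [ab b1]]]; rewrite zz'// ltW.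
Qed.

Lemma young_refl (z : H) phi a : young z phi a a = 0.
Proof.
rewrite /young; case: pselect => // h; exfalso.
by move: h => [_ [_ []]]; rewrite ltxx.
Qed.

Lemma young_continuous phi a b : continuous (fun z : H => young z phi a b : R).
Proof.
rewrite /young; case: pselect => [h|_]; last exact: cst_cont.
by apply: scale_cont; exact: ptws_proj_continuous.
Qed.

Hypothesis cX : compact [set: X].
Implicit Types (phi psi : X -> R) (a b c : R) (z : H).

Lemma young_HM (alpha : HM R X) phi a b :
  continuous phi -> 0 <= a -> a <= b -> b <= 1 ->
  young (HM_embed alpha) phi a b =
  \int[@lebesgue_measure R]_(t in `[a, b]) phi (sval alpha t).
Proof.
move=> cphi a0 ab b1; rewrite /young; case: pselect => [h|nh].
  rewrite /HM_embed /phi_ab /= mulVKf// subr_eq0 gt_eqF//.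
  by case: h => _ [_ []].
have -> : a = b.
  by apply/eqP; rewrite eq_le ab /= leNgt; apply/negP => ba; apply: nh.
by rewrite set_itv1 Rintegral_set1.
Qed.

Lemma closed_HX : closed Z.
Proof. exact: closed_closure. Qed.

(** Relations between coordinates are closed conditions, so they need only be checked on step
    functions, where [young] is an integral. *)
Lemma HX_ind (P : set H) : closed P -> (forall alpha : HM R X, P (HM_embed alpha)) ->
  forall z, Z z -> P z.
Proof.
move=> cP hP z Zz; have := (closure_id P).1 cP => ->.
by apply: closureS Zz => _ [alpha _ <-].
Qed.

Lemma HM_in (alpha : HM R X) : Z (HM_embed alpha).
Proof. by apply: subset_closure; exists alpha. Qed.

Lemma young_lin z phi psi (k a b : R) : Z z -> continuous phi -> continuous psi ->
  0 <= a -> a <= b -> b <= 1 ->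
  young z (fun x => phi x + k * psi x) a b = young z phi a b + k * young z psi a b.
Proof.
move=> Zz cphi cpsi a0 ab b1.
have ckpsi : continuous (fun x => k * psi x).
  exact: scale_cont.
have cs : continuous (fun x => phi x + k * psi x).
  exact: add_cont.
move: z Zz; apply: HX_ind.
  apply: closed_eq_real; first exact: young_continuous.
  apply: add_cont; first exact: young_continuous.
  by apply: scale_cont; exact: young_continuous.
move=> alpha; rewrite /= !young_HM//.
have ia p : continuous p -> (@lebesgue_measure R).-integrable `[a, b] (EFin \o (p \o sval alpha)).
  by move=> cp; apply: HM_integrable_sub => //; exact: (svalP alpha).
rewrite -RintegralZl//; last exact: (ia psi).
by rewrite -RintegralD//; [exact: (ia phi)|exact: (ia _ ckpsi)].
Qed.

Lemma young_ge0 z phi a b : Z z -> continuous phi ->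
  0 <= a -> a <= b -> b <= 1 -> (forall x, 0 <= phi x) -> 0 <= young z phi a b.
Proof.
move=> Zz cphi a0 ab b1 phi0; move: z Zz; apply: HX_ind.
  by apply: closed_le_real; [exact: cst_cont|exact: young_continuous].
by move=> alpha; rewrite /= young_HM//; apply: Rintegral_ge0.
Qed.

Lemma young_cst z (k a b : R) : Z z -> 0 <= a -> a <= b -> b <= 1 ->
  young z (fun=> k) a b = k * (b - a).
Proof.
move=> Zz a0 ab b1; move: z Zz; apply: HX_ind.
  by apply: closed_eq_real; [exact: young_continuous|exact: cst_cont].
move=> alpha; rewrite /= young_HM//; last exact: cst_cont.
rewrite Rintegral_cst//; congr (_ * _).
have := @lebesgue_measure_itv R (`[a, b]); rewrite /= lte_fin => ->.
by case: ltP => [|ba] //=; rewrite (@le_anti _ _ a b) ?ab// subrr.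
Qed.

Lemma young_add z phi a b c : Z z -> continuous phi ->
  0 <= a -> a <= b -> b <= c -> c <= 1 ->
  young z phi a c = young z phi a b + young z phi b c.
Proof.
move=> Zz cphi a0 ab bc c1; move: z Zz; apply: HX_ind.
  apply: closed_eq_real; first exact: young_continuous.
  by apply: add_cont; exact: young_continuous.
move=> alpha; rewrite /= !young_HM//; try lra.
have := @Rintegral_itvB R (fun t => phi (sval alpha t)) (BLeft a) (BRight c) b.
rewrite !bnd_simp => /(_ (HM_integrable_sub cX _ _ cphi (svalP alpha) a0 c1) ab bc).
rewrite Rintegral_itv_obnd_cbnd; last first.
  by apply: (HM_integrable_sub cX _ _ cphi (svalP alpha)) => //; lra.
by move=> <-; rewrite addrC subrK.
Qed.

(** Pieces of step functions are half-open, so nothing is asked at [b], which is a null set. *)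
Lemma young_ext (alpha beta : HM R X) phi psi a b :
  continuous phi -> continuous psi -> 0 <= a -> a <= b -> b <= 1 ->
  (forall t, a <= t -> t < b -> phi (sval alpha t) = psi (sval beta t)) ->
  young (HM_embed alpha) phi a b = young (HM_embed beta) psi a b.
Proof.
move=> cphi cpsi a0 ab b1 e; rewrite !young_HM//.
have h p (g : HM R X) : continuous p ->
    (@lebesgue_measure R).-integrable `[a, b[ (EFin \o (p \o sval g)).
  by move=> cp; apply: HM_integrable_sub => //; exact: (svalP g).
rewrite -(@Rintegral_itv_bndo_bndc R (BLeft a) b); last exact: (h phi).
rewrite -(@Rintegral_itv_bndo_bndc R (BLeft a) b); last exact: (h psi).
by apply: eq_Rintegral => t; rewrite inE /= in_itv /= => /andP[*]; exact: e.
Qed.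

Lemma young_const_piece (alpha : HM R X) phi a b x :
  continuous phi -> 0 <= a -> a <= b -> b <= 1 ->
  (forall t, a <= t -> t < b -> sval alpha t = x) ->
  young (HM_embed alpha) phi a b = phi x * (b - a).
Proof.
move=> cphi a0 ab b1 e.
rewrite (@young_ext alpha alpha phi (fun=> phi x))//.
- by rewrite young_cst//; exact: HM_in.
- exact: cst_cont.
- by move=> t ta tb; rewrite e.
Qed.

End Young.

(** * Step functions and partitions *)

Section FinitelyDetermined.
Variables (I : Type) (K : I -> topologicalType).

(* The points agreeing with [f] at finitely many indices form a filter
   converging to [f]. *)
Lemma ptws_nbhs_finite (f : prod_topology K) (U : set (prod_topology K)) :
  nbhs f U -> exists s : seq {classic I},
    forall g : prod_topology K, (forall i, i \in s -> g i = f i) -> U g.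
Proof.
pose D := filter_from [set: seq {classic I}]
  (fun s => [set g : prod_topology K | forall i, i \in s -> g i = f i]).
have FD : Filter D.
  apply: filter_from_filter; first by exists [::].
  move=> s s' _ _; exists (s ++ s') => // g /= gs.
  by split=> i si; apply: gs; rewrite mem_cat si ?orbT.
suff Df : D --> f by move=> /Df [s _ sU]; exists s.
apply/cvg_sup => i V [_ [[W oW <-] /= Wfi]] WV.
by exists [:: i] => // g gi; apply: WV; rewrite /= gi// mem_seq1.
Qed.

End FinitelyDetermined.

Section Partitions.
Variable R : realType.

Definition is_partition (n : nat) (t : nat -> R) :=
  [/\ t 0%N = 0, t n = 1 & forall i, (i < n)%N -> t i < t i.+1].

Lemma partition_le n t i j : is_partition n t -> (i <= j)%N -> (j <= n)%N -> t i <= t j.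
Proof.
move=> [_ _ tlt]; elim: j => [|j IH]; first by rewrite leqn0 => /eqP ->.
rewrite leq_eqVlt => /orP[/eqP -> //|ij] jn.
by rewrite (le_trans (IH ij (ltnW jn)))// ltW// tlt.
Qed.

Lemma partition_lt n t i j : is_partition n t -> (i <= n)%N -> (j <= n)%N ->
  t i < t j -> (i < j)%N.
Proof.
move=> pt ilt jlt; apply: contraTT; rewrite -leqNgt -leNgt => ji.
exact: partition_le ilt.
Qed.

Lemma partition_01 n t i : is_partition n t -> (i <= n)%N -> 0 <= t i <= 1.
Proof.
move=> pt ilt; have [t0 t1 _] := pt.
by rewrite -t0 -t1 !(partition_le pt).
Qed.

Lemma partition_points (s : seq R) : exists n t,
  is_partition n t /\
  forall c, c \in s -> 0 <= c <= 1 -> exists2 p, (p <= n)%N & t p = c.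
Proof.
pose s1 := undup (0 :: 1 :: [seq c <- s | 0 <= c <= 1]).
pose s' := sort <=%R s1.
have s'lt : sorted <%R s' by rewrite sort_lt_sorted undup_uniq.
have ms' c : (c \in s') = [|| c == 0, c == 1 | (c \in s) && (0 <= c <= 1)].
  by rewrite mem_sort mem_undup !inE mem_filter andbC.
have s'n0 : (0 < size s')%N by rewrite -has_predT; apply/hasP; exists 0; rewrite // ms' eqxx.
have s'01 c : c \in s' -> 0 <= c <= 1.
  by rewrite ms' => /or3P[/eqP ->|/eqP ->|/andP[]//]; rewrite ?lexx ?ler01.
have tlt i j : (i < j)%N -> (j < size s')%N -> nth 1 s' i < nth 1 s' j.
  move=> ij js; rewrite (@lt_sorted_ltn_nth _ _ 1 s')// inE; exact: ltn_trans js.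
have tle i j : (i <= j)%N -> (j < size s')%N -> nth 1 s' i <= nth 1 s' j.
  by rewrite leq_eqVlt => /orP[/eqP -> //|ij] js; rewrite ltW// tlt.
have pP c : c \in s' -> exists2 p, (p <= (size s').-1)%N & nth 1 s' p = c.
  move=> cs; exists (index c s'); last exact: nth_index.
  by rewrite -ltnS prednK// index_mem.
exists (size s').-1, (nth 1 s'); split; first split.
- have [|p ple p0] := pP 0; first by rewrite ms' eqxx.
  have /andP[n0 _] := s'01 _ (mem_nth 1 s'n0).
  by apply/le_anti; rewrite n0 andbT -[leRHS]p0 tle// -[X in (_ < X)%N](prednK s'n0).
- have [|p ple p1] := pP 1; first by rewrite ms' eqxx orbT.
  have lts : ((size s').-1 < size s')%N by rewrite prednK.
  have /andP[_ n1] := s'01 _ (mem_nth 1 lts).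
  by apply/le_anti; rewrite n1 -[leLHS]p1 tle.
- by move=> i ilt; apply: tlt => //; rewrite -ltn_predRL.
- by move=> c cs c01; apply: pP; rewrite ms' cs c01 !orbT.
Qed.

Section Steps.
Variable X : Type.

(** All jumps of [alpha] occur at points of [s]. Unlike a partition, such a list needs neither order
    nor end points, so a common refinement is a concatenation. *)
Definition stepw (s : seq R) (alpha : R -> X) := forall u v,
  0 <= u -> u <= v -> v < 1 -> (forall c, c \in s -> ~ (u < c /\ c <= v)) ->
  alpha u = alpha v.

Lemma is_HM_partition (alpha : R -> X) : is_HM alpha <->
  exists n t, is_partition n t /\
  forall i, (i < n)%N -> forall s, t i <= s -> s < t i.+1 -> alpha s = alpha (t i).
Proof.
split=> [[n [t [t0 [t1 [tlt h]]]]]|[n [t [[t0 t1 tlt] h]]]]; exists n, t.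
  by [].
by [].
Qed.

Lemma partition_piece n (t : nat -> R) u : is_partition n t -> 0 <= u -> u < 1 ->
  exists i, [/\ (i < n)%N, t i <= u & u < t i.+1].
Proof.
move=> [t0 t1 _] u0 u1.
have ex : exists i, u < t i by exists n; rewrite t1.
case: (ex_minnP ex) => -[|i] ui imin; first by move: ui; rewrite t0 ltNge u0.
exists i; split=> //; first by apply: imin; rewrite t1.
by rewrite leNgt; apply/negP => /imin; rewrite ltnn.
Qed.

Lemma stepw_piece s (alpha : R -> X) n t : stepw s alpha -> is_partition n t ->
  (forall c, c \in s -> 0 <= c <= 1 -> exists2 p, (p <= n)%N & t p = c) ->
  forall i, (i < n)%N -> forall u, t i <= u -> u < t i.+1 -> alpha u = alpha (t i).
Proof.
move=> sa pt sP i ilt u tu ut; symmetry.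
have /andP[ti0 _] := partition_01 pt (ltnW ilt).
have /andP[_ ti1] := partition_01 pt ilt.
apply: sa => //; first exact: lt_le_trans ti1.
move=> c cs [c1 c2].
have [|p pn pc] := sP c cs; first by apply/andP; split; lra.
rewrite -pc in c1 c2.
have := partition_lt pt (ltnW ilt) pn c1.
have := partition_lt pt pn ilt (le_lt_trans c2 ut).
by rewrite ltnS => /leq_ltn_trans h /h; rewrite ltnn.
Qed.

Lemma stepw_HM s (alpha : R -> X) : stepw s alpha -> is_HM alpha.
Proof.
move=> sa; have [n [t [pt sP]]] := partition_points s.
by apply/is_HM_partition; exists n, t; split=> //; exact: stepw_piece sP.
Qed.

Lemma HM_stepw (alpha : R -> X) : is_HM alpha -> exists s, stepw s alpha.
Proof.
move=> /is_HM_partition[n [t [pt h]]]; exists [seq t i | i <- iota 0 n.+1].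
move=> u v u0 uv v1 hs.
have [i [ilt tu ut]] := partition_piece pt u0 (le_lt_trans uv v1).
rewrite (h i ilt u)// (h i ilt v)//; first exact: le_trans tu uv.
rewrite ltNge; apply/negP => tv; apply: (hs (t i.+1)) => //.
by apply/mapP; exists i.+1; rewrite // mem_iota.
Qed.

Lemma cut_HM (alpha beta : R -> X) c : is_HM alpha -> is_HM beta ->
  is_HM (fun u => if u < c then alpha u else beta u).
Proof.
move=> /HM_stepw[s sa] /HM_stepw[s' sb]; apply: (@stepw_HM (c :: s ++ s')).
move=> u v u0 uv v1 h.
have ha : alpha u = alpha v.
  by apply: sa => // d ds; apply: h; rewrite inE mem_cat ds orbT.
have hb : beta u = beta v.
  by apply: sb => // d ds; apply: h; rewrite inE mem_cat ds !orbT.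
have hc := h c (mem_head _ _); case: (ltP u c) => uc; case: (ltP v c) => vc //.
- by case: hc.
- by have := lt_le_trans vc uc; rewrite ltNge uv.
Qed.

Lemma glue_HM n t (A : nat -> R -> X) :
  (forall i, (i < n)%N -> t i < t i.+1) -> (forall i, is_HM (A i)) ->
  exists gamma, is_HM gamma /\
    forall i, (i < n)%N -> forall u, t i <= u -> u < t i.+1 -> gamma u = A i u.
Proof.
move=> tlt hA; suff : forall m, (m <= n)%N -> exists gamma, is_HM gamma /\
    forall i, (i < m)%N -> forall u, t i <= u -> u < t i.+1 -> gamma u = A i u.
  by apply.
elim=> [_|m IH mn]; first by exists (A 0%N).
have [g [hg gA]] := IH (ltnW mn).
exists (fun u => if u < t m then g u else A m u); split; first exact: cut_HM.
move=> i; rewrite ltnS leq_eqVlt => /orP[/eqP ->|im] u tu ut.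
  by rewrite ltNge tu.
have tle j : (j <= m - i.+1)%N -> t i.+1 <= t (i.+1 + j)%N.
  elim: j => [|j IHj] jm; first by rewrite addn0.
  rewrite (le_trans (IHj (ltnW jm)))// addnS ltW// tlt// (leq_trans _ mn)//.
  by rewrite ltnS -[leqRHS](subnKC im) leq_add2l ltnW.
have um : u < t m by have := tle _ (leqnn _); rewrite subnKC//; exact: lt_le_trans.
by rewrite um; apply: gA.
Qed.

End Steps.
End Partitions.

(** * Estimates for the coordinates, compactness and convexity of [HX] *)

Section YoungTheory.
Variables (R : realType) (X : topologicalType).
Hypothesis cX : compact [set: X].
Local Notation H := (HXspace R X).
Local Notation Z := (@HX R X).
Implicit Types (phi psi : X -> R) (a b c : R) (z w : H).

Lemma young_sum (I : Type) (r : seq I) (P : pred I) (k : I -> R) (f : I -> X -> R) z a b :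
  Z z -> (forall i, continuous (f i)) -> 0 <= a -> a <= b -> b <= 1 ->
  young z (fun x => \sum_(i <- r | P i) k i * f i x) a b =
  \sum_(i <- r | P i) k i * young z (f i) a b.
Proof.
move=> Zz cf a0 ab b1; elim: r => [|i r IH].
  under eq_fun do rewrite big_nil.
  by rewrite big_nil young_cst// mul0r.
under eq_fun do rewrite big_cons; rewrite big_cons.
case: (P i) => //.
have cs : continuous (fun x => \sum_(j <- r | P j) k j * f j x).
  by apply: sum_cont => j _; exact: scale_cont.
under eq_fun do rewrite addrC.
by rewrite young_lin// IH addrC.
Qed.

Lemma young_le z phi psi a b : Z z -> continuous phi -> continuous psi ->
  0 <= a -> a <= b -> b <= 1 -> (forall x, phi x <= psi x) ->
  young z phi a b <= young z psi a b.
Proof.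
move=> Zz cphi cpsi a0 ab b1 le.
rewrite -subr_ge0 -mulN1r -young_lin//; apply: young_ge0 => //.
  by apply: add_cont => //; exact: scale_cont.
by move=> x; rewrite mulN1r subr_ge0.
Qed.

Lemma young_near z phi psi a b e : Z z -> continuous phi -> continuous psi ->
  0 <= a -> a <= b -> b <= 1 -> (forall x, `|phi x - psi x| <= e) ->
  `|young z phi a b - young z psi a b| <= e * (b - a).
Proof.
move=> Zz cphi cpsi a0 ab b1 le; rewrite -mulN1r -young_lin//.
have cd : continuous (fun x => phi x + -1 * psi x).
  by apply: add_cont => //; exact: scale_cont.
rewrite ler_norml -mulNr -!(young_cst _ Zz)//.
rewrite !young_le//; try exact: cst_cont.
- by move=> x; rewrite mulN1r; exact: (le_trans (ler_norm _)).
- by move=> x; have := le x; rewrite mulN1r ler_norml => /andP[].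
Qed.

Lemma young_bound z phi a b M : Z z -> continuous phi ->
  0 <= a -> a <= b -> b <= 1 -> (forall x, `|phi x| <= M) ->
  `|young z phi a b| <= M * (b - a).
Proof.
move=> Zz cphi a0 ab b1 le.
have := @young_near z phi (fun=> 0) a b M Zz cphi (@cst_cont R X 0) a0 ab b1.
rewrite young_cst// mul0r subr0; apply.
by move=> x; rewrite subr0.
Qed.

Lemma coord_bound z (s : SHM_index R X) M : Z z ->
  (forall x, `|(sval s).1.1 x| <= M) -> `|z s| <= M.
Proof.
move=> Zz bM; rewrite young_coord.
case: s bM => -[[phi a] b] /= [cphi [a0 [ab b1]]] bM.
have ba : 0 < b - a by rewrite subr_gt0.
rewrite normrM normfV (gtr0_norm ba) mulrC ler_pdivrMr//.
by rewrite young_bound// ltW.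
Qed.

Lemma HX_hausdorff : hausdorff_space H.
Proof. by apply: (@hausdorff_product {classic _}) => s; exact: norm_hausdorff. Qed.

Lemma HX_compact : compact Z.
Proof.
have /choice[M hM] (s : SHM_index R X) : exists M, forall x, `|(sval s).1.1 x| <= M.
  by have [M [_ hM]] := compact_bound cX (svalP s).1; exists M.
have cB : compact [set z : H | forall s, `[- M s, M s]%classic (z s)].
  exact: (@tychonoff {classic (SHM_index R X)} (fun=> R^o)
    (fun s => `[- M s, M s]%classic) (fun s => @segment_compact R _ _)).
apply: (subclosed_compact (@closed_HX R X) cB).
by move=> z Zz s; rewrite /= in_itv /= -ler_norml; exact: coord_bound.
Qed.

Lemma HX_nonempty (x : X) : Z !=set0.
Proof. by exists (HM_embed (exist _ (fun=> x) (is_HM_cst R x))); exact: HM_in. Qed.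

Lemma young_pieces z phi n t p q : Z z -> continuous phi -> is_partition n t ->
  (p <= q)%N -> (q <= n)%N ->
  young z phi (t p) (t q) = \sum_(p <= i < q) young z phi (t i) (t i.+1).
Proof.
move=> Zz cphi pt; elim: q => [|q IH].
  by rewrite leqn0 => /eqP -> _; rewrite big_geq// young_refl.
rewrite leq_eqVlt => /orP[/eqP -> qn|pq qn].
  by rewrite big_geq// young_refl.
have /andP[p0 _] := partition_01 pt (leq_trans (ltnSE pq) (ltnW qn)).
have /andP[_ q1] := partition_01 pt qn.
rewrite big_nat_recr//= -IH//; last exact: ltnW.
by apply: young_add => //; apply: (partition_le pt) => //; exact: ltnW.
Qed.

Definition agree z w phi := forall a b, 0 <= a -> a <= b -> b <= 1 ->
  young z phi a b = young w phi a b.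

Lemma agree_closed z w phi : Z z -> Z w -> continuous phi ->
  (forall e, 0 < e -> exists psi, [/\ continuous psi, agree z w psi
      & forall x, `|phi x - psi x| <= e]) -> agree z w phi.
Proof.
move=> Zz Zw cphi h a b a0 ab b1; apply/eqP; rewrite -subr_eq0 -normr_le0.
apply/ler_addgt0Pl => e e0; rewrite addr0.
have e20 : 0 < e / 2 by lra.
have [psi [cpsi ag bd]] := h _ e20.
have h1 := young_near Zz cphi cpsi a0 ab b1 bd.
have h2 := young_near Zw cphi cpsi a0 ab b1 bd.
rewrite (ag a b) // in h1.
have ba1 : b - a <= 1 by lra.
have : e / 2 * (b - a) <= e / 2 by rewrite ler_piMr// ltW.
move: h1 h2; rewrite !ler_norml; lra.
Qed.

Lemma agree_rat z w phi : Z z -> Z w -> continuous phi ->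
  (forall p q : rat, 0 <= ratr p :> R -> ratr p < ratr q :> R -> ratr q <= 1 :> R ->
     young z phi (ratr p) (ratr q) = young w phi (ratr p) (ratr q)) ->
  agree z w phi.
Proof.
move=> Zz Zw cphi h a b a0 ab b1.
have [->|anb] := eqVneq a b.
  by rewrite !young_refl.
have {}ab : a < b by rewrite lt_neqAle anb.
have [M [M0 bM]] := compact_bound cX cphi.
apply/eqP; rewrite -subr_eq0 -normr_le0.
apply/ler_addgt0Pl => e e0; rewrite addr0.
(* Two end pieces for each of [z] and [w] contribute at most [M * d] each, whence the factor [4];
   the second bound keeps the rational end points in order. *)
pose d := Num.min (e / (4 * M)) ((b - a) / 2).
have d0 : 0 < d by rewrite lt_min divr_gt0 ?mulr_gt0 ?subr_gt0//; lra.
have de : 4 * M * d <= e.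
  by rewrite mulrC -ler_pdivlMr ?mulr_gt0// ge_min lexx.
have dab : d <= (b - a) / 2 by rewrite ge_min lexx orbT.
have [p] := @rat_in_itvoo R a (a + d) ltac:(lra).
rewrite in_itv /= => /andP[ap pd].
have [q] := @rat_in_itvoo R (b - d) b ltac:(lra).
rewrite in_itv /= => /andP[dq qb].
have hpq := h p q ltac:(lra) ltac:(lra) ltac:(lra).
have s u : Z u -> young u phi a b = young u phi a (ratr p) +
    (young u phi (ratr p) (ratr q) + young u phi (ratr q) b).
  move=> Zu; rewrite -(@young_add R X cX u phi (ratr p) (ratr q))//; try lra.
  by rewrite -young_add//; lra.
rewrite !s// hpq.
have b1' u : Z u -> `|young u phi a (ratr p)| <= M * d.
  move=> Zu; apply: (le_trans (young_bound Zu cphi _ _ _ bM)); try lra.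
  by rewrite ler_pM2l//; lra.
have b2' u : Z u -> `|young u phi (ratr q) b| <= M * d.
  move=> Zu; apply: (le_trans (young_bound Zu cphi _ _ _ bM)); try lra.
  by rewrite ler_pM2l//; lra.
have := b1' _ Zz; have := b1' _ Zw; have := b2' _ Zz; have := b2' _ Zw.
move: de; rewrite -mulrA; move: (M * d) => Md; rewrite !ler_norml; lra.
Qed.

Lemma agree_lin z w phi psi (k : R) : Z z -> Z w ->
  continuous phi -> continuous psi -> agree z w phi -> agree z w psi ->
  agree z w (fun x => phi x + k * psi x).
Proof. by move=> Zz Zw cphi cpsi h1 h2 a b *; rewrite !young_lin// h1// h2. Qed.

Lemma agree_cst z w (k : R) : Z z -> Z w -> agree z w (fun=> k).
Proof. by move=> Zz Zw a b *; rewrite !young_cst. Qed.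

Lemma agree_sym z w phi : agree z w phi -> agree w z phi.
Proof. by move=> h a b *; rewrite h. Qed.

Lemma agree_trans u z w phi : agree u z phi -> agree z w phi -> agree u w phi.
Proof. by move=> h h' a b *; rewrite h// h'. Qed.

Lemma agree_all z w : (forall phi, continuous phi -> agree z w phi) -> z = w.
Proof. by move=> h; apply: young_inj => phi a b cphi *; exact: h. Qed.

Lemma agree_coord z w (s : SHM_index R X) : agree z w (sval s).1.1 -> z s = w s.
Proof.
move=> h; rewrite [LHS]young_coord [RHS]young_coord; congr (_ * _).
by case: s h => -[[phi a] b] /= [cphi [a0 [ab b1]]] h; rewrite h// ltW.
Qed.

(* Refining the common pieces of [alpha] and [beta] and using each of them on one
   half of every piece realises the midpoint exactly on finitely many
   coordinates. *)
Lemma alternate_HM (alpha beta : HM R X) (s : seq R) : exists n t (gamma : HM R X),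
  [/\ is_partition n t,
     forall c, c \in s -> 0 <= c <= 1 -> exists2 p, (p <= n)%N & t p = c,
     forall i, (i < n)%N -> forall u, t i <= u -> u < (t i + t i.+1) / 2 ->
       sval gamma u = sval alpha (t i),
     forall i, (i < n)%N -> forall u, (t i + t i.+1) / 2 <= u -> u < t i.+1 ->
       sval gamma u = sval beta (t i)
   & forall i, (i < n)%N -> forall u, t i <= u -> u < t i.+1 ->
       sval alpha u = sval alpha (t i) /\ sval beta u = sval beta (t i)].
Proof.
have [sa ha] := HM_stepw (svalP alpha); have [sb hb] := HM_stepw (svalP beta).
have [n [t [pt sP]]] := partition_points (s ++ sa ++ sb).
have tlt i : (i < n)%N -> t i < t i.+1 by case: pt => _ _; apply.
pose A i u := if u < (t i + t i.+1) / 2 then sval alpha u else sval beta u.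
have hA i : is_HM (A i) by apply: cut_HM; exact: svalP.
have [g [hg gA]] := glue_HM tlt hA.
have pa := stepw_piece ha pt (fun c cs => sP c ltac:(by rewrite !mem_cat cs orbT)).
have pb := stepw_piece hb pt (fun c cs => sP c ltac:(by rewrite !mem_cat cs !orbT)).
exists n, t, (exist _ g hg); split=> //.
- by move=> c cs; apply: sP; rewrite mem_cat cs.
- move=> i ilt u tu ut /=; have := tlt i ilt => ti.
  have utt : u < t i.+1 by lra.
  by rewrite (gA i)// /A ut (pa i).
- move=> i ilt u tu ut /=; have := tlt i ilt => ti.
  have utt : t i <= u by lra.
  by rewrite (gA i)// /A ltNge tu /= (pb i).
- by move=> i ilt u tu ut; rewrite (pa i)// (pb i).
Qed.

Lemma alternate_coord (alpha beta gamma : HM R X) n t (s : SHM_index R X) p q :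
  is_partition n t ->
  (forall i, (i < n)%N -> forall u, t i <= u -> u < (t i + t i.+1) / 2 ->
     sval gamma u = sval alpha (t i)) ->
  (forall i, (i < n)%N -> forall u, (t i + t i.+1) / 2 <= u -> u < t i.+1 ->
     sval gamma u = sval beta (t i)) ->
  (forall i, (i < n)%N -> forall u, t i <= u -> u < t i.+1 ->
     sval alpha u = sval alpha (t i) /\ sval beta u = sval beta (t i)) ->
  (p <= n)%N -> (q <= n)%N -> t p = (sval s).1.2 -> t q = (sval s).2 ->
  HM_embed gamma s = (HM_embed alpha s + HM_embed beta s) / 2.
Proof.
move=> pt ga gb gc pn qn; rewrite !(young_coord (HM_embed _) s).
case: s => -[[phi a] b] /= [cphi [a0 [ab b1]]] tp tq.
have pq : (p <= q)%N by rewrite ltnW// (partition_lt pt)// tp tq.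
rewrite -mulrDr -mulrA; congr (_ * _); rewrite -tp -tq.
rewrite !(@young_pieces _ phi n)//; try exact: HM_in.
rewrite -big_split mulr_suml; apply: eq_big_nat => j /andP[_ jq] /=.
have jn := leq_trans jq qn.
have tj : t j < t j.+1 by case: pt => _ _; exact.
have /andP[j0 _] := partition_01 pt (ltnW jn).
have /andP[_ j1] := partition_01 pt jn.
rewrite (@young_add R X cX _ phi (t j) ((t j + t j.+1) / 2) (t j.+1))//; try lra;
  last exact: HM_in.
rewrite (young_const_piece cX cphi _ _ _ (ga _ jn))//; try lra.
rewrite (young_const_piece cX cphi _ _ _ (gb _ jn))//; try lra.
rewrite (young_const_piece cX cphi _ _ _ (fun u u1 u2 => (gc _ jn u u1 u2).1))//; try lra.
rewrite (young_const_piece cX cphi _ _ _ (fun u u1 u2 => (gc _ jn u u1 u2).2))//; try lra.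
Qed.

Lemma index_endpoints (s : seq (SHM_index R X)) n t :
  (forall c, c \in flatten [seq [:: (sval i).1.2; (sval i).2] | i <- s] -> 0 <= c <= 1 ->
     exists2 p, (p <= n)%N & t p = c) ->
  forall i, List.In i s -> exists p q,
    [/\ (p <= n)%N, (q <= n)%N, t p = (sval i).1.2 & t q = (sval i).2].
Proof.
move=> sP i si; have [_ [a0 [ab b1]]] := svalP i.
set pts := flatten _ in sP.
have sub : forall c, c \in [:: (sval i).1.2; (sval i).2] -> c \in pts.
  rewrite /pts; elim: s si {pts sP} => //= j s IH [->|si] c.
    by rewrite inE mem_seq1 !inE => /orP[->|->]; rewrite ?orbT.
  by move=> /(IH si); rewrite !inE => ->; rewrite !orbT.
have [||p pn tp] := sP (sval i).1.2; [by apply: sub; rewrite !inE eqxx|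
  by apply/andP; split; lra|].
have [||q qn tq] := sP (sval i).2; [by apply: sub; rewrite !inE eqxx orbT|
  by apply/andP; split; lra|].
by exists p, q.
Qed.

Lemma midpoint_coord (alpha beta : HM R X) (s : seq (SHM_index R X)) :
  exists gamma : HM R X, forall i : SHM_index R X, List.In i s ->
   HM_embed gamma i = (HM_embed alpha i + HM_embed beta i) / 2.
Proof.
have [n [t [g [pt sP ga gb gc]]]] :=
  alternate_HM alpha beta (flatten [seq [:: (sval i).1.2; (sval i).2] | i <- s]).
exists g => i /(index_endpoints sP)[p [q [pn qn tp tq]]].
exact: (alternate_coord pt ga gb gc pn qn).
Qed.

(** Closedness reduces [z] and then [w] to step functions. A basic neighbourhood sees only finitely
    many coordinates, and on those the midpoint of two step functions is attained by a step
    function. *)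
Lemma midpoint_HX z w : Z z -> Z w -> Z (fun s => (z s + w s) / 2).
Proof.
have cm (f g : H -> SHM_index R X -> R) :
    (forall s, continuous (fun z => f z s)) -> (forall s, continuous (fun z => g z s)) ->
    continuous (fun z : H => (fun s => (f z s + g z s) / 2) : H).
  move=> cf cg; apply: ptws_cvg_continuous => s.
  by apply: mul_cont; [apply: add_cont|exact: cst_cont].
have clm (f g : H -> SHM_index R X -> R) :
    (forall s, continuous (fun z => f z s)) -> (forall s, continuous (fun z => g z s)) ->
    closed [set z : H | Z (fun s => (f z s + g z s) / 2)].
  by move=> cf cg; move/continuous_closedP: (cm _ _ cf cg); apply; exact: closed_HX.
have cp s : continuous (fun z : H => z s : R) by exact: ptws_proj_continuous.
move=> + Zw; move: z; apply: HX_ind; first by apply: clm => // s; exact: cst_cont.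
move=> alpha; move: w Zw; apply: HX_ind; first by apply: clm => // s; exact: cst_cont.
move=> beta U /ptws_nbhs_finite[s sU].
have [gamma hg] := midpoint_coord alpha beta s.
exists (HM_embed gamma); split; first by exists gamma.
apply: sU => i si; apply: hg.
by elim: s si => //= j s IH; rewrite inE => /orP[/eqP ->|/IH]; [left|right].
Qed.

End YoungTheory.

(** * Minimisation over fibres *)

Section FibreMin.
Variables (R : realType) (X : topologicalType).
Hypothesis cX : compact [set: X].
Local Notation H := (HXspace R X).
Local Notation Z := (@HX R X).

Definition invariant_fun (E : X -> X -> Prop) (phi : X -> R) :=
  forall x y, E x y -> phi x = phi y.

(* The fibrewise minimum of a continuous function is attained and continuous:
   for a quotient map [q] between compacta and [E x y := q x = q y] this holds
   when [q] is open. *)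
Definition open_rel (E : X -> X -> Prop) := forall phi : X -> R, continuous phi ->
  exists psi : X -> R, [/\ continuous psi, invariant_fun E psi,
    forall x, psi x <= phi x & forall x, exists y, E x y /\ phi y = psi x].

(** For the kernel of a quotient map of compacta, this says that [z] and [w] have the same image
    over the quotient space. *)
Definition fagree (E : X -> X -> Prop) (z w : H) := forall phi : X -> R,
  continuous phi -> invariant_fun E phi -> agree z w phi.

(** Refining the finitely many intervals makes the time pieces disjoint, so that a linear functional
    can be minimised on each piece separately. *)
Lemma lincomb_pieces (N : nat) (d : nat -> R) (s : nat -> SHM_index R X) :
  exists n t (psi : nat -> X -> R),
  [/\ is_partition n t, forall i, continuous (psi i)
    & forall z : H, Z z -> \sum_(m < N) d m * z (s m) =
        \sum_(0 <= i < n) young z (psi i) (t i) (t i.+1)].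
Proof.
pose pts := [seq (sval (s m)).1.2 | m <- iota 0 N] ++ [seq (sval (s m)).2 | m <- iota 0 N].
have [n [t [pt sP]]] := partition_points pts.
have /choice[p hp] (m : nat) : exists p, (m < N)%N -> (p <= n)%N /\ t p = (sval (s m)).1.2.
  case: (ltnP m N) => mN; last by exists 0%N.
  have [_ [a0 [ab b1]]] := svalP (s m).
  have [||p pn tp] := sP (sval (s m)).1.2; last by exists p.
    by rewrite mem_cat; apply/orP; left; apply/mapP; exists m; rewrite // mem_iota.
  by apply/andP; split; lra.
have /choice[q hq] (m : nat) : exists p, (m < N)%N -> (p <= n)%N /\ t p = (sval (s m)).2.
  case: (ltnP m N) => mN; last by exists 0%N.
  have [_ [a0 [ab b1]]] := svalP (s m).
  have [||p' pn tp] := sP (sval (s m)).2; last by exists p'.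
    by rewrite mem_cat; apply/orP; right; apply/mapP; exists m; rewrite // mem_iota.
  by apply/andP; split; lra.
pose k m i : R := if (p m <= i < q m)%N then
  d m * ((sval (s m)).2 - (sval (s m)).1.2)^-1 else 0.
have cs m : continuous (sval (s m)).1.1 by case: (svalP (s m)).
exists n, t, (fun i x => \sum_(m < N) k m i * (sval (s m)).1.1 x); split=> //.
  by move=> i; apply: sum_cont => m _; apply: scale_cont; exact: cs.
move=> z Zz.
have -> :
  \sum_(0 <= i < n) young z (fun x => \sum_(m < N) k m i * (sval (s m)).1.1 x) (t i) (t i.+1)
  = \sum_(0 <= i < n) \sum_(m < N) k m i * young z (sval (s m)).1.1 (t i) (t i.+1).
  apply: eq_big_nat => i /andP[_ ilt].
  have /andP[i0 _] := partition_01 pt (ltnW ilt).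
  have /andP[_ i1] := partition_01 pt ilt.
  by rewrite (young_sum cX)//; apply: (partition_le pt).
rewrite exchange_big /=; apply: eq_bigr => m _.
have [pn tp] := hp m (ltn_ord m); have [qn tq] := hq m (ltn_ord m).
rewrite young_coord mulrA -tq -tp.
have pq : (p m <= q m)%N.
  have [_ [_ [ab _]]] := svalP (s m).
  by rewrite ltnW// (partition_lt pt)// tp tq.
rewrite (young_pieces cX Zz (cs m) pt pq qn) mulr_sumr.
rewrite [RHS](@big_cat_nat _ _ _ (p m))//=.
rewrite [X in _ = X + _]big_nat_cond [X in _ = X + _]big1 ?add0r; last first.
  by move=> i; rewrite andbT => /andP[_ ip]; rewrite /k leqNgt ip /= mul0r.
rewrite [X in _ = X](@big_cat_nat _ _ _ (q m))//=.
rewrite [X in _ = _ + X]big_nat_cond [X in _ = _ + X]big1 ?addr0; last first.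
  by move=> i; rewrite andbT => /andP[iq _]; rewrite /k ltnNge iq /= andbF mul0r.
by apply: eq_big_nat => i pqi; rewrite /k pqi tq tp.
Qed.

Lemma lincomb_continuous N (d : nat -> R) (s : nat -> SHM_index R X) :
  continuous (fun z : H => \sum_(m < N) d m * z (s m)).
Proof.
apply: sum_cont => m _; apply: scale_cont; exact: ptws_proj_continuous.
Qed.

Lemma closed_fagree (T : topologicalType) (E : X -> X -> Prop) (f g : T -> H) :
  continuous f -> continuous g -> closed [set x | fagree E (f x) (g x)].
Proof.
move=> cf cg.
rewrite (_ : [set x | _] = \bigcap_(s in [set s : (X -> R) * R * R |
  [/\ continuous s.1.1, invariant_fun E s.1.1, 0 <= s.1.2, s.1.2 <= s.2 & s.2 <= 1]])
  [set x | young (f x) s.1.1 s.1.2 s.2 = young (g x) s.1.1 s.1.2 s.2]).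
  apply: closed_bigI => s _; apply: closed_eq_real.
    exact: (comp_cont cf (@young_continuous R X s.1.1 s.1.2 s.2)).
  exact: (comp_cont cg (@young_continuous R X s.1.1 s.1.2 s.2)).
apply/seteqP; split=> [x h [[phi a] b] /= [c i a0 ab b1]|x h phi c i a b a0 ab b1].
  exact: h.
exact: (h (phi, a, b)).
Qed.

(** On each time piece the integrand [psi i] is replaced by its minimum [chi i] over the classes of
    [E]. As [chi i] is continuous and invariant, the resulting functional is continuous and depends
    only on the fibre. *)
Lemma fibre_min (E : X -> X -> Prop) (N : nat) (d : nat -> R)
    (s : nat -> SHM_index R X) : open_rel E ->
  exists lmin : H -> R, [/\ continuous lmin,
    forall z w, Z z -> Z w -> fagree E z w -> lmin z = lmin w,
    forall z, Z z -> lmin z <= \sum_(m < N) d m * z (s m)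
  & forall w, Z w -> exists z, [/\ Z z, fagree E w z &
      \sum_(m < N) d m * z (s m) = lmin w]].
Proof.
move=> oE; have [n [t [psi [pt cpsi psiE]]]] := lincomb_pieces N d s.
have /choice[chi hchi] i := oE (psi i) (cpsi i).
have cchi i : continuous (chi i) by case: (hchi i).
have /choice[sel hsel] (ix : nat * X) : exists y, E ix.2 y /\ psi ix.1 y = chi ix.1 ix.2.
  by case: (hchi ix.1) => _ _ _; exact.
have t01 i : (i < n)%N -> [/\ 0 <= t i, t i <= t i.+1 & t i.+1 <= 1].
  move=> ilt; have /andP[? _] := partition_01 pt (ltnW ilt).
  have /andP[_ ?] := partition_01 pt ilt; split=> //.
  exact: (partition_le pt).
pose lmin (z : H) : R := \sum_(0 <= i < n) young z (chi i) (t i) (t i.+1).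
have clmin : continuous lmin by apply: sum_cont => i _; exact: young_continuous.
exists lmin; split=> //.
- move=> z w Zz Zw zw; apply: eq_big_nat => i /andP[_ /t01[? ? ?]].
  by apply: zw => //; case: (hchi i).
- move=> z Zz; rewrite psiE//; apply: ler_sum_nat => i /andP[_ /t01[? ? ?]].
  by apply: (young_le cX) => //; case: (hchi i).
pose l (z : H) : R := \sum_(m < N) d m * z (s m).
have cl : continuous l by exact: lincomb_continuous.
pose C := [set zw : H * H | (Z zw.1 /\ Z zw.2) /\
  (fagree E zw.1 zw.2 /\ l zw.2 = lmin zw.1)].
have cfst : continuous (fst : H * H -> H) by move=> x; exact: cvg_fst.
have csnd : continuous (snd : H * H -> H) by move=> x; exact: cvg_snd.
have cC : compact C.
  have cZZ : compact (Z `*` Z) by apply: compact_setX; exact: HX_compact.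
  apply: (subclosed_compact _ cZZ) => [|x [] //].
  have clZ := @closed_HX R X.
  have -> : C = ((fst @^-1` Z) `&` (snd @^-1` Z)) `&`
     ([set zw : H * H | fagree E zw.1 zw.2] `&`
      [set zw : H * H | l zw.2 = lmin zw.1]) by [].
  apply: closedI; apply: closedI.
  - by move/continuous_closedP : cfst; exact.
  - by move/continuous_closedP : csnd; exact.
  - exact: closed_fagree.
  - by apply: closed_eq_real; [exact: (comp_cont csnd cl)|exact: (comp_cont cfst clmin)].
have clC : closed (fst @` C).
  apply: compact_closed; first exact: HX_hausdorff.
  by apply: continuous_compact => //; exact: continuous_subspaceT.
(* The projection of the compact [C] is closed, so minimisers are needed only over step functions;
   there every value is moved to a point of its class at which [psi i] is minimal. *)
suff h w : Z w -> (fst @` C) w.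
  by move=> w /h[[w' z] [/= [Zw Zz] [wz lz]] <-]; exists z.
move: w; apply: HX_ind => // beta.
have tlt i : (i < n)%N -> t i < t i.+1 by case: pt => _ _; apply.
pose A i u := sel (i, sval beta u).
have hA i : is_HM (A i) by exact: (is_HM_comp (fun x => sel (i, x)) (svalP beta)).
have [g [hg gA]] := glue_HM tlt hA.
pose gamma : HM R X := exist _ g hg.
exists (HM_embed beta, HM_embed gamma) => //; split=> /=.
  by split; exact: HM_in.
have piece u : 0 <= u -> u < 1 -> exists2 i, (i < n)%N &
    t i <= u < t i.+1 /\ g u = sel (i, sval beta u).
  move=> u0 u1; have [i [ilt tu ut]] := partition_piece pt u0 u1.
  by exists i => //; split; [rewrite tu ut|exact: gA].
split.
  move=> phi cphi iphi a b a0 ab b1; apply: young_ext => // u au ub.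
  have [||i ilt [_ /= ->]] := piece u; try lra.
  by apply: iphi; case: (hsel (i, sval beta u)).
rewrite /l psiE; last exact: HM_in.
apply: eq_big_nat => i /andP[_ ilt]; have [t1 t2 t3] := t01 i ilt.
apply: young_ext => // u tu ut /=.
by rewrite (gA i)//; case: (hsel (i, sval beta u)).
Qed.

End FibreMin.

(** * The retraction along a well-ordered chain of open quotients *)

(** The preimage under [h] of a closed set [A] is, within [e @]
    K[, the image under]e[of the compact set]K [&] f @^-1[A]. *)
Lemma inverse_within_continuous (T Y U : topologicalType) (K : set T)
    (e : T -> Y) (f : T -> U) (h : Y -> U) :
  compact K -> hausdorff_space Y -> {within K, continuous e} -> continuous f ->
  (forall z, K z -> h (e z) = f z) -> {within e @` K, continuous h}.
Proof.
move=> cK hY ce cf hef; apply/continuous_closedP => A cA.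
apply/closed_subspaceP; exists (e @` (K `&` f @^-1` A)).
  apply: compact_closed => //; apply: continuous_compact.
    by apply: (@continuous_subspaceW T Y (K `&` f @^-1` A) K e _ ce) => x [].
  apply: compact_closedI => //.
  by move/continuous_closedP : cf; exact.
apply/seteqP; split=> y /=.
  by move=> [[z [Kz Az] <-] _]; split; [change (A (h (e z))); rewrite hef|exists z].
move=> [Ah [z Kz ezy]]; split; exists z => //; split=> //.
by change (A (f z)); rewrite -hef// ezy.
Qed.

Section Stages.
Variables (R : realType) (X : topologicalType).
Hypotheses (cX : compact [set: X]) (x0 : X).
Local Notation H := (HXspace R X).
Local Notation Z := (@HX R X).

(** [E i] stands for agreement at all stages below [i], and [s i] lists the coordinates decided at
    stage [i]. By [detE] and [s_inv] the earlier coordinates and the [E i]-invariant functions carry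
    the same information. *)
Variables (I : Type) (lt : I -> I -> Prop) (E : I -> X -> X -> Prop)
  (s : I -> nat -> SHM_index R X).
Hypotheses
  (lt_ind : forall P : I -> Prop, (forall i, (forall j, lt j i -> P j) -> P i) -> forall i, P i)
  (lt_tr : forall i j k, lt i j -> lt j k -> lt i k)
  (lt_tot : forall i j, i = j \/ lt i j \/ lt j i)
  (s_bound : forall i n x, `|(sval (s i n)).1.1 x| <= 1)
  (openE : forall i, @open_rel R X (E i))
  (detE : forall i z w, Z z -> Z w ->
     (forall j, lt j i -> forall n, z (s j n) = w (s j n)) -> fagree (E i) z w)
  (det : forall z w, Z z -> Z w -> (forall i n, z (s i n) = w (s i n)) -> z = w)
  (s_inv : forall i j, lt j i -> forall n, invariant_fun (E i) (sval (s j n)).1.1)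
  (E_mono : forall i j, lt j i -> forall x y, E i x y -> E j x y).

Local Notation h n := ((2^-1 : R) ^+ n).

Lemma halfpow_gt0 n : 0 < h n. Proof. by rewrite exprn_gt0// invr_gt0. Qed.

(** Half the derivative at [z], in the direction [z' - z], of the first [N] terms of the weighted
    sum of squares. *)
Definition gain i N (g : I -> nat -> R) (z z' : H) : R :=
  \sum_(n < N) (h n * (z (s i n) - g i n)) * (z' (s i n) - z (s i n)).

(* The variational inequality saying that [z] minimises the strictly convex
   function [sum_n 2^-n (z_n - g_n)^2] among the points of [Z] agreeing with [z]
   on the [E i]-invariant functions.  Truncating the series at [N] costs at most
   [8 * 2^-N] as all terms are bounded by [4 * 2^-n]. *)
Definition good i (g : I -> nat -> R) (z : H) := forall z', Z z' -> fagree (E i) z z' ->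
  forall N, - (8 * h N) <= gain i N g z z'.

Lemma fagree_trans i (u z w : H) : fagree (E i) u z -> fagree (E i) z w -> fagree (E i) u w.
Proof. by move=> h1 h2 phi c v; apply: (agree_trans (h1 phi c v)); exact: h2. Qed.

Lemma fagree_sym i (z w : H) : fagree (E i) z w -> fagree (E i) w z.
Proof. by move=> h1 phi c v; apply: agree_sym; exact: h1. Qed.

Lemma coord_dist (z w : H) i n : Z z -> Z w -> `|z (s i n) - w (s i n)| <= 2.
Proof.
move=> Zz Zw; have := coord_bound cX Zz (s_bound i n).
have := coord_bound cX Zw (s_bound i n); rewrite !ler_norml; lra.
Qed.

(** The obstacle is that the competitors of [f t] vary with its fibre. Freezing the coefficients at
    [t0] gives one linear functional [l], whose fibrewise minimum [lmin] is continuous; the best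
    competitor over [f t] then has gain at most [Psi t], where the cost [2 * err t] of freezing
    vanishes at [t0]. *)
Lemma good_closed (T : topologicalType) (f : T -> H) (G : T -> I -> nat -> R) i :
  continuous f -> (forall n, continuous (fun t => G t i n)) ->
  closed [set t | Z (f t) /\ good i (G t) (f t)].
Proof.
move=> cf cG t0 cl.
have Zt : Z (f t0).
  have clZf : closed (f @^-1` Z).
    by move/continuous_closedP: cf; apply; exact: closed_HX.
  by apply: clZf => B /cl[t [[Zft _] Bt]]; exists t.
split=> // z' Zz' fz' N; set z := f t0 in Zt fz' *.
apply/ler_addgt0Pr => e e0.
pose d n := h n * (z (s i n) - G t0 i n).
have [lmin [clmin lminE lmin_le lmin_at]] := fibre_min cX N d (s i) (@openE i).
pose l (w : H) : R := \sum_(n < N) d n * w (s i n).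
have cz n : continuous (fun w : H => w n : R) by exact: ptws_proj_continuous.
pose err t := \sum_(n < N) `|h n * (f t (s i n) - G t i n) - d n|.
pose Psi t := (lmin (f t) - l (f t)) + 2 * err t.
have cPsi : continuous Psi.
  apply: add_cont.
    apply: sub_cont; first exact: (comp_cont cf clmin).
    by apply: (comp_cont cf); exact: lincomb_continuous.
  apply: scale_cont; apply: sum_cont => n _.
  apply: (@comp_cont T R R _ (fun x => `|x|)); last exact: norm_continuous.
  apply: sub_cont; last exact: cst_cont.
  by apply: scale_cont; apply: sub_cont; [exact: (comp_cont cf (@cz _))|exact: cG].
have Psi0 : Psi t0 = lmin z - l z.
  rewrite /Psi /err big1 ?mulr0 ?addr0// => n _.
  by rewrite /d subrr normr0.
have : nbhs t0 [set t | Psi t < lmin z - l z + e].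
  apply: open_nbhs_nbhs; split; last by rewrite /= Psi0 ltrDl.
  by apply: open_lt_real => //; exact: cst_cont.
move=> /cl[t [[Zft gt] /= Pt]].
have [w [Zw fw lw]] := lmin_at _ Zft.
have := gt w Zw fw N.
have : gain i N (G t) (f t) w <= lmin (f t) - l (f t) + 2 * err t.
  rewrite -lw /l /err -sumrB mulr_sumr -big_split /=.
  apply: ler_sum => n _; rewrite -mulrBr.
  rewrite -lerBlDl -mulrBl; apply: (le_trans (ler_norm _)).
  by rewrite normrM mulrC ler_wpM2r// coord_dist.
have : lmin z <= l z' by rewrite (lminE z z')// lmin_le.
have -> : gain i N (G t0) z z' = l z' - l z.
  by rewrite /gain /l -sumrB; apply: eq_bigr => n _; rewrite -mulrBr.
rewrite -/(Psi t); move: Pt; lra.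
Qed.

(** Once all stages below [i] agree, [z] and [w] compete against each other at stage [i]. Adding the
    two inequalities bounds the weighted sum of the squares of their differences by [16 * h N] for
    every [N]. *)
Lemma good_unique g (z w : H) : Z z -> Z w -> (forall i, good i g z) ->
  (forall i, good i g w) -> z = w.
Proof.
move=> Zz Zw gz gw; apply: det => //.
apply: lt_ind => i IH n; have zw := detE Zz Zw IH.
apply/eqP; rewrite -subr_eq0 -sqrf_eq0; apply/eqP/le_anti; rewrite sqr_ge0 andbT.
have key N : (n < N)%N -> h n * (z (s i n) - w (s i n)) ^+ 2 <= 16 * h N.
  move=> nN.
  have := gz i w Zw zw N; have := gw i z Zz (fagree_sym zw) N.
  have : gain i N g z w + gain i N g w z =
      - \sum_(m < N) h m * (z (s i m) - w (s i m)) ^+ 2.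
    by rewrite -big_split -sumrN /=; apply: eq_bigr => m _; ring.
  have : h n * (z (s i n) - w (s i n)) ^+ 2 <=
      \sum_(m < N) h m * (z (s i m) - w (s i m)) ^+ 2.
    rewrite (bigD1 (Ordinal nN))//= lerDl sumr_ge0// => m _.
    by apply: mulr_ge0; [exact/ltW/halfpow_gt0|exact: sqr_ge0].
  lra.
apply/ler_addgt0Pl => e e0; rewrite addr0.
have e1 : 0 < h n * e / 16 by rewrite divr_gt0// mulr_gt0// halfpow_gt0.
have := @cvg_geometric R 1 2^-1; rewrite ger0_norm// => /(_ ltac:(lra)).
move=> /cvgrPdist_lt /(_ _ e1)[M _ hM].
have := hM (maxn M n.+1) (leq_maxl _ _); have := key (maxn M n.+1) (leq_maxr _ _).
rewrite sub0r normrN /geometric /= mul1r ger0_norm; last exact/ltW/halfpow_gt0.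
by move=> h1 h2; rewrite -(ler_pM2l (halfpow_gt0 n)); lra.
Qed.


Definition midpt (z w : H) : H := fun i => (z i + w i) / 2.

Lemma young_midpt (z w : H) phi a b :
  young (midpt z w) phi a b = (young z phi a b + young w phi a b) / 2.
Proof. by rewrite /young; case: pselect => *; rewrite /midpt; field. Qed.

Lemma fagree_midpt i (u z w : H) :
  fagree (E i) u z -> fagree (E i) u w -> fagree (E i) u (midpt z w).
Proof.
move=> h1 h2 phi c v a b a0 ab b1.
by rewrite young_midpt -(h1 phi c v)// -(h2 phi c v)//; field.
Qed.

(** Convexity of [Z] is available only through midpoints, so the direction of [z'] is tested at the
    points [z + 2^-k (z' - z)] reached by repeated halving. *)
Lemma gain_minimizer i N (g : I -> nat -> R) (z0 z : H) : Z z -> fagree (E i) z0 z ->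
  (forall w, Z w -> fagree (E i) z0 w ->
     \sum_(n < N) h n * (z (s i n) - g i n) ^+ 2 <=
     \sum_(n < N) h n * (w (s i n) - g i n) ^+ 2) ->
  forall z', Z z' -> fagree (E i) z0 z' -> 0 <= gain i N g z z'.
Proof.
move=> Zz fz zmin z' Zz' fz'.
pose w k := iter k (midpt z) z'.
have [Zw fw] : (forall k, Z (w k)) /\ (forall k, fagree (E i) z0 (w k)).
  split; elim=> //= k IH; first exact: (midpoint_HX cX).
  exact: fagree_midpt.
have wE k n : w k (s i n) = z (s i n) + h k * (z' (s i n) - z (s i n)).
  elim: k => [|k IH] /=; first by rewrite expr0; ring.
  by rewrite /midpt -/(w k) IH exprS; field.
pose S := \sum_(n < N) h n * (z' (s i n) - z (s i n)) ^+ 2.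
have S0 : 0 <= S.
  by apply: sumr_ge0 => n _; apply: mulr_ge0; [exact/ltW/halfpow_gt0|exact: sqr_ge0].
have key k : 0 <= 2 * gain i N g z z' + h k * S.
  have := zmin _ (Zw k) (fw k).
  have -> : \sum_(n < N) h n * (w k (s i n) - g i n) ^+ 2 =
      \sum_(n < N) h n * (z (s i n) - g i n) ^+ 2 +
      h k * (2 * gain i N g z z' + h k * S).
    rewrite /gain /S !mulr_sumr -big_split mulr_sumr -big_split /=.
    by apply: eq_bigr => n _; rewrite wE; ring.
  by rewrite lerDl pmulr_rge0// halfpow_gt0.
rewrite leNgt; apply/negP => gneg.
have e1 : 0 < - gain i N g z z' / (S + 1) by rewrite divr_gt0//; lra.
have := @cvg_geometric R 1 2^-1; rewrite ger0_norm// => /(_ ltac:(lra)).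
move=> /cvgrPdist_lt /(_ _ e1)[k _ hk].
have := hk k (leqnn k); have := key k.
rewrite sub0r normrN /geometric /= mul1r ger0_norm; last exact/ltW/halfpow_gt0.
move=> h1; rewrite ltr_pdivlMr; last lra.
have := halfpow_gt0 k; lra.
Qed.

Lemma gain_tail i N M (g : I -> nat -> R) (z z' : H) : (N <= M)%N -> Z z -> Z z' ->
  (forall n, `|g i n| <= 1) -> gain i M g z z' <= gain i N g z z' + 8 * (h N - h M).
Proof.
move=> NM Zz Zz' bg; rewrite -(subnKC NM).
elim: (M - N)%N => [|k IH]; first by rewrite addn0 subrr mulr0 addr0.
rewrite addnS [gain i (N + k).+1 g z z']/gain big_ord_recr /= -/(gain i (N + k) g z z').
apply: (le_trans (lerD IH (lexx _))).
have : (h (N + k) * (z (s i (N + k)%N) - g i (N + k)%N)) *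
    (z' (s i (N + k)%N) - z (s i (N + k)%N)) <= 4 * h (N + k).
  apply: (le_trans (ler_norm _)); rewrite !normrM (ger0_norm (ltW (halfpow_gt0 _))).
  have b1 : `|z (s i (N + k)%N) - g i (N + k)%N| <= 2.
    have := coord_bound cX Zz (s_bound i (N + k)%N).
    have := bg (N + k)%N; rewrite !ler_norml; lra.
  have b2 := coord_dist i (N + k) Zz' Zz.
  rewrite -mulrA mulrC ler_pM2r ?halfpow_gt0//.
  by have := ler_pM (normr_ge0 _) (normr_ge0 _) b1 b2; lra.
move: (_ * (z' _ - _)) => u; rewrite (exprS _ (N + k)).
lra.
Qed.

(** The infinite series is never minimised. Minimising its first [M] terms yields the inequalities
    for all [N <= M], the slack [8 * h N] absorbing the tail, and compactness provides a point that
    serves all [M]. *)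
Lemma good_exists_stage i (g : I -> nat -> R) (z0 : H) : Z z0 -> (forall n, `|g i n| <= 1) ->
  exists z, [/\ Z z, fagree (E i) z0 z & good i g z].
Proof.
move=> Zz0 bg.
have clf : closed [set z : H | fagree (E i) z0 z].
  have cid' : continuous (fun z : H => z) by move=> z; exact: cvg_id.
  exact: (closed_fagree (@cst_continuous H H z0) cid').
have cg N z' : continuous (fun z => gain i N g z z').
  apply: sum_cont => n _; apply: mul_cont; last first.
    by apply: sub_cont; [exact: cst_cont|exact: ptws_proj_continuous].
  by apply: scale_cont; apply: sub_cont; [exact: ptws_proj_continuous|exact: cst_cont].
pose F M := [set z : H | fagree (E i) z0 z /\ forall z', Z z' -> fagree (E i) z0 z' ->
  forall N, (N <= M)%N -> - (8 * h N) <= gain i N g z z'].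
have [||M|z [Zz Fz]] := @compact_directed_inter _ Z _ F 0%N (HX_compact cX).
- move=> M.
  rewrite (_ : F M = [set z | fagree (E i) z0 z] `&`
    \bigcap_(p in [set p : H * nat | [/\ Z p.1, fagree (E i) z0 p.1 & (p.2 <= M)%N]])
      [set z | - (8 * h p.2) <= gain i p.2 g z p.1]).
    apply: closedI; first exact: clf.
    by apply: closed_bigI => p _; apply: closed_le_real => //; exact: cst_cont.
  apply/seteqP; split=> z [f hz]; split=> //; first by move=> [z' N] [*]; exact: hz.
  by move=> z' Zz' fz' N NM; exact: (hz (z', N)).
- move=> M N; exists (maxn M N) => z [f hz]; split; split=> // z' Zz' fz' K KM;
    by apply: hz => //; apply: leq_trans KM _; rewrite ?leq_maxl ?leq_maxr.
- pose Q z := \sum_(n < M) h n * (z (s i n) - g i n) ^+ 2.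
  have cQ : continuous (Q : H -> R).
    apply: sum_cont => n _; apply: scale_cont.
    under eq_fun do rewrite expr2.
    by apply: mul_cont; (apply: sub_cont; [exact: ptws_proj_continuous|exact: cst_cont]).
  have cK : compact (Z `&` [set z | fagree (E i) z0 z]).
    by apply: compact_closedI; [exact: HX_compact|exact: clf].
  have [|z [[Zz fz] zmin]] := compact_min _ cK cQ; first by exists z0; split=> // phi.
  exists z; split=> //; split=> // z' Zz' fz' N NM.
  have := @gain_minimizer i M g z0 z Zz fz (fun w Zw fw => zmin w (conj Zw fw)) z' Zz' fz'.
  have := gain_tail NM Zz Zz' bg; have := halfpow_gt0 M; lra.
exists z; split=> //; first by case: (Fz 0%N).
move=> z' Zz' fz' N; have [fz hz] := Fz N.
by apply: hz => //; exact: fagree_trans fz'.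
Qed.

(** A correction at stage [i] moves only inside an [E i]-fibre, which fixes all coordinates of
    earlier stages and hence does not spoil their inequalities. *)
Lemma good_fagree i k g (z w : H) : lt k i -> fagree (E i) z w -> good k g z -> good k g w.
Proof.
move=> ki fzw gz z' Zz' fwz' N.
have zw n : z (s k n) = w (s k n).
  apply: agree_coord; apply: fzw; last exact: s_inv.
  by case: (svalP (s k n)).
have fk : fagree (E k) z w.
  by move=> phi c v; apply: fzw => // x y exy; apply: v; exact: E_mono exy.
rewrite (_ : gain k N g w z' = gain k N g z z').
  by apply: gz => //; exact: fagree_trans fwz'.
by apply: eq_bigr => n _; rewrite zw.
Qed.

Lemma good_exists (g : I -> nat -> R) : (forall i n, `|g i n| <= 1) ->
  exists z, Z z /\ forall i, good i g z.
Proof.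
move=> bg.
(* Used below [i] in the induction and for all of [I] at the end: solutions on initial segments form
   a directed family of closed subsets of the compact [Z]. *)
have glue (P : I -> Prop) : (forall i j, P i -> P j -> i = j \/ lt i j \/ lt j i) ->
    (forall i, P i -> exists z, Z z /\ forall k, k = i \/ lt k i -> good k g z) ->
    exists z, Z z /\ forall i, P i -> good i g z.
  move=> Ptot Pex.
  have [[i0 Pi0]|nP] := pselect (exists i, P i); last first.
    have [z Zz] := HX_nonempty R x0; exists z; split=> // i Pi.
    by exfalso; apply: nP; exists i.
  pose F (i : {i | P i}) := [set z : H | forall k, k = sval i \/ lt k (sval i) ->
     Z z /\ good k g z].
  have [||i|z [Zz Fz]] := @compact_directed_inter _ Z _ F (exist _ i0 Pi0) (HX_compact cX).
  - move=> i.
    rewrite (_ : F i = \bigcap_(k in [set k | k = sval i \/ lt k (sval i)])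
      [set z | Z z /\ good k g z]); last by apply/seteqP; split=> z hz k; exact: hz.
    apply: closed_bigI => k _.
    apply: (@good_closed H id (fun _ => g)) => [z|n]; first exact: cvg_id.
    exact: cst_cont.
  - move=> i j; have [ij|[ij|ji]] := Ptot _ _ (svalP i) (svalP j).
    + by exists i => z hz; split=> // k; rewrite -ij; exact: hz.
    + exists j => z hz; split=> // k ki; apply: hz; right.
      by case: ki => [->//|ki]; exact: lt_tr ij.
    + exists i => z hz; split=> // k ki; apply: hz; right.
      by case: ki => [->//|ki]; exact: lt_tr ji.
  - by have [z [Zz hz]] := Pex _ (svalP i); exists z; split=> // k ki; split=> //; exact: hz.
  exists z; split=> // i Pi.
  by have [] := Fz (exist _ i Pi) i (or_introl erefl).
have [//||z [Zz hz]] := glue (fun=> True); last by exists z; split=> // i; exact: hz.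
move=> + _; apply: lt_ind => i IH.
have [//|//|z0 [Zz0 hz0]] := glue (fun k => lt k i).
have [z [Zz fz gz]] := good_exists_stage Zz0 (bg i).
exists z; split=> // k [->//|ki].
by apply: (good_fagree ki fz); exact: hz0.
Qed.

Theorem stages_absolute_retract : absolute_retract Z.
Proof.
move=> Y cY hY e ce ie.
have eK : compact (e @` Z) by apply: continuous_compact => //; exact: HX_compact.
have einj z w : Z z -> Z w -> e z = e w -> z = w.
  by move=> Zz Zw; apply: ie; rewrite inE.
have ext i n : exists g : Y -> R, [/\ continuous g, forall y, `|g y| <= 1 &
    forall z, Z z -> g (e z) = z (s i n)].
  have /choice[f hf] (y : Y) : exists r : R, forall z, Z z -> e z = y -> r = z (s i n).
    have [[z [Zz zy]]|nz] := pselect (exists z, Z z /\ e z = y).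
      by exists (z (s i n)) => w Zw wy; rewrite (einj z w)// zy wy.
    by exists 0 => z Zz zy; exfalso; apply: nz; exists z.
  have fe z : Z z -> f (e z) = z (s i n) by move=> Zz; exact: hf.
  have cf : {within e @` Z, continuous f}.
    apply: (inverse_within_continuous (HX_compact cX) hY ce _ fe).
    exact: ptws_proj_continuous.
  have [|g [fg cg bg]] := @continuous_bounded_extension Y R (compact_normal hY cY)
      (e @` Z) (compact_closed hY eK) f 1 ltr01 cf.
    by move=> _ [z Zz <-]; rewrite fe// (coord_bound cX Zz (s_bound i n)).
  exists g; split=> // z Zz; rewrite -fg ?fe//.
  by rewrite inE; exists z.
have /choice[G hG] (p : I * nat) := ext p.1 p.2.
pose g y i n := G (i, n) y.
have bg y i n : `|g y i n| <= 1 by rewrite /g; case: (hG (i, n)).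
have cg i n : continuous (fun y => g y i n) by rewrite /g; case: (hG (i, n)).
have ge z i n : Z z -> g (e z) i n = z (s i n).
  by rewrite /g; case: (hG (i, n)) => _ _ ge' Zz; exact: ge'.
have /choice[r hr] (y : Y) := good_exists (bg y).
exists r; split; [|split].
- pose Gr := [set zy : H * Y | forall i, Z zy.1 /\ good i (g zy.2) zy.1].
  apply: (@closed_graph_continuous Y H Z Gr) => //; first exact: HX_compact.
  + rewrite (_ : Gr = \bigcap_i [set zy | Z zy.1 /\ good i (g zy.2) zy.1]).
      apply: closed_bigI => i _; apply: good_closed => [x|n]; first exact: cvg_fst.
      by apply: (comp_cont _ (cg i n)) => x; exact: cvg_snd.
    by apply/seteqP; split=> zy hz i *; apply: hz.
  + by move=> y; case: (hr y).
  + by move=> y i /=; have [? gy] := hr y; split=> //; exact: gy.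
  + move=> y z Zz gz; have [Zr gr] := hr y.
    by apply: (good_unique Zz Zr) => i //; have [] := gz i.
- by move=> y; case: (hr y).
(* At [e z] the prescribed values are the coordinates of [z] itself, so every gain vanishes and
   uniqueness gives [z]. *)
- move=> z Zz; have [Zr gr] := hr (e z); symmetry.
  apply: (good_unique Zz Zr) => // i z' Zz' fz' N.
  rewrite /gain big1 => [|n _]; last by rewrite ge// subrr mulr0 mul0r.
  by rewrite oppr_le0 mulr_ge0// ltW// halfpow_gt0.
Qed.

End Stages.

(** * Open maps and dense sequences *)

Section OpenMaps.
Variable R : realType.

Lemma countable_enum (T : Type) (D : set T) (t0 : T) : countable D ->
  exists e : nat -> T, forall d, D d -> exists n, e n = d.
Proof.
move=> /countable_injP[f finj].
have /choice[e he] (n : nat) : exists t, forall d, D d -> f d = n -> t = d.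
  have [[d [Dd fd]]|nd] := pselect (exists d, D d /\ f d = n).
    by exists d => d' Dd' fd'; apply: finj; rewrite ?inE// fd.
  by exists t0 => d Dd fd; exfalso; apply: nd; exists d.
by exists e => d Dd; exists (f d); exact: he.
Qed.

Lemma countable_setU (T : Type) (A B : set T) :
  countable A -> countable B -> countable (A `|` B).
Proof.
move=> cA cB; rewrite -bigcup2E; apply: bigcup_countable => // n _.
by rewrite /bigcup2; case: ifP => // _; case: ifP => // _; exact: countable0.
Qed.

Lemma semicont_continuous (T : topologicalType) (f : T -> R) :
  (forall c, open [set x | f x < c]) -> (forall c, open [set x | c < f x]) ->
  continuous f.
Proof.
move=> flt fgt x; apply/cvgrPdist_lt => e e0.
have n1 : nbhs x [set y | f y < f x + e].
  by apply: open_nbhs_nbhs; split; [exact: flt|rewrite /= ltrDl].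
have n2 : nbhs x [set y | f x - e < f y].
  by apply: open_nbhs_nbhs; split; [exact: fgt|rewrite /= ltrBlDr ltrDl].
by apply: filterS2 n1 n2 => y /= h1 h2; rewrite ltr_norml; lra.
Qed.

Lemma closed_fun_eq (T K : topologicalType) (f g : T -> K) :
  hausdorff_space K -> continuous f -> continuous g -> closed [set x | f x = g x].
Proof.
move=> hK cf cg x cl; apply: hK => A B Afx Bgx.
have nA : nbhs x (f @^-1` A) by exact: cf.
have nB : nbhs x (g @^-1` B) by exact: cg.
have := cl (f @^-1` A `&` g @^-1` B) (filterI nA nB).
by move=> [y [/= fgy [Ay By]]]; exists (f y); split=> //=; rewrite fgy.
Qed.

Lemma hausdorff_sep (K : topologicalType) (x y : K) : hausdorff_space K -> x <> y ->
  exists A B : set K, [/\ open A, open B, A x, B y & forall z, A z -> ~ B z].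
Proof.
rewrite open_hausdorff => hK /eqP xy.
have [[A B] /= [Ax By] [oA oB /eqP AB]] := hK x y xy.
move/set_mem: Ax => Ax; move/set_mem: By => By.
exists A, B; split=> // z Az Bz; have : (A `&` B) z by [].
by rewrite AB.
Qed.

Variables (X : topologicalType).
Hypothesis (cX : compact [set: X]).

(** The fibrewise minimum is upper semicontinuous because [q] is open, and lower semicontinuous
    because [q] is closed, its domain being compact. *)
Lemma open_rel_of_map (K : topologicalType) (q : X -> K) : hausdorff_space K ->
  continuous q -> (forall U, open U -> open (q @` U)) ->
  @open_rel R X (fun x y => q x = q y).
Proof.
move=> hK cq oq phi cphi.
have /choice[sel hsel] (x : X) : exists y, q x = q y /\
    forall y', q x = q y' -> phi y <= phi y'.
  have cC : compact [set y | q x = q y].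
    apply: (subclosed_compact _ cX) => //.
    by apply: closed_fun_eq => //; exact: cst_continuous.
  have [|y [qy ymin]] := compact_min _ cC cphi; first by exists x.
  by exists y.
exists (fun x => phi (sel x)); split.
- apply: semicont_continuous => c.
    have oc : open [set y | phi y < c] by apply: open_lt_real => //; exact: cst_cont.
    rewrite (_ : [set x | _] = q @^-1` (q @` [set y | phi y < c])).
      by move/continuousP : cq; apply; exact: oq.
    apply/seteqP; split=> x /= => [h|[y yc qyx]].
      by exists (sel x) => //; case: (hsel x).
    by case: (hsel x) => _ /(_ y (esym qyx)) h; exact: le_lt_trans yc.
  have cc : closed (q @` [set y | phi y <= c]).
    apply: compact_closed => //; apply: continuous_compact; first exact: continuous_subspaceT.
    apply: (subclosed_compact _ cX) => //.
    by apply: closed_le_real => //; exact: cst_cont.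
  rewrite (_ : [set x | _] = ~` (q @^-1` (q @` [set y | phi y <= c]))).
    by apply: closed_openC; move/continuous_closedP : cq; exact.
  apply/seteqP; split=> x /= => [h [y yc qyx]|nh].
    by case: (hsel x) => _ /(_ y (esym qyx)); lra.
  rewrite ltNge; apply/negP => h; apply: nh; exists (sel x) => //.
  by case: (hsel x).
- move=> x y qxy; apply/le_anti/andP; split.
    by case: (hsel x) => _; apply; case: (hsel y) => <-.
  by case: (hsel y) => _; apply; case: (hsel x) => <-.
- by move=> x; case: (hsel x) => _; exact.
- by move=> x; exists (sel x); case: (hsel x).
Qed.

Lemma open_rel_total (x0 : X) : @open_rel R X (fun _ _ => True).
Proof.
move=> phi cphi; have [|y [_ ymin]] := compact_min _ cX cphi; first by exists x0.
exists (fun=> phi y); split=> //; first exact: cst_cont.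
- by move=> x; exact: ymin.
- by move=> x; exists y.
Qed.

Local Notation H := (HXspace R X).
Local Notation Z := (@HX R X).

Section Dense.
Variables (K : topologicalType) (q : X -> K).
Hypotheses (cK : compact [set: K]) (hK : hausdorff_space K)
  (wK : weight_le_omega K) (cq : continuous q) (oq : forall U, open U -> open (q @` U)).

(** The sequence consists of finite maxima of rational multiples of Urysohn functions for pairs of
    basic open sets of [K]. By compactness these approximate uniformly, from below, every invariant
    function with values in [[0, 1]]; the general case follows by affine rescaling. *)
Lemma dense_sequence : exists u : nat -> X -> R,
  [/\ forall n, continuous (u n), forall n x, `|u n x| <= 1,
      forall n x y, q x = q y -> u n x = u n y
    & forall z w, Z z -> Z w -> (forall n, agree z w (u n)) ->
        fagree (fun x y => q x = q y) z w].
Proof.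
have [B [[oB bB] /(countable_enum set0)[V hV]]] := wK.
have /choice[v hv] (ij : nat * nat) : exists v : K -> R, [/\ continuous v,
    forall x, 0 <= v x <= 1 & closure (V ij.1) `<=` V ij.2 -> open (V ij.2) ->
    (forall x, V ij.1 x -> v x = 1) /\ (forall x, ~ V ij.2 x -> v x = 0)].
  have [[cl op]|nh] := pselect (closure (V ij.1) `<=` V ij.2 /\ open (V ij.2)).
    have [|||f [cf f01 f0 f1]] := @urysohn_fun R K (~` V ij.2) (closure (V ij.1)) cK hK.
    - exact: open_closedC.
    - exact: closed_closure.
    - by apply/seteqP; split=> x // [nx /cl].
    exists f; split=> // _ _; split=> x; first by move=> Vx; apply: f1; exact: subset_closure.
    exact: f0.
  exists (fun=> 0); split=> [|x|cl op]; first exact: cst_cont.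
    by rewrite lexx ler01.
  by exfalso; apply: nh.
(* Rationals outside [[0, 1]] are sent to [0], which keeps every [term] in [[0, 1]]. *)
pose cf (c : rat) : R := if 0 <= (ratr c : R) <= 1 then ratr c else 0.
have cf01 c : 0 <= cf c <= 1 by rewrite /cf; case: ifP => // _; rewrite lexx ler01.
pose term (t : rat * (nat * nat)) x := cf t.1 * v t.2 (q x).
have cterm t : continuous (term t).
  by apply: scale_cont; apply: (comp_cont cq); case: (hv t.2).
have term01 t x : 0 <= term t x <= 1.
  have [_ /(_ (q x))/andP[v0 v1] _] := hv t.2; have /andP[c0 c1] := cf01 t.1.
  by rewrite mulr_ge0//= mulr_ile1.
pose u_ (l : seq (rat * (nat * nat))) x := foldr (fun t m => Num.max (term t x) m) 0 l.
have cu l : continuous (u_ l).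
  by elim: l => [|t l IH]; [exact: cst_cont|apply: max_cont].
have u01 l x : 0 <= u_ l x <= 1.
  elim: l => [|t l /andP[IH1 IH2]]; first by rewrite /= lexx ler01.
  by rewrite /= le_max ge_max IH1 IH2 orbT /= andbT; case/andP: (term01 t x).
have uq l x y : q x = q y -> u_ l x = u_ l y.
  by move=> qxy; elim: l => //= t l ->; rewrite /term qxy.
have u_cat l l' x : u_ l x <= u_ (l ++ l') x /\ u_ l' x <= u_ (l ++ l') x.
  have u_cons t k : u_ (t :: k) x = Num.max (term t x) (u_ k x) by [].
  elim: l => [|t l [IH1 IH2]]; first by have /andP[] := u01 l' x.
  by rewrite cat_cons !u_cons ge_max !le_max lexx IH1 IH2 !orbT.
pose u n := u_ (odflt [::] (unpickle n)).
exists u; split=> //.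
- by move=> n; exact: cu.
- by move=> n x; have /andP[? ?] := u01 (odflt [::] (unpickle n)) x; rewrite ger0_norm.
- by move=> n x y; exact: uq.
move=> z w Zz Zw zwu.
have zwu_ l : agree z w (u_ l) by have := zwu (pickle l); rewrite /u pickleK.
have agree01 (phi : X -> R) : continuous phi -> (forall x y, q x = q y -> phi x = phi y) ->
    (forall x, 0 <= phi x <= 1) -> agree z w phi.
  move=> cphi iphi phi01; apply: agree_closed => // e e0.
  (* Concatenation keeps a maximum below [phi], so the sets where it falls short by [e] are
     directed. A common point [x] is refuted by a single multiple that exceeds [phi x - e] at
     [x]. *)
  pose J := {l | forall x, u_ l x <= phi x}.
  pose F (l : J) := [set x | u_ (sval l) x <= phi x - e].
  have nil_ok x : u_ [::] x <= phi x by have /andP[] := phi01 x.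
  have [[l hl]|hF] := pselect (exists l : J, F l = set0).
    exists (u_ (sval l)); split=> [||x]; [exact: cu|exact: zwu_|].
    have : ~ F l x by rewrite hl.
    rewrite /F /= => /negP; rewrite -ltNge => h; have := svalP l x => h'.
    by rewrite ger0_norm ?subr_ge0//; lra.
  have [||l|x [_ Fx]] := @compact_directed_inter X setT J F (exist _ [::] nil_ok) cX.
  - by move=> l; apply: closed_le_real => //; apply: sub_cont => //; exact: cst_cont.
  - move=> l l'.
    have h x : u_ (sval l ++ sval l') x <= phi x.
      have := svalP l; have := svalP l'; move: (sval l) (sval l') => k k' hk' hk.
      elim: k hk => [|t k IH] hk /=; first exact: hk'.
      have := hk x; rewrite /= !ge_max => /andP[-> _] /=; apply: IH => y.
      by have := hk y; rewrite /= ge_max => /andP[].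
    exists (exist _ _ h) => x; rewrite /F /= => hx.
    by split; apply: le_trans hx; case: (u_cat (sval l) (sval l') x).
  - apply: contrapT => /nonemptyPn h0; apply: hF; exists l.
    by rewrite -h0 setTI.
  exfalso.
  have phixe : e <= phi x by have := Fx (exist _ [::] nil_ok); rewrite /F /=; lra.
  have /andP[phi0 phi1] := phi01 x.
  have [c] := @rat_in_itvoo R (phi x - e) (phi x) ltac:(lra).
  rewrite in_itv /= => /andP[c1 c2].
  (* Openness of [q] brings the superlevel set down to [K], where there is room for basic sets [Vi]
     and [Vj] with the closure of [Vi] inside [Vj] and [Vj] inside [W]. *)
  pose W := q @` [set y | ratr c < phi y].
  have oW : open W by apply: oq; apply: open_lt_real => //; exact: cst_cont.
  have Wq y : W (q y) -> ratr c < phi y by move=> [y' h /iphi <-].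
  have Wx : W (q x) by exists x.
  have [Vj [BVj [Vjx VjW]]] := bB _ _ oW Wx.
  have nVj : nbhs (q x) Vj by apply: open_nbhs_nbhs; split=> //; exact: oB.
  have [U nU clU] := @compact_regular K (q x) setT hK cK filterT _ nVj.
  have [Vi [BVi [Vix ViU]]] := bB _ _ (open_interior U) nU.
  have [i hi] := hV _ BVi; have [j hj] := hV _ BVj.
  have [_ v01 vP] := hv (i, j).
  have [|| v1 v0] := vP.
  - rewrite /= hi hj; apply: subset_trans clU; apply: closureS.
    exact: (subset_trans ViU (@interior_subset _ _)).
  - by rewrite /= hj; exact: oB.
  have cfc : cf c = ratr c by rewrite /cf ifT//; apply/andP; split; lra.
  have tle y : term (c, (i, j)) y <= phi y.
    rewrite /term /= cfc.
    have [Vy|nVy] := pselect (Vj (q y)); last first.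
      by rewrite v0 ?mulr0/= ?hj//; case/andP: (phi01 y).
    have := Wq y (VjW _ Vy); have /andP[w0 w1] := v01 (q y) => h.
    by apply: ltW; apply: le_lt_trans h; rewrite ler_piMr//; lra.
  have ule y : u_ [:: (c, (i, j))] y <= phi y.
    by rewrite /= ge_max tle; case/andP: (phi01 y).
  have := Fx (exist _ _ ule); rewrite /F /= /term /= v1 ?hi// cfc mulr1 ge_max.
  by case/andP; lra.
move=> phi cphi iphi.
have [M [M0 bM]] := compact_bound cX cphi.
pose psi x := M + 1 * phi x.
have cpsi : continuous psi by apply: add_cont; [exact: cst_cont|exact: scale_cont].
pose chi x := 0 + (2 * M)^-1 * psi x.
have cchi : continuous chi by apply: add_cont; [exact: cst_cont|exact: scale_cont].
have achi : agree z w chi.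
  apply: agree01 => //.
    by move=> x y qxy; rewrite /chi /psi (iphi x y qxy).
  move=> x; have := bM x; rewrite ler_norml /chi /psi add0r mul1r => /andP[h1 h2].
  rewrite mulr_ge0 ?invr_ge0//=; try lra.
  rewrite mulrC ler_pdivrMr; lra.
have -> : phi = (fun x => - M + (2 * M) * chi x).
  apply/funext => x; rewrite /chi /psi add0r mulrA divff ?mul1r; first ring.
  by apply: lt0r_neq0; lra.
by apply: agree_lin => //; [exact: cst_cont|exact: agree_cst].
Qed.

End Dense.
End OpenMaps.

(** * Sufficiency *)

Section OmegaSystem.
Variables (R : realType) (X : topologicalType).
Hypotheses (cX : compact [set: X]) (hX : hausdorff_space X) (x0 : X).
Local Notation H := (HXspace R X).
Local Notation Z := (@HX R X).

Variables (A : Type) (le : A -> A -> Prop) (Xs : A -> topologicalType)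
  (p : forall a b : A, Xs b -> Xs a).
Arguments p : clear implicits.
Hypothesis sys : @omega_system A le Xs p.
Hypothesis openp : forall a b, le a b -> forall U : set (Xs b), open U -> open (p a b @` U).
Variables (f : X -> prod_topology Xs) (g : prod_topology Xs -> X).
Hypotheses (cf : continuous f) (fL : forall x, system_limit le p (f x))
  (gf : forall x, g (f x) = x) (fg : forall y, system_limit le p y -> f (g y) = y).

Let q a x : Xs a := f x a.

Let le_tr a b c : le a b -> le b c -> le a c.
Proof. by case: sys => _ [h _]; exact: h. Qed.

Let le_dir a b : exists c, le a c /\ le b c.
Proof. by case: sys => _ [_ [_ [_ [h _]]]]; exact: h. Qed.

Let le_refl a : le a a.
Proof. by case: sys. Qed.

Let lub_ex (C : set A) : C !=set0 -> countable C -> exists s, is_lub le C s.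
Proof. by case: sys => _ [_ [_ [_ [_ [h _]]]]]; exact: h. Qed.

Let Xs_top a : compact [set: Xs a] /\ hausdorff_space (Xs a) /\ weight_le_omega (Xs a).
Proof. by case: sys => _ [_ [_ [_ [_ [_ [h _]]]]]]; exact: h. Qed.

Let p_cont a b : le a b -> continuous (p a b).
Proof. by case: sys => _ [_ [_ [_ [_ [_ [_ [h _]]]]]]] /h[]. Qed.

Let p_surj a b : le a b -> forall y, exists x, p a b x = y.
Proof. by case: sys => _ [_ [_ [_ [_ [_ [_ [h _]]]]]]] /h[]. Qed.

Let p_comp a b c : le a b -> le b c -> forall x : Xs c, p a b (p b c x) = p a c x.
Proof. by case: sys => _ [_ [_ [_ [_ [_ [_ [_ [_ [h _]]]]]]]]]; exact: h. Qed.

Let limit_unique (B : set A) (beta : A) : B !=set0 ->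
  (forall a b, B a -> B b -> exists c, B c /\ le a c /\ le b c) ->
  is_lub le B beta ->
  forall x : forall a, Xs a,
    (forall a b, B a -> B b -> le a b -> p a b (x b) = x a) ->
  exists y : Xs beta, (forall a, B a -> p a beta y = x a) /\
    (forall y' : Xs beta, (forall a, B a -> p a beta y' = x a) -> y' = y).
Proof. by case: sys => _ [_ [_ [_ [_ [_ [_ [_ [_ [_ h]]]]]]]]]; exact: h. Qed.

Lemma limit_proj_continuous a : continuous (q a).
Proof. exact: (comp_cont cf (@ptws_proj_continuous A Xs a)). Qed.

Lemma limit_proj_compat a b x : le a b -> p a b (q b x) = q a x.
Proof. exact: fL. Qed.

Lemma limit_proj_separate x y : (forall a, q a x = q a y) -> x = y.
Proof.
by move=> h; rewrite -(gf x) -(gf y); congr g; exact: functional_extensionality_dep.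
Qed.

Lemma limit_proj_surj a (t : Xs a) : exists x, q a x = t.
Proof.
have cP : compact [set: prod_topology Xs].
  have := @tychonoff {classic A} Xs (fun=> setT) (fun b => (Xs_top b).1).
  by congr compact; apply/seteqP; split.
pose F b := [set y : prod_topology Xs | y a = t /\ forall c, le c b -> p c b (y b) = y c].
have cproj b : continuous (fun y : prod_topology Xs => y b).
  exact: ptws_proj_continuous.
have [|||y [_ Fy]] := @compact_directed_inter _ setT A F a cP.
- move=> b; rewrite (_ : F b = [set y : prod_topology Xs | y a = t] `&`
     \bigcap_(c in [set c | le c b]) [set y | p c b (y b) = y c]).
    apply: closedI.
      by apply: closed_fun_eq; [exact: (Xs_top a).2.1|exact: cproj|exact: cst_continuous].
    apply: closed_bigI => c cb; apply: closed_fun_eq.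
    + exact: (Xs_top c).2.1.
    + exact: (comp_cont (@cproj b) (p_cont cb)).
    + exact: cproj.
  by apply/seteqP; split=> y [ya yc]; split=> // c cb; exact: yc.
- move=> b b'; have [d [bd b'd]] := le_dir b b'; exists d => y [ya yd].
  by split; split=> // c cb; [rewrite -(yd b bd) (p_comp cb bd) yd//; exact: le_tr bd|
    rewrite -(yd b' b'd) (p_comp cb b'd) yd//; exact: le_tr b'd].
- move=> b; have [d [ad bd]] := le_dir a b; have [z pz] := p_surj ad t.
  (* [F b] constrains only the coordinate [a] and those below [b], all of them below [d]; the others
     are filled in from [x0]. *)
  exists (fun c => if pselect (le c d) is left _ then p c d z else f x0 c).
  split=> //; split; first by case: pselect.
  move=> c cb; case: pselect => // bd'; case: pselect => [cd|]; first exact: p_comp.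
  by case; exact: le_tr bd.
exists (g y); rewrite /q fg; first by case: (Fy a).
by move=> c b cb; have [_] := Fy b; exact.
Qed.

(** By compactness the fibre of some [q b] through [x] lies inside [U]. At an index [c] above [a]
    and [b] the claim then reduces to openness of the bonding map from [c] to [a]. *)
Lemma limit_proj_open a (U : set X) : open U -> open (q a @` U).
Proof.
move=> oU; rewrite openE => _ [x Ux <-].
pose F b := [set x' : X | q b x' = q b x /\ ~ U x'].
have clF b : closed (F b).
  apply: closedI; last exact: open_closedC.
  by apply: closed_fun_eq; [exact: (Xs_top b).2.1|exact: limit_proj_continuous|
    exact: cst_continuous].
have [b Fb] : exists b, F b = set0.
  apply: contrapT => nF.
  have [||b|y [_ Fy]] := @compact_directed_inter X setT A F a cX.
  - exact: clF.
  - move=> b b'; have [d [bd b'd]] := le_dir b b'; exists d => y [yd nUy].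
    have e c : le c d -> q c y = q c x.
      by move=> cd; rewrite -(limit_proj_compat y cd) yd limit_proj_compat.
    by split; split=> //; exact: e.
  - by apply: contrapT => /nonemptyPn Fb; apply: nF; exists b; rewrite -Fb setTI.
  case: (Fy a) => _; apply; rewrite (_ : y = x)//.
  by apply: limit_proj_separate => b; case: (Fy b).
have [c [ac bc]] := le_dir a b.
pose W := ~` (q b @` (~` U)).
have oW : open W.
  apply: closed_openC; apply: compact_closed; first exact: (Xs_top b).2.1.
  apply: continuous_compact; first exact/continuous_subspaceT/limit_proj_continuous.
  by apply: (subclosed_compact _ cX) => //; exact: open_closedC.
have oV : open (p a c @` (p b c @^-1` W)).
  by apply: openp => //; have /continuousP := p_cont bc; exact.
have sub : p a c @` (p b c @^-1` W) `<=` q a @` U.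
  move=> _ [y Wy <-]; have [x' qx'] := @limit_proj_surj c y.
  exists x'; last by rewrite -(limit_proj_compat _ ac) qx'.
  apply: contrapT => nU; apply: Wy; exists x' => //.
  by rewrite -(limit_proj_compat _ bc) qx'.
apply: (filterS sub); apply: open_nbhs_nbhs; split=> //.
exists (q c x); last exact: limit_proj_compat.
rewrite /= limit_proj_compat// => -[x' nU qx'].
have : F b x' by [].
by rewrite Fb.
Qed.

Lemma limit_open_rel a : @open_rel R X (fun x y => q a x = q a y).
Proof.
apply: open_rel_of_map => //; first exact: (Xs_top a).2.1.
  exact: limit_proj_continuous.
exact: limit_proj_open.
Qed.

(* A continuous function that is constant on the classes of the intersection of
   a chain of these relations is nearly constant on the classes of one of them. *)
Lemma agree_chain (J : Type) (a : J -> A) (z w : H) (phi : X -> R) (j0 : J) :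
  (forall i j, exists k, le (a i) (a k) /\ le (a j) (a k)) ->
  Z z -> Z w -> continuous phi ->
  (forall x y, (forall j, q (a j) x = q (a j) y) -> phi x = phi y) ->
  (forall j, fagree (fun x y => q (a j) x = q (a j) y) z w) -> agree z w phi.
Proof.
move=> adir Zz Zw cphi iphi zw; apply: agree_closed => // e e0.
pose F j := [set xy : X * X | q (a j) xy.1 = q (a j) xy.2 /\ e <= phi xy.1 - phi xy.2].
have cfst : continuous (fst : X * X -> X) by move=> x; exact: cvg_fst.
have csnd : continuous (snd : X * X -> X) by move=> x; exact: cvg_snd.
have [j Fj] : exists j, F j = set0.
  apply: contrapT => nF.
  have cXX : compact [set: X * X] by rewrite -setXTT; exact: compact_setX.
  have [||j|[x y] [_ Fxy]] := @compact_directed_inter _ setT J F j0 cXX.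
  - move=> j; apply: closedI.
      apply: closed_fun_eq; first exact: (Xs_top _).2.1.
        exact: (comp_cont cfst (@limit_proj_continuous _)).
      exact: (comp_cont csnd (@limit_proj_continuous _)).
    apply: closed_le_real; first exact: cst_cont.
    by apply: sub_cont; [exact: (comp_cont cfst cphi)|exact: (comp_cont csnd cphi)].
  - move=> i j; have [k [ik jk]] := adir i j; exists k => -[x y] [/= qxy exy].
    have eq_k c : le c (a k) -> q c x = q c y.
      by move=> ck; rewrite -(limit_proj_compat x ck) qxy limit_proj_compat.
    by split; split=> //=; exact: eq_k.
  - by apply: contrapT => /nonemptyPn Fj; apply: nF; exists j; rewrite -Fj setTI.
  have /iphi /= xy : forall j, q (a j) x = q (a j) y by move=> j; case: (Fxy j).
  by have [_ /=] := Fxy j0; rewrite xy subrr leNgt e0.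
(* As [F j] is empty, [phi] varies by less than [e] on each class, so its fibrewise minimum is an
   invariant approximation. *)
have [psi [cpsi ipsi le1 at1]] := limit_open_rel (a j) cphi.
exists psi; split=> //; first exact: (zw j psi cpsi ipsi).
move=> x; rewrite ger0_norm ?subr_ge0//.
have [y [qxy <-]] := at1 x; rewrite leNgt; apply/negP => he.
have Fxy : F j (x, y) by split=> //=; exact: ltW.
by rewrite Fj in Fxy.
Qed.

Variables (B : set (set X)) (r : set X -> set X -> Prop).
Hypotheses (baseB : is_base B)
  (r_irr : forall x, B x -> ~ r x x)
  (r_tr : forall x y z, B x -> B y -> B z -> r x y -> r y z -> r x z)
  (r_tot : forall x y, B x -> B y -> x = y \/ r x y \/ r y x)
  (r_wf : forall C, C `<=` B -> C !=set0 -> exists m, C m /\ forall y, C y -> ~ r y m)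
  (r_count : forall x, B x -> countable [set y | B y /\ r y x]).

Let I := {U | B U}.
Let lt (i j : I) := r (sval i) (sval j).

Lemma countable_initial (i : I) : countable [set j : I | j = i \/ lt j i].
Proof.
have cS : countable ([set sval i] `|` [set y | B y /\ r y (sval i)]).
  by apply: countable_setU; [exact: countable1|exact: r_count (svalP i)].
move/countable_injP : cS => [k kinj]; apply/countable_injP; exists (k \o sval).
move=> j j'; rewrite !inE => jS j'S /= kjj'.
have h (l : I) : l = i \/ lt l i ->
    sval l \in [set sval i] `|` [set y | B y /\ r y (sval i)].
  move=> [->|li]; rewrite inE; [by left|right; split=> //; exact: svalP].
have := kinj _ _ (h _ jS) (h _ j'S) kjj'.
by case: j j' {jS j'S kjj'} => j hj [j' hj'] /= jj'; exact: eq_exist.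
Qed.

Lemma system_absolute_retract : absolute_retract Z.
Proof.
have [oB bB] := baseB.
have lt_trans i j k : lt i j -> lt j k -> lt i k.
  by apply: r_tr; exact: svalP.
have lt_tot i j : i = j \/ lt i j \/ lt j i.
  case: (r_tot (svalP i) (svalP j)); last by right.
  by case: i j => i hi [j hj] /= ij; left; exact: eq_exist.
have lt_ind (P : I -> Prop) : (forall i, (forall j, lt j i -> P j) -> P i) -> forall i, P i.
  move=> hP i; apply: contrapT => nPi.
  have [||U [[hU nPU] Umin]] := @r_wf [set U | exists hU : B U, ~ P (exist _ U hU)].
  - by move=> U [].
  - by case: i nPi => V hV nP; exists V, hV.

  apply: nPU; apply: hP => -[V hV] /= VU; apply: contrapT => nPV.
  by apply: (Umin V) => //; exists hV.
(* [h (U, V)] is an index at which the images of [U] and [V] are disjoint, whenever one exists.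
   Since pairs of basic sets separate points, these indices suffice. *)
have /choice[h hh] (UV : I * I) : exists a : A,
    (exists a, forall u v, sval UV.1 u -> sval UV.2 v -> q a u <> q a v) ->
    forall u v, sval UV.1 u -> sval UV.2 v -> q a u <> q a v.
  have [[a ha]|nh] := pselect (exists a, forall u v,
      sval UV.1 u -> sval UV.2 v -> q a u <> q a v).
    by exists a.
  have [_ [_ [_ [[a _] _]]]] := sys.
  by exists a => ex; exfalso.
pose ini i := [set j : I | j = i \/ lt j i].
have ini_sub i j : lt j i -> ini j `<=` ini i.
  by move=> ji k [->|kj]; right => //; exact: lt_trans ji.
(* Taking suprema over all pairs up to [i] makes [a] monotone without recursion. *)
have /choice[a ha] (i : I) : exists s, is_lub le (h @` (ini i `*` ini i)) s.
  apply: lub_ex; first by exists (h (i, i)), (i, i) => //; split; left.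
  apply: (sub_countable (card_image_le _ _)).
  by apply: countableX; exact: countable_initial.
have a_mono i j : lt j i -> le (a j) (a i).
  move=> ji; apply: (ha j).2 => _ [[k l] [/= kj lj] <-]; apply: (ha i).1.
  by exists (k, l) => //; split; exact: ini_sub ji _ _.
have a_dir i j : exists k, le (a i) (a k) /\ le (a j) (a k).
  have [->|[/a_mono ij|/a_mono ji]] := lt_tot i j.
  - by exists j.
  - by exists j.
  - by exists i.
have a_sep x y : (forall i, q (a i) x = q (a i) y) -> x = y.
  move=> qxy; apply: contrapT => xy.
  have [b qb] : exists b, q b x <> q b y.
    by apply: contrapT => nb; apply: xy; apply: limit_proj_separate => b;
       apply: contrapT => qb; apply: nb; exists b.
  have [P [Q [oP oQ Px Qy PQ]]] := hausdorff_sep (Xs_top b).2.1 qb.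
  have /continuousP cqb := @limit_proj_continuous b.
  have [U [BU [Ux UP]]] := bB (q b @^-1` P) x (cqb _ oP) Px.
  have [V [BV [Vy VQ]]] := bB (q b @^-1` Q) y (cqb _ oQ) Qy.
  pose iU : I := exist _ U BU; pose iV : I := exist _ V BV.
  have hUV : forall u v, U u -> V v -> q (h (iU, iV)) u <> q (h (iU, iV)) v.
    apply: (hh (iU, iV)); exists b => u v Uu Vv quv.
    by apply: (PQ _ (UP _ Uu)); rewrite quv; exact: VQ.
  have [i [iUi iVi]] : exists i, ini i iU /\ ini i iV.
    have [UV|[UV|VU]] := lt_tot iU iV.
    - by exists iU; split; left.
    - by exists iV; split; [right|left].
    - by exists iU; split; [left|right].
  have hi : le (h (iU, iV)) (a i) by apply: (ha i).1; exists (iU, iV).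
  by apply: (hUV x y) => //; rewrite -!(limit_proj_compat _ hi) qxy.
have /choice[u hu] (i : I) := @dense_sequence R X cX (Xs (a i)) (q (a i))
  (Xs_top _).1 (Xs_top _).2.1 (Xs_top _).2.2 (@limit_proj_continuous _)
  (@limit_proj_open _).
pose okpq (pq : rat * rat) :=
  0 <= ratr pq.1 :> R /\ ratr pq.1 < ratr pq.2 :> R /\ ratr pq.2 <= 1 :> R.
(* The pairs of a function [u i m] and a rational interval are enumerated by their codes; a code of
   no valid pair yields [u i 0] on the whole time interval. *)
have /choice[s hs] (i : I) : exists s : nat -> SHM_index R X,
    (forall n, exists m, (sval (s n)).1.1 = u i m) /\
    forall m pq, okpq pq -> exists n, sval (s n) = (u i m, ratr pq.1, ratr pq.2).
  have cu m : continuous (u i m) by case: (hu i).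
  have /choice[s hs] (n : nat) : exists s : SHM_index R X,
      (exists m, (sval s).1.1 = u i m) /\
      forall m pq, okpq pq -> unpickle n = Some (m, pq) -> sval s = (u i m, ratr pq.1, ratr pq.2).
    case E : (unpickle n) => [[m pq]|]; last first.
      have h01 : continuous (u i 0%N) /\ 0 <= (0 : R) /\ (0 : R) < 1 /\ (1 : R) <= 1.
        by split=> //; split=> //; split.
      exists (exist _ (u i 0%N, 0, 1) h01); split; first by exists 0%N.
      by [].
    have [opq|npq] := pselect (okpq pq).
      exists (exist _ (u i m, ratr pq.1, ratr pq.2) (conj (cu m) opq)).
      split; first by exists m.
      by move=> m' pq' _ [<- <-].
    have h01 : continuous (u i 0%N) /\ 0 <= (0 : R) /\ (0 : R) < 1 /\ (1 : R) <= 1.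
      by split=> //; split=> //; split.
    exists (exist _ (u i 0%N, 0, 1) h01); split; first by exists 0%N.
    by move=> m' pq' opq [_ e]; exfalso; apply: npq; rewrite e.
  exists s; split=> [n|m pq opq]; first by case: (hs n).
  exists (pickle (m, pq)); have [_ hsn] := hs (pickle (m, pq)).
  by apply: hsn => //; rewrite pickleK.
have s_agree i z w : Z z -> Z w -> (forall n, z (s i n) = w (s i n)) ->
    fagree (fun x y => q (a i) x = q (a i) y) z w.
  move=> Zz Zw zw; have [cu _ _ hui] := hu i; apply: hui => // m.
  apply: agree_rat => // k l k0 kl l1; have [_ /(_ m (k, l))[//|n sn]] := hs i.
  have := zw n; rewrite (young_coord z) (young_coord w) sn /=.
  apply: mulfI; rewrite invr_eq0 subr_eq0 gt_eqF//.
(* If [i] has predecessors, continuity of the system identifies [E i] with the kernel of the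
   projection to the supremum of the countably many [a j], which is open. Otherwise [E i] is the
   total relation. *)
pose E i x y := forall j, lt j i -> q (a j) x = q (a j) y.
apply: (@stages_absolute_retract R X cX x0 I lt E s) => //.
- by move=> i n x; have [/(_ n)[m ->] _] := hs i; case: (hu i) => _ + _ _; exact.
- move=> i; have [[j0 j0i]|nj] := pselect (exists j, lt j i); last first.
    rewrite (_ : E i = fun _ _ => True); first exact: open_rel_total.
    apply/funext => x; apply/funext => y; apply/propext; split=> // _ j ji.
    by exfalso; apply: nj; exists j.
  pose C := a @` [set j | lt j i].
  have [||b hb] := @lub_ex C.
  - by exists (a j0), j0.
  - apply: (sub_countable (card_image_le _ _)).
    apply: (sub_countable _ (countable_initial i)).
    by apply: subset_card_le => j ji; right.
  rewrite (_ : E i = fun x y => q b x = q b y); first exact: limit_open_rel.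
  apply/funext => x; apply/funext => y; apply/propext; split=> [exy|qxy j ji].
    have [|||t [_ tu]] := @limit_unique C b _ _ hb (fun c => q c x).
    + by exists (a j0), j0.
    + move=> _ _ [j ji <-] [k ki <-]; have [jk|[/a_mono jk|/a_mono kj]] := lt_tot j k.
      * by exists (a k); split; [exists k|rewrite jk].
      * by exists (a k); split; [exists k|].
      * by exists (a j); split; [exists j|].
    + by move=> c d _ _ cd; exact: limit_proj_compat.
    have -> : q b x = t by apply: tu => c Cc; exact: (limit_proj_compat x (hb.1 c Cc)).
    symmetry; apply: tu => c Cc.
    rewrite (limit_proj_compat y (hb.1 c Cc)).
    by case: Cc => j ji <-; rewrite exy.
  have ab : le (a j) b by apply: hb.1; exists j.
  by rewrite -(limit_proj_compat x ab) -(limit_proj_compat y ab) qxy.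
- move=> i z w Zz Zw zw phi cphi iphi.
  have [[j0 j0i]|nj] := pselect (exists j, lt j i); last first.
    rewrite (_ : phi = fun=> phi x0); first exact: agree_cst.
    by apply/funext => x; apply: iphi => j ji; exfalso; apply: nj; exists j.
  apply: (@agree_chain {j | lt j i} (fun j => a (sval j)) z w phi (exist _ j0 j0i)) => //.
  + move=> [j ji] [k ki]; have [jk|[/a_mono jk|/a_mono kj]] := lt_tot j k.
    * by exists (exist _ k ki); rewrite /= jk.
    * by exists (exist _ k ki).
    * by exists (exist _ j ji).
  + by move=> x y h'; apply: iphi => j ji; exact: (h' (exist _ j ji)).
  + by move=> [j ji]; apply: s_agree => // n; exact: zw.
- move=> z w Zz Zw zw; apply: agree_all => phi cphi.
  have [U [BU _]] := bB setT x0 openT Logic.I.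
  apply: (@agree_chain I a z w phi (exist _ U BU)) => //.
  + by move=> x y /a_sep ->.
  + by move=> j; apply: s_agree => // n; exact: zw.
- move=> i j ji n x y exy; have [/(_ n)[m ->] _] := hs j.
  by case: (hu j) => _ _ h' _; apply: h'; exact: exy.
- by move=> i j ji x y exy k kj; apply: exy; exact: lt_trans ji.
Qed.

End OmegaSystem.

Lemma openly_generated_absolute_retract (R : realType) (X : topologicalType) :
  compact [set: X] -> hausdorff_space X -> [set: X] !=set0 ->
  openly_generated X -> weight_le_omega1 X -> absolute_retract (@HX R X).
Proof.
move=> cX hX [x0 _] [A [le [Xs [p [sys [openp [f [g [cf [fL [gf [fg _]]]]]]]]]]]].
move=> [B [baseB [r [r1 [r2 [r3 [r4 r5]]]]]]].
exact: (@system_absolute_retract R X cX x0 A le Xs p sys openp f g cf fL gf fg B r).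
Qed.

(** * Concentration and countable dependence *)

Section Necessity.
Variables (R : realType) (X : topologicalType).
Hypotheses (cX : compact [set: X]) (hX : hausdorff_space X).
Local Notation H := (HXspace R X).
Local Notation Z := (@HX R X).

Definition const_HM (x : X) : H := HM_embed (exist _ (fun=> x) (is_HM_cst R x)).

Lemma const_HM_in x : Z (const_HM x). Proof. exact: HM_in. Qed.

Lemma young_const x (phi : X -> R) a b : continuous phi -> 0 <= a -> a <= b -> b <= 1 ->
  young (const_HM x) phi a b = phi x * (b - a).
Proof. by move=> *; exact: young_const_piece. Qed.

Lemma const_HM_coord x (s : SHM_index R X) : const_HM x s = (sval s).1.1 x.
Proof.
rewrite young_coord; case: s => -[[phi a] b] /= [cphi [a0 [ab b1]]].
by rewrite (young_const x cphi a0 (ltW ab) b1) mulrC mulfK// subr_eq0 gt_eqF.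
Qed.

(* The variance of [phi] under [z] vanishes. *)
Lemma young_mult (z : H) (phi psi : X -> R) (c a b : R) : Z z ->
  continuous phi -> continuous psi -> 0 <= a -> a <= b -> b <= 1 ->
  young z phi a b = c * (b - a) ->
  young z (fun x => phi x * phi x) a b = c * c * (b - a) ->
  young z (fun x => phi x * psi x) a b = c * young z psi a b.
Proof.
move=> Zz cphi cpsi a0 ab b1 h1 h2.
have [M [M0 bM]] := compact_bound cX cpsi.
have cpp : continuous (fun x => phi x * phi x) by exact: mul_cont.
have cps : continuous (fun x => phi x * psi x) by exact: mul_cont.
apply/eqP; rewrite -subr_eq0 -normr_le0; apply/ler_addgt0Pl => e e0; rewrite addr0.
pose eta := e / M.
have eta0 : 0 < eta by rewrite divr_gt0.
pose var x := (phi x * phi x + - (2 * c) * phi x) + 1 * (c * c).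
have cv1 : continuous (fun x => phi x * phi x + - (2 * c) * phi x).
  by apply: add_cont => //; exact: scale_cont.
have cvar : continuous var.
  by apply: add_cont => //; apply: scale_cont; exact: cst_cont.
have var0 : young z var a b = 0.
  rewrite /var (@young_lin R X cX z _ (fun=> c * c))//; last exact: cst_cont.
  by rewrite young_lin// h1 h2 young_cst//; ring.
have varE x : var x = (phi x - c) ^+ 2 by rewrite /var; ring.
(* For [v = |phi - c|] one has [v <= eta + v^2 / eta]; multiplied by [M] this is [e] plus a multiple
   of the variance, whose integral is zero. *)
pose bound x := e + (M / eta) * var x.
have cbound : continuous bound by apply: add_cont; [exact: cst_cont|exact: scale_cont].
have yb : young z bound a b <= e.
  rewrite /bound (@young_lin R X cX z (fun=> e))//; last exact: cst_cont.
  by rewrite var0 mulr0 addr0 young_cst// ler_piMr//; lra.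
pose d x := phi x * psi x + - c * psi x.
have cd : continuous d by apply: add_cont => //; exact: scale_cont.
have dle x : `|d x| <= bound x.
  have -> : d x = (phi x - c) * psi x by rewrite /d; ring.
  rewrite normrM /bound varE.
  set u := phi x - c; have u0 : 0 <= `|u| by [].
  have ku : `|u| * `|psi x| <= `|u| * M by rewrite ler_wpM2l.
  apply: (le_trans ku).
  have -> : e = M * eta by rewrite /eta mulrC divfK// gt_eqF.
  rewrite -(real_normK (num_real u)); move: `|u| u0 => v v0.
  have -> : M * eta + M / eta * v ^+ 2 = M * (eta + v ^+ 2 / eta).
    by field; rewrite gt_eqF.
  rewrite mulrC ler_pM2l// -(ler_pM2r eta0) mulrDl divfK ?gt_eqF//.
  have := sqr_ge0 (v - eta); nra.
have dE : young z (fun x => phi x * psi x) a b - c * young z psi a b = young z d a b.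
  by rewrite /d young_lin//; ring.
rewrite dE ler_norml; apply/andP; split; last first.
  apply: le_trans yb; apply: (young_le cX) => // x.
  exact: le_trans (ler_norm _) (dle x).
have : young z (fun x => 0 + -1 * d x) a b <= young z bound a b.
  apply: (young_le cX) => //.
    by apply: add_cont; [exact: cst_cont|exact: scale_cont].
  by move=> x; have := dle x; rewrite ler_norml => /andP[]; lra.
rewrite (@young_lin R X cX z (fun=> 0))//; last exact: cst_cont.
by rewrite young_cst//; lra.
Qed.

Definition Ker (Phi : set (X -> R)) (x y : X) := forall phi, Phi phi -> phi x = phi y.

(* Finite sums of squares [(phi - phi x)^2] have integral [0] under [z], and one of
   them is bounded away from [0] where [phi0] is at least [1/4]. *)
Lemma young_support (Phi : set (X -> R)) (z : H) (x : X) (phi0 : X -> R) :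
  (forall phi, Phi phi -> continuous phi) ->
  (forall phi, Phi phi -> Phi (fun x => phi x * phi x)) ->
  Z z -> (forall phi, Phi phi -> agree z (const_HM x) phi) ->
  continuous phi0 -> (forall y, phi0 y <= 1) -> (forall y, Ker Phi y x -> phi0 y <= 0) ->
  young z phi0 0 1 <= 1 / 4.
Proof.
move=> cPhi sqPhi Zz zx cphi0 phi01 phi0K.
have l01 : (0 : R) <= 1 by [].
pose J := {l : seq (X -> R) | forall phi, List.In phi l -> Phi phi}.
pose g (l : seq (X -> R)) y := foldr (fun phi m => (phi y - phi x) ^+ 2 + m) 0 l.
have g0 l y : 0 <= g l y.
  by elim: l => //= phi l IH; rewrite addr_ge0// sqr_ge0.
have g_cat l l' y : g (l ++ l') y = g l y + g l' y.
  by elim: l => [|phi l IH] /=; [rewrite add0r|rewrite IH addrA].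
have cg l : (forall phi, List.In phi l -> Phi phi) -> continuous (g l) /\ young z (g l) 0 1 = 0.
  elim: l => [|phi l IH] hl.
    by split; [exact: cst_cont|rewrite young_cst// mul0r].
  have [|cl zl] := IH; first by move=> psi psil; apply: hl; right.
  have Pphi : Phi phi by apply: hl; left.
  have cphi := cPhi _ Pphi.
  have c2 : continuous (fun y => phi y * phi y) by exact: mul_cont.
  pose v y := (phi y * phi y + - (2 * phi x) * phi y).
  have cv : continuous v by apply: add_cont => //; exact: scale_cont.
  pose v' y := (phi x * phi x) + 1 * v y.
  have cv' : continuous v' by apply: add_cont; [exact: cst_cont|exact: scale_cont].
  have gE : g (phi :: l) = fun y => v' y + 1 * g l y.
    by apply/funext => y; rewrite /g /= -/(g l y) /v' /v; ring.
  rewrite gE; split; first by apply: add_cont => //; exact: scale_cont.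
  rewrite young_lin// zl /v' (@young_lin R X cX z (fun=> phi x * phi x))//; last exact: cst_cont.
  rewrite young_lin// young_cst// (zx _ (sqPhi _ Pphi))// (zx _ Pphi)//.
  by rewrite !young_const//; ring.
pose F (l : J) := [set y | 1 / 4 <= phi0 y /\ g (sval l) y <= 0].
have clphi0 : closed [set y | 1 / 4 <= phi0 y].
  by apply: closed_le_real => //; exact: cst_cont.
have nil_ok : forall phi : X -> R, List.In phi [::] -> Phi phi by [].
have [l Fl] : exists l : J, F l = set0.
  apply: contrapT => nF.
  have [||l|y [_ Fy]] := @compact_directed_inter X setT J F (exist _ [::] nil_ok) cX.
  - move=> l; apply: closedI => //; apply: closed_le_real; last exact: cst_cont.
    by case: (cg _ (svalP l)).
  - move=> l l'.
    have h phi : List.In phi (sval l ++ sval l') -> Phi phi.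
      by move=> /(@List.in_app_or _ _ _ _)[/(svalP l)|/(svalP l')].
    exists (exist _ _ h) => y [h1]; rewrite /= g_cat => h2.
    by have := g0 (sval l) y; have := g0 (sval l') y; split; split=> //; lra.
  - by apply: contrapT => /nonemptyPn Fl; apply: nF; exists l; rewrite -Fl setTI.
  have Ky : Ker Phi y x.
    move=> phi Pphi.
    have h1 psi : List.In psi [:: phi] -> Phi psi by move=> [<-|[]].
    have [_] := Fy (exist _ _ h1); rewrite /= addr0 => h2.
    by apply/eqP; rewrite -subr_eq0 -sqrf_eq0; apply/eqP/le_anti; rewrite h2 sqr_ge0.
  by have := phi0K y Ky; have [h _] := Fy (exist _ [::] nil_ok); lra.
have [cgl zgl] := cg _ (svalP l).
have [del [del0 hdel]] : exists del, 0 < del /\ forall y, 1 / 4 <= phi0 y -> del <= g (sval l) y.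
  have [[y0 hy0]|ny] := pselect ([set y | 1 / 4 <= phi0 y] !=set0); last first.
    by exists 1; split=> // y hy; exfalso; apply: ny; exists y.
  have cK : compact [set y | 1 / 4 <= phi0 y] by apply: (subclosed_compact _ cX).
  have [|y [hy ymin]] := compact_min _ cK cgl; first by exists y0.
  exists (g (sval l) y); split=> //.
  rewrite ltNge; apply/negP => h.
  have Fly : F l y by [].
  by rewrite Fl in Fly.
pose bound y := 1 / 4 + del^-1 * g (sval l) y.
have cb : continuous bound by apply: add_cont; [exact: cst_cont|exact: scale_cont].
have : young z phi0 0 1 <= young z bound 0 1.
  apply: (young_le cX) => // y; rewrite /bound.
  have [h|h] := leP (1 / 4) (phi0 y); last first.
    have : 0 <= del^-1 * g (sval l) y by apply: mulr_ge0 => //; rewrite invr_ge0 ltW.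
    by move: h; lra.
  have : 1 <= del^-1 * g (sval l) y by rewrite mulrC ler_pdivlMr// mul1r hdel.
  by have := phi01 y; lra.
rewrite /bound (@young_lin R X cX z (fun=> 1 / 4))//; last exact: cst_cont.
by rewrite zgl young_cst//; lra.
Qed.

(** * A compact cube containing [HX] and the countable dependence of its continuous functions *)

Local Notation K := (one_point_compactification R^o).
Local Notation Y := (prod_topology (fun _ : SHM_index R X => K)).

Lemma opc_hausdorff : hausdorff_space K.
Proof.
apply: one_point_compactification_hausdorff; first exact: locally_compactR.
exact: norm_hausdorff.
Qed.

Lemma opc_cube_compact : compact [set: Y].
Proof.
have := @tychonoff {classic (SHM_index R X)} (fun=> K) (fun=> setT)
  (fun s => @one_point_compactification_compact R^o).
by congr compact; apply/seteqP; split.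
Qed.

Lemma opc_cube_hausdorff : hausdorff_space Y.
Proof. by apply: (@hausdorff_product {classic _}) => s; exact: opc_hausdorff. Qed.

(** With the one-point compactification of the line as factor, a single compact space serves all
    coordinates and no bounds have to be chosen. *)
Definition emb (z : H) : Y := fun s => Some (z s).

Lemma emb_coord_continuous (T : topologicalType) (f : T -> R) :
  continuous f -> continuous (fun t => Some (f t) : K).
Proof.
by move=> cf; exact: (comp_cont cf (@one_point_compactification_some_continuous R^o)).
Qed.

Lemma emb_continuous : continuous emb.
Proof.
apply: ptws_cvg_continuous => s.
by apply: emb_coord_continuous; exact: ptws_proj_continuous.
Qed.

Lemma emb_inj (z w : H) : emb z = emb w -> z = w.
Proof.
move=> zw; apply: functional_extensionality_dep => s.
by have := congr1 (fun y => y s) zw => -[].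
Qed.

(** By compactness of the square of the cube, finitely many coordinates determine [h] up to any
    given error. The finite sets for the errors [1 / (n + 1)] are united. *)
Lemma continuous_countable_support (h : Y -> R) : continuous h ->
  exists D : set (SHM_index R X), countable D /\
    forall y y' : Y, (forall s, D s -> y s = y' s) -> h y = h y'.
Proof.
move=> ch.
have cYY : compact [set: Y * Y] by rewrite -setXTT; apply: compact_setX; exact: opc_cube_compact.
have cfst : continuous (fst : Y * Y -> Y) by move=> x; exact: cvg_fst.
have csnd : continuous (snd : Y * Y -> Y) by move=> x; exact: cvg_snd.
have cproj s : continuous (fun y : Y => y s) by exact: ptws_proj_continuous.
have step (e : R) : 0 < e -> exists l : seq (SHM_index R X), forall y y' : Y,
    (forall s, List.In s l -> y s = y' s) -> h y - h y' < e.
  move=> e0; apply: contrapT => nl.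
  pose F l := [set yy : Y * Y | (forall s, List.In s l -> yy.1 s = yy.2 s) /\
    e <= h yy.1 - h yy.2].
  have [||l|[y y'] [_ Fy]] := @compact_directed_inter _ setT (seq (SHM_index R X)) F [::] cYY.
  - move=> l; have -> : F l = (\bigcap_(s in [set s | List.In s l])
         [set yy : Y * Y | yy.1 s = yy.2 s]) `&` [set yy | e <= h yy.1 - h yy.2].
      by apply/seteqP; split=> yy [].
    apply: closedI.
      apply: closed_bigI => s _; apply: closed_fun_eq; first exact: opc_hausdorff.
        exact: (comp_cont cfst (@cproj s)).
      exact: (comp_cont csnd (@cproj s)).
    apply: closed_le_real; first exact: cst_cont.
    by apply: sub_cont; [exact: (comp_cont cfst ch)|exact: (comp_cont csnd ch)].
  - move=> l l'; exists (l ++ l') => -[y y'] /= [h1 h2].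
    by split; split=> // s sl; apply: h1; apply: List.in_or_app; [left|right].
  - apply: contrapT => /nonemptyPn Fl; apply: nl; exists l => y y' yy'.
    rewrite ltNge; apply/negP => he.
    have : ([set: Y * Y] `&` F l) (y, y') by [].
    by rewrite Fl.
  have yy' : y = y'.
    apply: functional_extensionality_dep => s.
    by have [/(_ s (or_introl erefl))] := Fy [:: s].
  by have [_ /=] := Fy [::]; rewrite yy' subrr leNgt e0.
have /choice[l hl] (n : nat) : exists l : seq (SHM_index R X), forall y y' : Y,
    (forall s, List.In s l -> y s = y' s) -> h y - h y' < n.+1%:R^-1.
  by apply: step; rewrite invr_gt0.
exists (\bigcup_n [set s | List.In s (l n)]); split.
  apply: bigcup_countable => // n _; elim: (l n) => [|s k IH].
    by rewrite (_ : [set _ | _] = set0)//; exact: countable0.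
  rewrite (_ : [set _ | _] = [set s] `|` [set s' | List.In s' k]).
    by apply: countable_setU => //; exact: countable1.
  by apply/seteqP; split=> s' /= [->|?]; [left|right|left|right].
move=> y y' yy'.
have key (u v : Y) : (forall s, (\bigcup_n [set s | List.In s (l n)]) s -> u s = v s) ->
    h u <= h v.
  move=> uv; rewrite -subr_le0; apply/ler_addgt0Pl => e e0; rewrite addr0.
  have [n hn] : exists n, n.+1%:R^-1 < e.
    by have [n] := @ltr_add_invr R 0 e e0; rewrite add0r => hn; exists n.
  by apply/ltW; apply: lt_trans hn; apply: hl => s sl; apply: uv; exists n.
by apply/le_anti/andP; split; apply: key => // s sD; rewrite yy'.
Qed.

End Necessity.

(** * Families closed under the dependence of a retraction *)

Section Retraction.
Variables (R : realType) (X : topologicalType).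
Hypotheses (cX : compact [set: X]) (hX : hausdorff_space X).
Local Notation H := (HXspace R X).
Local Notation Z := (@HX R X).
Local Notation K := (one_point_compactification R^o).
Local Notation Y := (prod_topology (fun _ : SHM_index R X => K)).
Variable (r : Y -> H).
Hypotheses (cr : continuous r) (rZ : forall y, Z (r y)) (re : forall z, Z z -> r (emb z) = z).

(* Rational intervals suffice since the coordinates of points of [Z] are Lipschitz
   in the end points. *)
Lemma support_family_ex : exists T : (X -> R) -> set (X -> R), forall phi, continuous phi ->
  [/\ countable (T phi), forall psi, T phi psi -> continuous psi,
     T phi (fun x => phi x * phi x)
   & forall y y' : Y, (forall s : SHM_index R X, T phi (sval s).1.1 -> y s = y' s) ->
       agree (r y) (r y') phi].
Proof.
have cproj s : continuous (fun y => r y s : R).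
  exact: (comp_cont cr (@ptws_proj_continuous (SHM_index R X) (fun=> R^o) s)).
have /choice[D hD] (s : SHM_index R X) :=
  @continuous_countable_support R X (fun y => r y s) (cproj s).
(* Squares are included for the arguments by vanishing variance. The union over [s] has at most one
   member, and none when the rationals do not form an admissible interval. *)
pose T (phi : X -> R) := [set (fun x => phi x * phi x)] `|`
  \bigcup_(pq in [set: rat * rat]) \bigcup_(s in [set s : SHM_index R X |
     sval s = (phi, ratr pq.1, ratr pq.2)]) [set (sval s').1.1 | s' in D s].
exists T => phi cphi; split.
- apply: countable_setU; first exact: countable1.
  apply: bigcup_countable => // pq _; apply: bigcup_countable => [|s _].
    have [[s0 hs0]|ns] := pselect (exists s0 : SHM_index R X,
        sval s0 = (phi, ratr pq.1, ratr pq.2)); last first.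
      rewrite (_ : [set _ | _] = set0); first exact: countable0.
      by apply/seteqP; split=> s // hs; apply: ns; exists s.
    apply: (sub_countable (subset_card_le (B := [set s0]) _)); last exact: countable1.
    by move=> s /= hs; apply: eq_sig_hprop; [move=> *; exact: Prop_irrelevance|rewrite hs hs0].
  by apply: (sub_countable (card_image_le _ _)); case: (hD s).
- move=> psi [->|[pq _ [s _ [s' _ <-]]]]; first exact: mul_cont.
  by case: (svalP s').
- by left.
move=> y y' yy'; apply: agree_rat => // p q p0 pq q1.
pose s : SHM_index R X := exist _ (phi, ratr p, ratr q) (conj cphi (conj p0 (conj pq q1))).
have [_ Ds] := hD s.
have : r y s = r y' s.
  apply: Ds => s' Ds'; apply: yy'; right; exists (p, q) => //; exists s => //.
  by exists s'.
rewrite (young_coord (r y)) (young_coord (r y')) /=.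
by apply: mulfI; rewrite invr_eq0 subr_eq0 gt_eqF.
Qed.

Variable T : (X -> R) -> set (X -> R).
Hypothesis hT : forall phi, continuous phi ->
  [/\ countable (T phi), forall psi, T phi psi -> continuous psi,
     T phi (fun x => phi x * phi x)
   & forall y y' : Y, (forall s : SHM_index R X, T phi (sval s).1.1 -> y s = y' s) ->
       agree (r y) (r y') phi].

Definition support_closed (Phi : set (X -> R)) :=
  forall phi, Phi phi -> continuous phi /\ T phi `<=` Phi.

Lemma support_closed_agree Phi (y y' : Y) : support_closed Phi ->
  (forall s : SHM_index R X, Phi (sval s).1.1 -> y s = y' s) ->
  forall phi, Phi phi -> agree (r y) (r y') phi.
Proof.
move=> hPhi yy' phi Pphi; have [cphi sub] := hPhi phi Pphi.
by have [_ _ _] := hT cphi; apply=> s Ts; apply: yy'; exact: sub.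
Qed.

Lemma support_closedI A B : support_closed A -> support_closed B -> support_closed (A `&` B).
Proof.
move=> hA hB phi [/hA[cphi sA] /hB[_ sB]]; split=> // psi Tpsi.
by split; [exact: sA|exact: sB].
Qed.

Lemma support_closed_bigcup (I : Type) (D : set I) (F : I -> set (X -> R)) :
  (forall i, D i -> support_closed (F i)) -> support_closed (\bigcup_(i in D) F i).
Proof.
move=> hF phi [i Di /(hF i Di)[cphi sF]]; split=> // psi /sF Fpsi.
by exists i.
Qed.

Lemma support_closure (Phi : set (X -> R)) : countable Phi ->
  (forall phi, Phi phi -> continuous phi) ->
  exists Psi, [/\ countable Psi, support_closed Psi & Phi `<=` Psi].
Proof.
move=> kPhi cPhi.
pose S := fix S n := if n is m.+1 then \bigcup_(phi in S m) T phi else Phi.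
have hS n : countable (S n) /\ forall phi, S n phi -> continuous phi.
  elim: n => [//|n [k c]]; split.
    by apply: bigcup_countable => // phi /c /hT[].
  by move=> psi [phi /c /hT[_ h _ _]]; exact: h.
exists (\bigcup_n S n); split.
- by apply: bigcup_countable => // n _; case: (hS n).
- move=> phi [n _ Sphi]; split; first by case: (hS n) => _; exact.
  by move=> psi Tpsi; exists n.+1 => //; exists phi.
- by move=> phi Pphi; exists 0%N.
Qed.

Lemma support_closed_sqr Phi phi : support_closed Phi -> Phi phi ->
  Phi (fun x => phi x * phi x).
Proof. by move=> hPhi /hPhi[/hT[_ _ h _] sub]; exact: sub. Qed.

Definition saturation (Phi : set (X -> R)) (U : set X) : set X :=
  [set y | exists2 x, U x & Ker Phi x y].

(* Perturbing the Dirac function at [x] on the coordinates in [Phi] only and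
   retracting back to [Z] lifts small changes of the fibre. *)
Lemma saturation_open Phi U : support_closed Phi -> open U -> open (saturation Phi U).
Proof.
move=> hPhi oU; rewrite openE => y [x Ux xy].
have [|||phi0 [cphi0 phi01 phi0U phi0x]] := @urysohn_fun R X (~` U) [set x] cX hX.
- exact: open_closedC.
- exact: accessible_closed_set1 (hausdorff_accessible hX) x.
- by apply/seteqP; split=> // z [] /= nUz zx; apply: nUz; rewrite zx.
pose m x' : Y := fun s => if pselect (Phi (sval s).1.1) is left _
  then emb (const_HM x') s else emb (const_HM x) s.
have cm : continuous m.
  apply: ptws_cvg_continuous => s; rewrite /m; case: pselect => _; last exact: cst_continuous.
  apply: emb_coord_continuous.
  under eq_fun do rewrite (const_HM_coord cX).
  by case: (svalP s).
have my : m y = emb (const_HM x).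
  apply: functional_extensionality_dep => s; rewrite /m; case: pselect => // Ps.
  by rewrite /emb !(const_HM_coord cX) (xy _ Ps).
pose h x' := young (r (m x')) phi0 0 1.
have ch : continuous h.
  by apply: (comp_cont _ (@young_continuous R X phi0 0 1)); exact: (comp_cont cm cr).
have hy : h y = 1.
  rewrite /h my re; last exact: const_HM_in.
  by rewrite young_const// phi0x// subr0 mulr1.
have : nbhs y [set x' | 1 / 2 < h x'].
  apply: open_nbhs_nbhs; split; last by rewrite /= hy; lra.
  by apply: open_lt_real => //; exact: cst_cont.
apply: filterS => x' /= hx'; apply: contrapT => nsat.
(* On [Phi] the point [r (m x')] agrees with the Dirac function at [x'], so it is concentrated on
   the class of [x'], where [phi0] vanishes if that class misses [U]. *)
have : h x' <= 1 / 4; last lra.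
apply: (@young_support R X cX Phi (r (m x')) x') => //.
- by move=> phi /hPhi[].
- by move=> phi; exact: support_closed_sqr.
- move=> phi Pphi; rewrite -[const_HM x']re; last exact: const_HM_in.
  apply: (support_closed_agree hPhi) => // s Ps; rewrite /m.
  by case: pselect.
- by move=> z; case/andP: (phi01 z).
- move=> z zx'; rewrite phi0U// => Uz; apply: nsat; exists z => //.
Qed.

(* With [z0] the average of the Dirac functions at [x] and [y] and [gamma] a
   function oscillating between [x] and [y], prescribe [gamma] on [A] and [z0]
   elsewhere.  The retraction yields a point close to [z0] at which functions in
   [A] and in [B] are uncorrelated, whereas they are fully correlated at [z0]. *)
Lemma Ker_setI A B x y : support_closed A -> support_closed B -> Ker (A `&` B) x y ->
  Ker A x y \/ Ker B x y.
Proof.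
move=> hA hB xyAB; apply: contrapT => /not_orP[nA nB].
have [phi [Aphi phixy]] : exists phi, A phi /\ phi x <> phi y.
  apply: contrapT => nex; apply: nA => phi Aphi; apply: contrapT => ne.
  by apply: nex; exists phi.
have [psi [Bpsi psixy]] : exists psi, B psi /\ psi x <> psi y.
  apply: contrapT => nex; apply: nB => psi Bpsi; apply: contrapT => ne.
  by apply: nex; exists psi.
have [cphi _] := hA _ Aphi; have [cpsi _] := hB _ Bpsi.
pose ax : HM R X := exist _ (fun=> x) (is_HM_cst R x).
pose ay : HM R X := exist _ (fun=> y) (is_HM_cst R y).
pose z0 : H := midpt (const_HM x) (const_HM y).
have Zz0 : Z z0 by apply: (midpoint_HX cX); exact: const_HM_in.
have z0E (th : X -> R) a b : continuous th -> 0 <= a -> a <= b -> b <= 1 ->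
    young z0 th a b = (th x + th y) / 2 * (b - a).
  by move=> *; rewrite young_midpt !young_const//; field.
have l01 : (0 : R) <= 1 by [].
pose pp t := phi t * psi t.
have cpp : continuous pp by exact: mul_cont.
(* The covariance of [phi] and [psi] for the uniform distribution on [x] and [y]. *)
pose del := (phi x - phi y) * (psi x - psi y) / 4.
have del0 : 0 < `|del|.
  by rewrite normr_gt0 !mulf_neq0 ?subr_eq0//; apply/eqP.
have : nbhs (emb z0) [set y' | `|young (r y') pp 0 1 - young z0 pp 0 1| < `|del|].
  apply: open_nbhs_nbhs; split; last by rewrite /= re// subrr normr0.
  apply: open_lt_real; last exact: cst_cont.
  apply: (@comp_cont Y R R _ (fun t => `|t|)); last exact: norm_continuous.
  apply: sub_cont; last exact: cst_cont.
  exact: (comp_cont cr (@young_continuous R X pp 0 1)).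
move=> /ptws_nbhs_finite[l hl].
have [n [t [g [pt sP ga gb gc]]]] :=
  alternate_HM ax ay (flatten [seq [:: (sval i).1.2; (sval i).2] | i <- l]).
pose y' : Y := fun s => if pselect (A (sval s).1.1) is left _
  then emb (HM_embed g) s else emb z0 s.
pose k := r y'.
have Zk : Z k by exact: rZ.
have knear : `|young k pp 0 1 - young z0 pp 0 1| < `|del|.
  apply: hl => s sl; rewrite /y'; case: pselect => // _.
  have sl' : List.In s l.
    by elim: l sl {sP} => //= j l IH; rewrite inE => /orP[/eqP ->|/IH]; [left|right].
  have [p [q [pn qn tp tq]]] := index_endpoints sP sl'.
  by rewrite /emb (alternate_coord cX pt ga gb gc pn qn tp tq).
have kA th : A th -> agree k (HM_embed g) th.
  move=> Ath; rewrite -(re (@HM_in R X g)).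
  apply: (support_closed_agree hA) => // s As; rewrite /y'.
  by case: pselect.
(* Where [y'] carries the oscillating function on a coordinate in [B], that coordinate lies in [A]
   as well. Its function takes equal values at [x] and [y], so the oscillation is invisible
   there. *)
have kB th : B th -> agree k z0 th.
  move=> Bth; rewrite -{1}(re Zz0).
  apply: (support_closed_agree hB) => // s Bs; rewrite /y'.
  case: pselect => // As; congr Some.
  have exy : (sval s).1.1 x = (sval s).1.1 y by apply: xyAB.
  rewrite /z0 /midpt !(const_HM_coord cX) -exy young_coord.
  case: s As Bs exy => -[[th' a] b] /= [cth [a0 [ab b1]]] _ _ exy.
  rewrite (@young_ext R X cX g ax th' th')//; last 2 first.
  - exact: ltW.
  - move=> u au ub; have [i [ilt tu ut]] :=
      partition_piece pt (le_trans a0 au) (lt_le_trans ub b1).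
    have [um|um] := ltP u ((t i + t i.+1) / 2); first by rewrite (ga i).
    by rewrite (gb i).
  rewrite (_ : HM_embed ax = const_HM x)// young_const//; last exact: ltW.
  by rewrite mulrC mulfK; [field|rewrite subr_eq0 gt_eqF].
have sqA : A (fun t => phi t * phi t) by exact: support_closed_sqr.
have csq : continuous (fun t => phi t * phi t) by exact: mul_cont.
pose m := (psi x + psi y) / 2.
(* On a piece where [g] is constant, [phi] and its square have under [k] the integrals of a
   constant. The variance of [phi] thus vanishes, and [phi] can be taken out of the product. *)
have piece u v w : 0 <= u -> u <= v -> v <= 1 ->
    (forall tt, u <= tt -> tt < v -> sval g tt = w) ->
    young k pp u v = phi w * m * (v - u).
  move=> u0 uv v1 gw.
  rewrite (@young_mult R X cX k phi psi (phi w))//.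
  - by rewrite (kB _ Bpsi)// z0E// mulrA.
  - by rewrite (kA _ Aphi)// (young_const_piece cX cphi _ _ _ gw).
  - by rewrite (kA _ sqA)// (young_const_piece cX csq _ _ _ gw).
have ktot : young k pp 0 1 = (phi x + phi y) / 2 * m.
  have [t0 t1 tlt] := pt.
  rewrite -[in LHS]t0 -[X in young _ _ _ X]t1.
  rewrite (young_pieces cX Zk cpp pt (leq0n _) (leqnn _)).
  transitivity (\sum_(0 <= i < n) (phi x + phi y) / 2 * m * (t i.+1 - t i)).
    apply: eq_big_nat => i /andP[_ ilt].
    have ti := tlt i ilt.
    have /andP[i0 _] := partition_01 pt (ltnW ilt).
    have /andP[_ i1] := partition_01 pt ilt.
    rewrite (@young_add R X cX k pp (t i) ((t i + t i.+1) / 2) (t i.+1))//; try lra.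
    have -> := piece (t i) ((t i + t i.+1) / 2) x i0 ltac:(lra) ltac:(lra) (ga i ilt).
    have -> := piece ((t i + t i.+1) / 2) (t i.+1) y ltac:(lra) ltac:(lra) i1 (gb i ilt).
    by field.
  by rewrite -mulr_sumr telescope_sumr// t0 t1 subr0 mulr1.
move: knear; rewrite ktot z0E// subr0 mulr1.
have -> : (phi x + phi y) / 2 * m - (pp x + pp y) / 2 = - del.
  by rewrite /m /pp /del; field.
by rewrite normrN ltxx.
Qed.

End Retraction.

(** * Quotients by families of functions *)

Lemma countable_lists (T : Type) (D : set T) : countable D ->
  countable [set l : seq T | forall t, List.In t l -> D t].
Proof.
move=> /countable_injP[k kinj]; apply/countable_injP; exists (fun l => pickle (map k l)).
move=> l l'; rewrite !inE /= => hl hl' /(pcan_inj pickleK).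
elim: l l' hl hl' => [|t l IH] [|t' l'] //= hl hl' [kt kl].
congr cons; last by apply: IH kl => u ul; [apply: hl|apply: hl']; right.
by apply: kinj => //; rewrite inE; [apply: hl|apply: hl']; left.
Qed.

Section Strips.
Variables (R : realType) (X : topologicalType).
Hypotheses (cX : compact [set: X]).

Definition strip (l : seq ((X -> R) * rat * rat)) : set X :=
  [set x | forall t, List.In t l -> ratr t.1.2 < t.1.1 x /\ t.1.1 x < ratr t.2].

Definition strips (Phi : set (X -> R)) : set (set X) :=
  strip @` [set l | forall t, List.In t l -> Phi t.1.1].

Lemma strips_countable Phi : countable Phi -> countable (strips Phi).
Proof.
move=> kPhi; apply: (sub_countable (card_image_le _ _)).
have kD : countable [set t : (X -> R) * rat * rat | Phi t.1.1].
  rewrite (_ : [set t | _] = Phi `*` [set: rat] `*` [set: rat]).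
    by apply: countableX => //; exact: countableX.
  by apply/seteqP; split=> t // [[]].
exact: countable_lists kD.
Qed.

Lemma strips_mono Phi Psi : Phi `<=` Psi -> strips Phi `<=` strips Psi.
Proof. by move=> PP _ [l hl <-]; exists l => // t /hl /PP. Qed.

Lemma strips_open Phi V : (forall phi, Phi phi -> continuous phi) -> strips Phi V -> open V.
Proof.
move=> cPhi [l hl <-]; elim: l hl => [|t l IH] hl.
  by rewrite (_ : strip [::] = setT); [exact: openT|apply/seteqP; split].
rewrite (_ : strip (t :: l) = ([set x | ratr t.1.2 < t.1.1 x] `&`
  [set x | t.1.1 x < ratr t.2]) `&` strip l).
  have ct := cPhi _ (hl t (or_introl erefl)).
  apply: openI; last by apply: IH => u ul; apply: hl; right.
  by apply: openI; apply: open_lt_real => //; exact: cst_cont.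
apply/seteqP; split=> x h; last first.
  by case: h => h1 h2 u [<-|/h2].
split; first by have [] := h t (or_introl erefl).
by move=> u ul; apply: h; right.
Qed.

Lemma Ker_sym (Phi : set (X -> R)) x y : Ker Phi x y -> Ker Phi y x.
Proof. by move=> h phi /h. Qed.

Lemma Ker_trans (Phi : set (X -> R)) y x z : Ker Phi x y -> Ker Phi y z -> Ker Phi x z.
Proof. by move=> h h' phi Pp; rewrite (h _ Pp) h'. Qed.

Lemma Ker_sub (Phi Psi : set (X -> R)) x y : Phi `<=` Psi -> Ker Psi x y -> Ker Phi x y.
Proof. by move=> PP h phi /PP /h. Qed.

Lemma strips_Ker Phi V x y : strips Phi V -> Ker Phi x y -> V x -> V y.
Proof. by move=> [l hl <-] xy Vx t tl; rewrite -(xy _ (hl t tl)); exact: Vx. Qed.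

(** The closed strips around [x] intersect in its class, which lies in the saturated set [U]; by
    compactness one of them already does. *)
Lemma strips_base Phi U x : (forall phi, Phi phi -> continuous phi) -> open U ->
  (forall x y, Ker Phi x y -> U x -> U y) -> U x ->
  exists V, [/\ strips Phi V, V x & V `<=` U].
Proof.
move=> cPhi oU satU Ux.
pose J := {l : seq ((X -> R) * rat * rat) | forall t, List.In t l ->
  Phi t.1.1 /\ (ratr t.1.2 < t.1.1 x /\ t.1.1 x < ratr t.2)}.
pose F (l : J) := [set y | (forall t, List.In t (sval l) ->
  ratr t.1.2 <= t.1.1 y /\ t.1.1 y <= ratr t.2) /\ ~ U y].
have nil_ok : forall t : (X -> R) * rat * rat, List.In t [::] ->
  Phi t.1.1 /\ (ratr t.1.2 < t.1.1 x /\ t.1.1 x < ratr t.2) by [].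
have [l Fl] : exists l : J, F l = set0.
  apply: contrapT => nF.
  have [||l|y [_ Fy]] := @compact_directed_inter X setT J F (exist _ [::] nil_ok) cX.
  - move=> l; have -> : F l = (\bigcap_(t in [set t | List.In t (sval l)])
        ([set y | ratr t.1.2 <= t.1.1 y] `&` [set y | t.1.1 y <= ratr t.2])) `&` ~` U.
      by apply/seteqP; split=> y [].
    apply: closedI; last exact: open_closedC.
    apply: closed_bigI => t tl; have ct := cPhi _ (svalP l t tl).1.
    by apply: closedI; apply: closed_le_real => //; exact: cst_cont.
  - move=> l l'.
    have hll t : List.In t (sval l ++ sval l') ->
        Phi t.1.1 /\ (ratr t.1.2 < t.1.1 x /\ t.1.1 x < ratr t.2).
      by move=> /(@List.in_app_or _ _ _ _)[/(svalP l)|/(svalP l')].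
    exists (exist _ _ hll) => y [h1 h2].
    by split; split=> // t tl; apply: h1; apply: List.in_or_app; [left|right].
  - by apply: contrapT => /nonemptyPn Fl; apply: nF; exists l; rewrite -Fl setTI.
  have [_] := Fy (exist _ [::] nil_ok); apply; apply: (satU x) => // phi Pphi.
  have le (u v : X) (k : R) : k < phi x -> k <= phi y.
    move=> kx; have [c] := @rat_in_itvoo R k (phi x) kx; rewrite in_itv /= => /andP[c1 c2].
    have [d] := @rat_in_itvoo R (phi x) (phi x + 1) ltac:(lra).
    rewrite in_itv /= => /andP[d1 d2].
    have h t : List.In t [:: (phi, c, d)] ->
        Phi t.1.1 /\ (ratr t.1.2 < t.1.1 x /\ t.1.1 x < ratr t.2) by move=> [<-|[]].
    have [/(_ (phi, c, d) (or_introl erefl))[/= h1 _] _] := Fy (exist _ _ h).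
    exact: le_trans (ltW c1) h1.
  have ge (k : R) : phi x < k -> phi y <= k.
    move=> kx; have [c] := @rat_in_itvoo R (phi x) k kx; rewrite in_itv /= => /andP[c1 c2].
    have [d] := @rat_in_itvoo R (phi x - 1) (phi x) ltac:(lra).
    rewrite in_itv /= => /andP[d1 d2].
    have h t : List.In t [:: (phi, d, c)] ->
        Phi t.1.1 /\ (ratr t.1.2 < t.1.1 x /\ t.1.1 x < ratr t.2) by move=> [<-|[]].
    have [/(_ (phi, d, c) (or_introl erefl))[/= _ h1] _] := Fy (exist _ _ h).
    exact: le_trans h1 (ltW c2).
  apply/le_anti/andP; split; apply/ler_addgt0Pr => e e0.
    by rewrite -lerBlDr; apply: (le x x); lra.
  by apply: ge; lra.
exists (strip (sval l)); split.
- by exists (sval l) => // t /(svalP l)[].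
- by move=> t /(svalP l)[].
move=> y hy; apply: contrapT => nUy.
have : F l y by split=> // t /hy[/ltW ? /ltW ?].
by rewrite Fl.
Qed.

End Strips.

Section Quotients.
Local Open Scope quotient_scope.
Variables (R : realType) (X : topologicalType).
Implicit Types Phi Psi : set (X -> R).

Lemma Kerb_equiv Phi : equiv_class_of (fun x y : X => `[< Ker Phi x y >]).
Proof.
split=> [x|x y|y x z]; first by apply/asboolP.
  by apply/asboolP/asboolP; exact: Ker_sym.
by move=> /asboolP h1 /asboolP h2; apply/asboolP; exact: Ker_trans h1 h2.
Qed.

Definition KerER Phi : equiv_rel X := EquivRelPack (Kerb_equiv Phi).

Definition KerQ Phi : topologicalType := quotient_topology {eq_quot (KerER Phi)}.

Definition KerPi Phi (x : X) : KerQ Phi := \pi_({eq_quot (KerER Phi)}) x.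

Definition KerRepr Phi (t : KerQ Phi) : X := repr (t : {eq_quot (KerER Phi)}).

Lemma KerReprK Phi t : KerPi Phi (KerRepr t) = t.
Proof. exact: reprK. Qed.

Lemma KerPi_eq Phi x y : KerPi Phi x = KerPi Phi y <-> Ker Phi x y.
Proof.
have h := @eqmodP X (KerER Phi) x y; split=> [e|xy].
  by have /h/asboolP : x = y %[mod {eq_quot (KerER Phi)}] := e.
by apply/h/asboolP.
Qed.

Lemma KerRepr_Ker Phi x : Ker Phi (KerRepr (KerPi Phi x)) x.
Proof. by apply/KerPi_eq; exact: KerReprK. Qed.

Lemma KerPi_continuous Phi : continuous (KerPi Phi).
Proof. exact: pi_continuous. Qed.

Lemma KerQ_open Phi (U : set (KerQ Phi)) : open (KerPi Phi @^-1` U) -> open U.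
Proof. by []. Qed.

End Quotients.

(** * The omega-system of quotients by countable closed families *)

Section OpenlyGenerated.
Variables (R : realType) (X : topologicalType).
Hypotheses (cX : compact [set: X]) (hX : hausdorff_space X) (x0 : X).
Variable SC : set (X -> R) -> Prop.
Hypotheses
  (SC_cont : forall Phi, SC Phi -> forall phi, Phi phi -> continuous phi)
  (SC_bigcup : forall (I : Type) (D : set I) (F : I -> set (X -> R)),
     (forall i, D i -> SC (F i)) -> SC (\bigcup_(i in D) F i))
  (SC_closure : forall Phi, countable Phi -> (forall phi, Phi phi -> continuous phi) ->
     exists Psi, [/\ countable Psi, SC Psi & Phi `<=` Psi])
  (SC_open : forall Phi U, SC Phi -> open U -> open (saturation Phi U)).

Lemma KerPi_open Phi (U : set X) : SC Phi -> open U -> open (KerPi Phi @` U).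
Proof.
move=> hPhi oU; apply: KerQ_open.
rewrite (_ : _ @^-1` _ = saturation Phi U); first exact: SC_open.
apply/seteqP; split=> y /= [x Ux xy]; exists x => //; exact/KerPi_eq.
Qed.

Lemma KerQ_compact (Phi : set (X -> R)) : compact [set: KerQ Phi].
Proof.
rewrite (_ : [set: KerQ Phi] = KerPi Phi @` [set: X]).
  apply: continuous_compact => //; apply: continuous_subspaceT; exact: KerPi_continuous.
by apply/seteqP; split=> // t _; exists (KerRepr t) => //; exact: KerReprK.
Qed.

Lemma KerQ_hausdorff (Phi : set (X -> R)) : SC Phi -> hausdorff_space (KerQ Phi).
Proof.
move=> hPhi; rewrite open_hausdorff => s t /eqP st.
have [phi [Pphi ne]] : exists phi, Phi phi /\ phi (KerRepr s) <> phi (KerRepr t).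
  apply: contrapT => nex; apply: st; rewrite -(KerReprK s) -(KerReprK t).
  apply/KerPi_eq => phi Pphi; apply: contrapT => ne; apply: nex.
  by exists phi.
have [A [B [oA oB As Bt AB]]] := hausdorff_sep (@Rhausdorff R) ne.
have pre (C : set R) : open C -> open [set u : KerQ Phi | C (phi (KerRepr u))].
  move=> oC; apply: KerQ_open.
  rewrite (_ : _ @^-1` _ = phi @^-1` C).
    by have /continuousP := SC_cont hPhi Pphi; apply.
  by apply/seteqP; split=> x /=; rewrite (@KerRepr_Ker R X Phi x phi Pphi).
exists ([set u | A (phi (KerRepr u))], [set u | B (phi (KerRepr u))]).
  by split; rewrite inE.
split; [exact: pre|exact: pre|].
by apply/eqP/seteqP; split=> u // [/= /AB].
Qed.

Lemma KerQ_weight (Phi : set (X -> R)) : SC Phi -> countable Phi -> weight_le_omega (KerQ Phi).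
Proof.
move=> hPhi kPhi; exists ((fun V => KerPi Phi @` V) @` strips Phi); split.
  split=> [_ [V sV <-]|U t oU Ut].
    by apply: KerPi_open => //; apply: strips_open sV; exact: SC_cont.
  have [||||V [sV Vx VU]] := @strips_base R X cX Phi (KerPi Phi @^-1` U) (KerRepr t).
  - exact: SC_cont.
  - by have /continuousP := @KerPi_continuous R X Phi; apply.
  - by move=> x y /KerPi_eq /= ->.
  - by rewrite /= KerReprK.
  exists (KerPi Phi @` V); split; first by exists V.
  by split; [exists (KerRepr t) => //; exact: KerReprK|move=> _ [x /VU ? <-]].
apply: (sub_countable (card_image_le _ _)); exact: strips_countable.
Qed.

Let A := {Phi : set (X -> R) | countable Phi /\ SC Phi}.
Let mkA Phi (k : countable Phi) (h : SC Phi) : A :=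
  exist (fun Phi => countable Phi /\ SC Phi) Phi (conj k h).
Let le (a b : A) := sval a `<=` sval b.
Let Xs (a : A) : topologicalType := KerQ (sval a).
Let p (a b : A) : Xs b -> Xs a := fun t => KerPi (sval a) (KerRepr t).

Let p_pi a b x : le a b -> p a (KerPi (sval b) x) = KerPi (sval a) x.
Proof.
by move=> ab; apply/KerPi_eq; apply: (Ker_sub ab); exact: KerRepr_Ker.
Qed.

Let sup_of (C : set A) : countable C -> exists s, is_lub le C s /\
  sval s = \bigcup_(c in C) sval c.
Proof.
move=> kC.
have kU : countable (\bigcup_(c in C) sval c).
  by apply: bigcup_countable => // c _; case: (svalP c).
have hU : SC (\bigcup_(c in C) sval c).
  by apply: SC_bigcup => c _; case: (svalP c).
exists (mkA kU hU); split=> //; split.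
  by move=> c Cc phi cphi; exists c.
by move=> u hu phi [c Cc cphi]; exact: (hu c).
Qed.

Lemma openly_generated_of_closure : openly_generated X.
Proof.
have A0 : exists a : A, True.
  have [Psi [kPsi hPsi _]] := SC_closure (@countable0 (X -> R))
    (fun phi (h : set0 phi) => False_ind _ h).
  by exists (mkA kPsi hPsi).
have dirA (a b : A) : exists c : A, le a c /\ le b c.
  have [s [[ub _] _]] := sup_of (countable_setU (countable1 a) (countable1 b)).
  by exists s; split; apply: ub; [left|right].
(* By compactness compatible classes of a directed family have a common point. *)
have thread (B : set A) (x : forall a, Xs a) : B !=set0 ->
    (forall a b, B a -> B b -> exists c, B c /\ le a c /\ le b c) ->
    (forall a b, B a -> B b -> le a b -> p a (x b) = x a) ->
    exists x', forall a, B a -> KerPi (sval a) x' = x a.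
  move=> [b0 Bb0] dirB xB.
  pose F (a : {a | B a}) := [set x' | KerPi (sval (sval a)) x' = x (sval a)].
  have [||a|x' [_ Fx]] := @compact_directed_inter X setT {a | B a} F (exist _ b0 Bb0) cX.
  - move=> a; apply: closed_fun_eq.
    + by apply: KerQ_hausdorff; case: (svalP (sval a)).
    + exact: KerPi_continuous.
    + exact: cst_continuous.
  - move=> [a Ba] [b Bb]; have [c [Bc [ac bc]]] := dirB a b Ba Bb.
    exists (exist _ c Bc) => x' /= Fx; rewrite /F /=.
    by split; rewrite /= -(@p_pi _ c)// Fx xB.
  - by exists (KerRepr (x (sval a))); split=> //; exact: KerReprK.
  by exists x' => a Ba; exact: (Fx (exist _ a Ba)).
exists A, le, Xs, (fun a b => @p a b); split; last split.
- split; first by move=> a.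
  split; first by move=> a b c ab bc; exact: subset_trans bc.
  split.
    move=> [a ha] [b hb] ab ba; apply: eq_exist.
    by apply/seteqP; split; [exact: ab|exact: ba].
  split; first exact: A0.
  split; first exact: dirA.
  split; first by move=> C _ /sup_of[s [lub _]]; exists s.
  split.
    move=> a; split; first exact: KerQ_compact.
    by have [k h] := svalP a; split; [exact: KerQ_hausdorff|exact: KerQ_weight].
  split.
    move=> a b ab; split.
      apply/continuousP => U oU; apply: KerQ_open.
      rewrite (_ : _ @^-1` _ = KerPi (sval a) @^-1` U).
        by have /continuousP := @KerPi_continuous R X (sval a); apply.
      by apply/seteqP; split=> x /=; rewrite p_pi.
    move=> y; exists (KerPi (sval b) (KerRepr y)).
    by rewrite p_pi//; exact: KerReprK.
  split; first by move=> a x; exact: KerReprK.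
  split.
    by move=> a b c ab bc x; rewrite -{1 2}(KerReprK x) !p_pi//; exact: subset_trans bc.
  move=> B beta B0 dirB lubB x xB.
  have [x' hx'] := thread B x B0 dirB xB.
  exists (KerPi (sval beta) x'); split.
    by move=> a Ba; rewrite p_pi ?hx'//; exact: lubB.1.
  move=> y' hy'; rewrite -(KerReprK y'); apply/KerPi_eq.
  (* A supremum is given only by its order property. The union of [B] lies in the countable [beta],
     hence is itself an index and an upper bound, so it contains [beta]. *)
  have kB : countable (\bigcup_(a in B) sval a).
    apply: (@sub_countable _ _ _ (sval beta)); last by case: (svalP beta).
    by apply: subset_card_le => phi [a Ba aphi]; exact: (lubB.1 a Ba).
  have hB : SC (\bigcup_(a in B) sval a).
    by apply: SC_bigcup => a _; case: (svalP a).
  have sub : sval beta `<=` \bigcup_(a in B) sval a.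
    by apply: (lubB.2 (mkA kB hB)) => a Ba phi aphi; exists a.
  move=> phi /sub[a Ba aphi].
  have /KerPi_eq : KerPi (sval a) (KerRepr y') = KerPi (sval a) x' by rewrite hx'// -(hy' a Ba).
  by apply.
- move=> a b ab U oU.
  rewrite (_ : _ @` _ = KerPi (sval a) @` (KerPi (sval b) @^-1` U)).
    apply: KerPi_open; first by case: (svalP a).
    by have /continuousP := @KerPi_continuous R X (sval b); apply.
  apply/seteqP; split=> t [y Uy <-].
    by exists (KerRepr y) => //=; rewrite KerReprK.
  by exists (KerPi (sval b) y) => //; exact: p_pi.
pose f x : prod_topology Xs := fun a => KerPi (sval a) x.
have cf : continuous f.
  by apply: ptws_cvg_continuous => a; exact: KerPi_continuous.
have finj x y : f x = f y -> x = y.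
  move=> fxy; apply: contrapT => xy.
  have [phi [cphi ne]] := continuous_separates R cX hX xy.
  have [||Psi [kPsi hPsi sub]] := @SC_closure [set phi].
  - exact: countable1.
  - by move=> _ ->.
  have : f x (mkA kPsi hPsi) = f y (mkA kPsi hPsi) by rewrite fxy.
  by move=> /KerPi_eq /(_ phi (sub _ erefl)).
have fL x : system_limit le (fun a b => @p a b) (f x).
  by move=> a b ab; exact: p_pi.
have surj y : system_limit le (fun a b => @p a b) y -> exists x, f x = y.
  move=> Ly; have [||| x hx] := thread setT y.
  - by have [a _] := A0; exists a.
  - by move=> a b _ _; have [c ?] := dirA a b; exists c.
  - by move=> a b _ _; exact: Ly.
  by exists x; apply: functional_extensionality_dep => a; exact: hx.
have /choice[g hg] (y : prod_topology Xs) : exists x, forall x', f x' = y -> x = x'.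
  have [[x <-]|ny] := pselect (exists x, f x = y).
    by exists x => x' /finj.
  by exists x0 => x' fx'; exfalso; apply: ny; exists x'.
have gf x : g (f x) = x by exact: hg.
exists f, g; split=> //; split=> //; split=> //; split.
  by move=> y /surj[x <-]; rewrite gf.
have -> : system_limit le (fun a b => @p a b) = f @` [set: X].
  by apply/seteqP; split=> y; [move=> /surj[x <-]; exists x|move=> [x _ <-]; exact: fL].
have cid' : continuous (fun x : X => x) by move=> x; exact: cvg_id.
apply: (@inverse_within_continuous X _ X setT f (fun x => x) g cX) => //.
  apply: (@hausdorff_product {classic A}) => a; apply: KerQ_hausdorff.
  by case: (svalP a).
exact: continuous_subspaceT.
Qed.

End OpenlyGenerated.

(** * Sets of cardinality at most aleph-one *)

(** The strict bounds in [o1_bound] express both that the order is uncountable and that no countable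
    set is cofinal. *)
Record omega1_like (I : Type) (lt : I -> I -> Prop) : Prop := {
  o1_irr : forall i, ~ lt i i;
  o1_tr : forall i j k, lt i j -> lt j k -> lt i k;
  o1_tot : forall i j, i = j \/ lt i j \/ lt j i;
  o1_min : forall P : set I, P !=set0 -> exists m, P m /\ forall j, P j -> ~ lt j m;
  o1_count : forall i, countable [set j | lt j i];
  o1_bound : forall C : set I, countable C -> exists u, forall c, C c -> lt c u }.

(** Take the elements with countable initial segment in a well-order of the power set of [nat]. If
    there were only countably many, then either all elements qualify, against Cantor's diagonal
    argument, or the least one that does not would have a countable segment after all. A countable
    unbounded set would likewise cover everything by countable segments. *)
Lemma omega1_exists : exists (I : Type) (lt : I -> I -> Prop), omega1_like lt.
Proof.
have [Rb wo] := wochoice.well_ordering_principle {classic (set nat)}.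
pose T : Type := set nat.
have minE (P : set T) : P !=set0 -> exists m, P m /\ forall j, P j -> Rb m j.
  move=> [x Px]; have [|z [[zP zmin] _]] := wo [pred x | `[< P x >]].
    by exists x; apply/asboolP.
  exists z; split; first by apply/asboolP.
  by move=> j Pj; apply: zmin; apply/asboolP.
have uniqE (P : set T) x y : P x -> P y -> (forall j, P j -> Rb x j) ->
    (forall j, P j -> Rb y j) -> x = y.
  move=> Px Py hx hy; have [|z [_ zu]] := wo [pred x | `[< P x >]].
    by exists x; apply/asboolP.
  rewrite -(zu x); last by split=> [|j /asboolP]; [apply/asboolP|exact: hx].
  by apply: zu; split=> [|j /asboolP]; [apply/asboolP|exact: hy].
have refl x : Rb x x.
  by have [|m [-> h]] := minE [set x]; [exists x|apply: h].
have tot x y : Rb x y \/ Rb y x.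
  have [|m [[->|->] h]] := minE ([set x] `|` [set y]); first by exists x; left.
    by left; apply: h; right.
  by right; apply: h; left.
have anti x y : Rb x y -> Rb y x -> x = y.
  move=> xy yx; apply: (uniqE ([set x] `|` [set y])); [by left|by right| |];
    by move=> j [->|->].
have tr x y z : Rb x y -> Rb y z -> Rb x z.
  move=> xy yz; have [|m [Pm h]] := minE ([set x] `|` [set y] `|` [set z]).
    by exists x; left; left.
  have mx : Rb m x by apply: h; left; left.
  have my : Rb m y by apply: h; left; right.
  have mz : Rb m z by apply: h; right.
  case: Pm => [[e|e]|e]; first by rewrite -e.
    by have -> : x = y by apply: anti => //; rewrite -e.
  by have <- : y = z by apply: anti => //; rewrite -e.
pose lt x y := Rb x y /\ x <> y.
have ltirr x : ~ lt x x by case.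
have lttr x y z : lt x y -> lt y z -> lt x z.
  move=> [xy nxy] [yz nyz]; split; first exact: tr yz.
  by move=> e; apply: nxy; apply: anti => //; rewrite e.
have lttot x y : x = y \/ lt x y \/ lt y x.
  have [->|ne] := pselect (x = y); first by left.
  by have [h|h] := tot x y; right; [left|right]; split=> // e; apply: ne.
have ltmin (P : set T) : P !=set0 -> exists m, P m /\ forall j, P j -> ~ lt j m.
  move=> /minE[m [Pm h]]; exists m; split=> // j Pj [jm ne].
  by apply: ne; apply: anti => //; exact: h.
pose I := {x : T | countable [set y | lt y x]}.
pose ltI (i j : I) := lt (sval i) (sval j).
have inj (i j : I) : sval i = sval j -> i = j.
  by case: i j => i hi [j hj] /= e; exact: eq_exist.
have count (i : I) : countable [set j | ltI j i].
  have /countable_injP[k kinj] := svalP i; apply/countable_injP.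
  exists (k \o sval) => j j'; rewrite !inE => ji j'i /= e.
  by apply: inj; apply: kinj; rewrite ?inE.
have unc : ~ countable [set: I].
  move=> kI.
  have kS : countable ((@sval _ _) @` [set: I]) by apply: (sub_countable (card_image_le _ _)).
  have [all|/existsNP[x nx]] := pselect (forall x : T, countable [set y | lt y x]).
    have kT : countable [set: T].
      apply: sub_countable kS; apply: subset_card_le => x _.
      by exists (exist _ x (all x)).
    have [e he] := countable_enum set0 kT.
    have [n hn] := he [set n | ~ e n n] Logic.I.
    have h1 : ~ e n n by move=> h; have := h; rewrite {1}hn /=.
    by apply: (h1); rewrite hn.
  have [|m [nm hm]] := ltmin [set x | ~ countable [set y | lt y x]]; first by exists x.
  apply: nm; apply: sub_countable kS; apply: subset_card_le => y ym.
  have ky : countable [set z | lt z y] by apply: contrapT => /hm.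
  by exists (exist _ y ky).
exists I, ltI; split.
- by move=> i; exact: ltirr.
- by move=> i j k; exact: lttr.
- by move=> i j; have [/inj ->|] := lttot (sval i) (sval j); [left|right].
- move=> P [i Pi]; have [|x [[j Pj <-] hx]] := ltmin (@sval _ _ @` P).
    by exists (sval i), i.
  by exists j; split=> // l Pl; apply: hx; exists l.
- exact: count.
- move=> C kC; apply: contrapT => nb; apply: unc.
  apply: (@sub_countable _ _ _ (\bigcup_(c in C) [set u | u = c \/ ltI u c])).
    apply: subset_card_le => u _; apply: contrapT => nu; apply: nb; exists u => c Cc.
    have [e|[h|h]] := lttot (sval c) (sval u); last 1 first.
    + by exfalso; apply: nu; exists c => //; right.
    + by exfalso; apply: nu; exists c => //; left; apply: inj.
    + exact: h.
  apply: bigcup_countable => // c _.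
  by apply: (@countable_setU _ [set c]); [exact: countable1|exact: count].
Qed.

Lemma omega1_ind (I : Type) (lt : I -> I -> Prop) : omega1_like lt ->
  forall P : I -> Prop, (forall i, (forall j, lt j i -> P j) -> P i) -> forall i, P i.
Proof.
move=> o1 P hP i; apply: contrapT => nPi.
have [|m [nPm hm]] := o1_min o1 (P := [set j | ~ P j]); first by exists i.
by apply: nPm; apply: hP => j jm; apply: contrapT => nPj; exact: hm nPj jm.
Qed.

(** Elements are ordered lexicographically, by the first [B i] containing them and then by their
    number in a fixed enumeration of that set. *)
Lemma card_le_aleph1_bigcup (I : Type) (lt : I -> I -> Prop) (U : Type) (B : I -> set U) :
  omega1_like lt -> (forall i, countable (B i)) -> card_le_aleph1 (\bigcup_i B i).
Proof.
move=> o1 kB.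
have /choice[rk hrk] (V : U) : exists i, (\bigcup_i B i) V ->
    B i V /\ forall j, lt j i -> ~ B j V.
  have [[i _ BV]|nV] := pselect ((\bigcup_i B i) V).
    have [|m [Bm hm]] := o1_min o1 (P := [set i | B i V]); first by exists i.
    by exists m => _; split=> // j jm /hm.
  have [u _] := o1_bound o1 (@countable0 I).
  by exists u.
have /choice[c hc] (i : I) : exists c : U -> nat, {in B i &, injective c}.
  by have /countable_injP := kB i.
exists (fun V W => lt (rk V) (rk W) \/ (rk V = rk W /\ (c (rk V) V < c (rk V) W)%N)).
split; last split; last split; last split.
- by move=> V _ [/(o1_irr o1)//|[_]]; rewrite ltnn.
- move=> V W Q _ _ _ [h1|[e1 h1]] [h2|[e2 h2]].
  + by left; exact: (o1_tr o1) h2.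
  + by left; rewrite -e2.
  + by left; rewrite e1.
  + by right; split; [rewrite e1|apply: ltn_trans h1 _; rewrite e1].
- move=> V W BV BW; have [e|[h|h]] := o1_tot o1 (rk V) (rk W); last 2 first.
  + by right; left; left.
  + by right; right; left.
  case: (ltngtP (c (rk V) V) (c (rk V) W)) => h.
  + by right; left; right.
  + by right; right; right; rewrite -e.
  left; apply: (hc (rk V)) => //; rewrite inE; first by case: (hrk V BV).
  by rewrite e; case: (hrk W BW).
- move=> C CB [V0 CV0].
  have [|i [[V [CV rV]] hi]] := o1_min o1 (P := [set i | exists V, C V /\ rk V = i]).
    by exists (rk V0), V0.
  have ex : exists n, `[< exists W, [/\ C W, rk W = i & c i W = n] >].
    by exists (c i V); apply/asboolP; exists V.
  case: (ex_minnP ex) => n /asboolP[W [CW rW cW]] nmin.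
  exists W; split=> // Q CQ [h|[e h]].
    by apply: (hi (rk Q)); [exists Q|rewrite -rW].
  rewrite e rW cW in h.
  have : (n <= c i Q)%N.
    by apply: nmin; apply/asboolP; exists Q; split=> //; rewrite e.
  by rewrite leqNgt h.
- move=> V BV.
  apply: (@sub_countable _ _ _ (\bigcup_(j in [set j | j = rk V \/ lt j (rk V)]) B j)).
    apply: subset_card_le => W [BW [h|[e h]]]; exists (rk W); rewrite /=.
    + by right.
    + by case: (hrk W BW).
    + by left.
    + by case: (hrk W BW).
  apply: bigcup_countable => [|j _]; last exact: kB.
  by apply: (@countable_setU _ [set rk V]); [exact: countable1|exact: o1_count].
Qed.

(** * The weight *)

Section Weight.
Variables (R : realType) (X : topologicalType).
Hypotheses (cX : compact [set: X]) (hX : hausdorff_space X).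
Variable SC : set (X -> R) -> Prop.
Hypotheses
  (SC_cont : forall Phi, SC Phi -> forall phi, Phi phi -> continuous phi)
  (SC_bigcup : forall (I : Type) (D : set I) (F : I -> set (X -> R)),
     (forall i, D i -> SC (F i)) -> SC (\bigcup_(i in D) F i))
  (SC_setI : forall Phi Psi, SC Phi -> SC Psi -> SC (Phi `&` Psi))
  (SC_closure : forall Phi, countable Phi -> (forall phi, Phi phi -> continuous phi) ->
     exists Psi, [/\ countable Psi, SC Psi & Phi `<=` Psi])
  (SC_open : forall Phi U, SC Phi -> open U -> open (saturation Phi U))
  (SC_Ker : forall Phi Psi x y, SC Phi -> SC Psi -> Ker (Phi `&` Psi) x y ->
     Ker Phi x y \/ Ker Psi x y).

(** One separating function is added for each of the countably many strips that contain a nontrivial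
    pair, so every such strip meets a class that is split at the next stage. *)
Lemma Ker_separating_step : exists G : set (X -> R) -> set (X -> R),
  forall D, countable D -> SC D -> [/\ countable (G D), SC (G D), D `<=` G D
    & forall V, strips D V -> (exists s t, [/\ V s, V t, Ker D s t & s <> t]) ->
      exists s t, [/\ V s, V t, Ker D s t & ~ Ker (G D) s t]].
Proof.
have /choice[G hG] (D : set (X -> R)) : exists G, countable D -> SC D ->
    [/\ countable G, SC G, D `<=` G
    & forall V, strips D V -> (exists s t, [/\ V s, V t, Ker D s t & s <> t]) ->
      exists s t, [/\ V s, V t, Ker D s t & ~ Ker G s t]].
  have [[kD hD]|nD] := pselect (countable D /\ SC D); last first.
    by exists D => kD hD; exfalso; apply: nD.
  have /choice[sep hsep] (V : set X) : exists phi : X -> R, continuous phi /\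
      ((exists s t, [/\ V s, V t, Ker D s t & s <> t]) ->
       exists s t, [/\ V s, V t, Ker D s t & phi s <> phi t]).
    have [[s [t [Vs Vt st ne]]]|nV] := pselect (exists s t, [/\ V s, V t, Ker D s t & s <> t]).
      have [phi [cphi ne']] := continuous_separates R cX hX ne.
      by exists phi; split=> // _; exists s, t.
    by exists (fun=> 0); split=> //; exact: cst_cont.
  have [||Psi [kPsi hPsi sub]] := @SC_closure (D `|` sep @` strips D).
  - apply: countable_setU => //; apply: (sub_countable (card_image_le _ _)).
    exact: strips_countable.
  - by move=> phi [/(SC_cont hD)//|[V _ <-]]; case: (hsep V).
  exists Psi => _ _; split=> //; first by move=> phi Dphi; apply: sub; left.
  move=> V sV hV; have [_ /(_ hV)[s [t [Vs Vt st ne]]]] := hsep V.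
  exists s, t; split=> // /(_ (sep V)) h; apply: ne; apply: h; apply: sub; right.
  by exists V.
by exists G.
Qed.

Lemma strips_directed (J : Type) (F : J -> set (X -> R)) (j0 : J) V :
  (forall i j, exists k, F i `<=` F k /\ F j `<=` F k) ->
  strips (\bigcup_j F j) V -> exists j, strips (F j) V.
Proof.
move=> dF [l hl <-].
suff [j hj] : exists j, forall t, List.In t l -> F j t.1.1 by exists j, l.
elim: l hl => [|t l IH] hl; first by exists j0.
have [|j hj] := IH; first by move=> u ul; apply: hl; right.
have [i _ Fi] := hl t (or_introl erefl).
have [k [ik jk]] := dF i j; exists k => u [<-|ul]; first exact: ik.
by apply: jk; exact: hj.
Qed.

Section Chain.
Variables (I : Type) (lt : I -> I -> Prop) (o1 : omega1_like lt).
Variable M : I -> set (X -> R).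
Hypotheses (kM : forall a, countable (M a)) (hM : forall a, SC (M a))
  (M_mono : forall a b, lt a b -> M a `<=` M b)
  (M_lim : forall (al : nat -> I) b, (forall n, lt (al n) (al n.+1)) ->
     (forall n, lt (al n) b) -> (forall c, lt c b -> exists n, ~ lt (al n) c) ->
     M b `<=` \bigcup_n M (al n))
  (M_sep : forall a V, strips (M a) V ->
     (exists s t, [/\ V s, V t, Ker (M a) s t & s <> t]) ->
     exists b s t, [/\ V s, V t, Ker (M a) s t & ~ Ker (M b) s t]).

Let MM := \bigcup_a M a.

Let MM_SC : SC MM. Proof. by apply: SC_bigcup. Qed.

Let M_MM a : M a `<=` MM. Proof. by move=> phi; exists a. Qed.

Let M_dir a b : exists c, M a `<=` M c /\ M b `<=` M c.
Proof.
by have [->|[/M_mono ab|/M_mono ba]] := o1_tot o1 a b;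
   [exists b; split|exists b; split|exists a; split].
Qed.

Let i0 : I. Proof. by have [u _] := cid (o1_bound o1 (@countable0 I)). Qed.

Let M_countable_sub C : countable C -> C `<=` MM -> exists a, C `<=` M a.
Proof.
move=> kC CM.
have /choice[a ha] (phi : X -> R) : exists a, C phi -> M a phi.
  have [/CM[a _ h]|n] := pselect (C phi); first by exists a.
  by exists i0.
have [u hu] := o1_bound o1 (sub_countable (card_image_le a C) kC).
by exists u => phi Cphi; apply: (M_mono (hu _ _)) (ha _ Cphi); exists phi.
Qed.

(* The points at which [M a] already determines everything that the whole chain
   determines. *)
Let full a := [set x | forall s, Ker (M a) x s -> Ker MM x s].

Let full_mono a b : M a `<=` M b -> full a `<=` full b.
Proof. by move=> ab x fx s /(Ker_sub ab); exact: fx. Qed.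

Let full_Ker a x y : Ker (M a) x y -> full a x -> full a y.
Proof.
move=> xy fx s ys; apply: (Ker_trans (Ker_sym (fx _ xy))).
by apply: fx; exact: Ker_trans ys.
Qed.

(** If [psi] separates [x] from a companion [s] with the same [M a]-class, then openness of
    saturations provides a nearby companion for every point close to [x], and [psi] still separates
    them. *)
Let full_compl_open a : open (~` full a).
Proof.
rewrite openE => x /existsNP[s /not_implyP[xs /existsNP[psi /not_implyP[Mpsi ne]]]].
have cpsi := SC_cont MM_SC Mpsi.
have [A [B [oA oB Ax Bs AB]]] := hausdorff_sep (@Rhausdorff R) ne.
have oA' : open (psi @^-1` A) by move/continuousP: cpsi; apply.
have oB' : open (psi @^-1` B) by move/continuousP: cpsi; apply.
have nb : nbhs x (psi @^-1` A `&` saturation (M a) (psi @^-1` B)).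
  apply: open_nbhs_nbhs; split; first by apply: openI => //; exact: SC_open.
  by split=> //; exists s => //; exact: Ker_sym.
apply: filterS nb => x' [Ax' [s' Bs' s'x']] fx'.
apply: (AB _ Ax'); rewrite /= (fx' s' (Ker_sym s'x') psi Mpsi).
exact: Bs'.
Qed.

(** Let [N] be countable, closed and separate [x] from [y]; then [M a] can be chosen to contain
    [N]&[MM]. If [s] agreed with [x] on [M a] but not on [MM], [SC_Ker] would make [s] agree with
    [x] on [N], and likewise with [y], so [N] would not separate [x] from [y]. *)
Lemma full_ex x y : x <> y -> Ker MM x y -> exists a, full a x.
Proof.
move=> xy Kxy; have [phi [cphi ne]] := continuous_separates R cX hX xy.
have [||N [kN hN sub]] := @SC_closure [set phi]; [exact: countable1|by move=> _ ->|].
have [||a ha] := @M_countable_sub (N `&` MM).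
- by apply: sub_countable kN; apply: subset_card_le; exact: subIsetl.
- exact: subIsetr.
exists a => s xs; apply: contrapT => nxs.
have Dxs : Ker (N `&` MM) x s by exact: Ker_sub xs.
have Dxy : Ker (N `&` MM) x y by apply: (Ker_sub _ Kxy); exact: subIsetr.
have Dys : Ker (N `&` MM) y s by exact: Ker_trans (Ker_sym Dxy) Dxs.
have [Nxs|//] := SC_Ker hN MM_SC Dxs.
have [Nys|Mys] := SC_Ker hN MM_SC Dys; last by apply: nxs; exact: Ker_trans Mys.
apply: ne; rewrite (Nxs phi (sub _ erefl)).
by rewrite (Nys phi (sub _ erefl)).
Qed.

(** The points not separated from some other point form an open saturated set [F], all of whose
    points are full at some stage. A stage [b] is found at which an entire strip [V0] inside [F] is
    full; no later stage can then split a class meeting [V0], against [M_sep]. *)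
Lemma chain_separates x y : Ker MM x y -> x = y.
Proof.
move=> Kxy; apply: contrapT => xy.
pose F := [set x | exists2 y, x <> y & Ker MM x y].
have oF : open F.
  rewrite openE => u [v uv Kuv].
  have [A [B [oA oB Au Bv AB]]] := hausdorff_sep hX uv.
  have nb : nbhs u (A `&` saturation MM B).
    apply: open_nbhs_nbhs; split; first by apply: openI => //; exact: SC_open.
    by split=> //; exists v => //; exact: Ker_sym.
  apply: filterS nb => u' [Au' [v' Bv' v'u']]; exists v'; last exact: Ker_sym.
  by move=> e; apply: (AB _ Au'); rewrite e.
have satF u v : Ker MM u v -> F u -> F v.
  move=> Kuv Fu; have [<-//|ne] := pselect (u = v).
  by exists u; [move=> e; exact: ne|exact: Ker_sym].
have Fx : F x by exists y.
have [V0 [sV0 V0x V0F]] := strips_base cX (SC_cont MM_SC) oF satF Fx.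
have V0y : V0 y by exact: strips_Ker sV0 Kxy V0x.
have [a0 sa0] := strips_directed i0 M_dir sV0.
have /choice[ix hix] (u : X) : exists a, F u -> full a u.
  have [[v uv Kuv]|nF] := pselect (F u); last by exists i0.
  by have [a fa] := full_ex uv Kuv; exists a.
(* One closing-off step: choose a point in each of the countably many strips of [M a], and bound the
   stages at which the chosen points are full. *)
have /choice[f hf] (a : I) : exists b, lt a b /\ forall V, strips (M a) V ->
    V `<=` V0 -> V !=set0 -> exists2 q, V q & full b q.
  have /choice[q hq] (V : set X) : exists q, V !=set0 -> V q.
    by have [[q Vq]|n] := pselect (V !=set0); [exists q|exists x].
  have [b hb] := o1_bound o1 (countable_setU (countable1 a)
    (sub_countable (card_image_le (fun V => ix (q V)) (strips (M a)))
       (strips_countable (kM a)))).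
  exists b; split; first by apply: hb; left.
  move=> V sV VV0 V0n; have Vq := hq V V0n; exists (q V) => //.
  have : full (ix (q V)) (q V) by apply: hix; apply: V0F; exact: VV0.
  by apply: full_mono; apply: M_mono; apply: hb; right; exists V.
(* At the supremum [b] of this sequence the points of [full b] are dense in [V0],
   hence fill it as [full b] is closed. *)
pose al := fix al n := if n is m.+1 then f (al m) else a0.
have al_lt n : lt (al n) (al n.+1) by case: (hf (al n)).
have [|b [hb bmin]] := o1_min o1 (P := [set b | forall n, lt (al n) b]).
  have [b hb] := o1_bound o1 (sub_countable (card_image_le al [set: nat]) (countableP _)).
  by exists b => n; apply: hb; exists n.
have Mb : M b `<=` \bigcup_n M (al n).
  apply: M_lim => // c cb; apply: contrapT => nc; apply: (bmin c) cb => n.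
  by apply: contrapT => h; apply: nc; exists n.
have al_le n m : (n <= m)%N -> M (al n) `<=` M (al m).
  elim: m => [|m IH]; first by rewrite leqn0 => /eqP ->.
  rewrite leq_eqVlt => /orP[/eqP -> //|/IH h].
  by apply: subset_trans h _; apply: M_mono; exact: al_lt.
have al_dir n m : exists k, M (al n) `<=` M (al k) /\ M (al m) `<=` M (al k).
  by exists (maxn n m); split; apply: al_le; rewrite ?leq_maxl ?leq_maxr.
have sb0 : strips (M b) V0 by apply: strips_mono sa0; apply: M_mono; exact: (hb 0%N).
have V0full : V0 `<=` full b.
  move=> v V0v; apply: contrapT => nfv.
  have oU : open (V0 `&` ~` full b).
    by apply: openI; [apply: strips_open sb0; exact: SC_cont|exact: full_compl_open].
  have [||||V [sV Vv VU]] := @strips_base R X cX (M b) (V0 `&` ~` full b) v => //.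
  - exact: SC_cont.
  - move=> u w uw [V0u nu]; split; first exact: strips_Ker sb0 uw V0u.
    by move=> fw; apply: nu; apply: full_Ker fw; exact: Ker_sym.
  have [n sn] := strips_directed 0%N al_dir (strips_mono Mb sV).
  have [_ /(_ V sn)[||q Vq fq]] := hf (al n).
  - by move=> u /VU[].
  - by exists v.
  have [_] := VU q Vq; apply.
  by apply: full_mono fq; apply: M_mono; exact: (hb n.+1).
have [|c [s [t [Vs Vt st nst]]]] := @M_sep b V0 sb0.
  by exists x, y; split=> //; apply: (Ker_sub _ Kxy); exact: M_MM.
apply: nst; apply: (Ker_sub (@M_MM c)); exact: V0full.
Qed.

Lemma chain_weight : weight_le_omega1 X.
Proof.
exists (\bigcup_a strips (M a)); split; last first.
  by apply: card_le_aleph1_bigcup o1 _ => a; exact: strips_countable.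
split=> [V [a _ sV]|U x oU Ux].
  by apply: strips_open sV; exact: SC_cont.
have [|V [sV Vx VU]] := strips_base cX (SC_cont MM_SC) oU _ Ux.
  by move=> u v /chain_separates ->.
have [a sa] := strips_directed i0 M_dir sV.
by exists V; split=> //; exists a.
Qed.

End Chain.

Lemma weight_of_closure : weight_le_omega1 X.
Proof.
have [I [lt o1]] := omega1_exists.
have [G hG] := Ker_separating_step.
have wf : well_founded lt.
  by move=> i; apply: (omega1_ind o1 (P := Acc lt)) => j hj; constructor.
(* Recursion over all earlier stages at once avoids distinguishing successors from limits. *)
pose step (a : I) (rec : forall b, lt b a -> set (X -> R)) : set (X -> R) :=
  [set phi | exists b (h : lt b a), G (rec b h) phi].
pose M := Fix wf (fun=> set (X -> R)) step.
have ME a : M a = \bigcup_(b in [set b | lt b a]) G (M b).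
  rewrite {1}/M Fix_eq.
    apply/seteqP; split=> phi [b]; first by move=> [ba Gphi]; exists b.
    by move=> ba Gphi; exists b, ba.
  move=> b g g' gg'; congr step.
  by apply: functional_extensionality_dep => c; apply: functional_extensionality_dep => h.
have hM a : countable (M a) /\ SC (M a).
  move: a; apply: (omega1_ind o1) => a IH; rewrite ME; split.
    apply: bigcup_countable => [|b /IH[kb hb]]; first exact: (o1_count o1).
    by case: (hG _ kb hb).
  by apply: SC_bigcup => b /IH[kb hb]; case: (hG _ kb hb).
have GM a b : lt a b -> G (M a) `<=` M b by move=> ab; rewrite [M b]ME => phi; exists a.
have MG a : M a `<=` G (M a) by case: (hM a) => k h; case: (hG _ k h).
have MM a b : lt a b -> M a `<=` M b by move=> /GM; apply: subset_trans.
apply: (@chain_weight I lt o1 M) => //.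
- by move=> a; case: (hM a).
- by move=> a; case: (hM a).
- move=> al b al_lt al_b bmin; rewrite ME => phi [c cb Gphi].
  (* Here [c] is at most [al n], so [G (M c)] is contained in the stage after [al n], not
     necessarily in [M (al n)] itself. *)
  have [n nlt] := bmin c cb; exists n.+1 => //.
  apply: (GM c) Gphi; have [<-|[//|cn]] := o1_tot o1 (al n) c; first exact: al_lt.
  exact: (o1_tr o1) cn (al_lt n).
- move=> a V sV hV; have [k h] := hM a.
  have [_ _ _ /(_ V sV hV)[s [t [Vs Vt st nst]]]] := hG _ k h.
  have [b hb] := o1_bound o1 (countable1 a).
  exists b, s, t; split=> // Kb; apply: nst; apply: (Ker_sub _ Kb).
  by apply: GM; exact: hb.
Qed.

End Weight.

Lemma absolute_retract_openly_generated (R : realType) (X : topologicalType) :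
  compact [set: X] -> hausdorff_space X -> [set: X] !=set0 ->
  absolute_retract (@HX R X) -> openly_generated X /\ weight_le_omega1 X.
Proof.
move=> cX hX [x0 _] AR.
have [||r [cr [rZ re]]] := AR _ (@opc_cube_compact R X) (@opc_cube_hausdorff R X) (@emb R X).
- exact/continuous_subspaceT/emb_continuous.
- by move=> z w _ _; exact: emb_inj.
have [T hT] := support_family_ex cX cr rZ.
have hI := @support_closedI R X T.
have hU := @support_closed_bigcup R X T.
have hC := @support_closure R X r T hT.
have hc Phi : support_closed T Phi -> forall phi, Phi phi -> continuous phi.
  by move=> h phi /h[].
have hO := @saturation_open R X cX hX r cr rZ re T hT.
split; first exact: (@openly_generated_of_closure R X cX hX x0 (support_closed T)).
apply: (@weight_of_closure R X cX hX (support_closed T)) => //.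
by move=> Phi Psi x y; exact: (@Ker_setI R X cX r cr rZ re T hT).
Qed.

Theorem theorem1p2 (R : realType) (X : topologicalType) :
  compact [set: X] -> hausdorff_space X -> [set: X] !=set0 ->
  (@absolute_retract (HXspace R X) (@HX R X) <->
   (openly_generated X /\ weight_le_omega1 X)).
Proof.
move=> cX hX X0; split; first exact: absolute_retract_openly_generated.
by move=> [og w]; exact: openly_generated_absolute_retract.
Qed.
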